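(* Let $\alpha\in(0,1)$ with $\alpha\neq1/m$ for all $m\in\mathbb N$, $0<\beta<\alpha$, $N=\lfloor1/\alpha\rfloor$, and let $f_1,\dots,f_d\in C^\infty(\mathbb R^n,\mathbb R^n)\cap C^{N+1}_b$. Let $\Phi(\xi,\mathbf X)=\mathbf Y$ be the It\^o–Lyons map, sending $\xi\in\mathbb R^n$ and an $\alpha$-branched rough path $\mathbf X\in\mathscr C^\alpha$ to the solution, as a controlled path, of $dY_t=\sum_{i=1}^df_i(Y_t)\,dX^i_t$, $Y_0=\xi$. Then $\Phi$ satisfies the local Lipschitz bound: for every $M>0$ there is a constant $C$ such that $$|||\Phi(\xi,\mathbf X);\Phi(\tilde\xi,\tilde{\mathbf X})|||_\alpha\le C\big(|\xi-\tilde\xi|+\rho_\alpha(\mathbf X,\tilde{\mathbf X})\big)$$ for all $\xi,\tilde\xi\in\mathbb R^n$ and $\mathbf X,\tilde{\mathbf X}\in\mathscr C^\alpha$ with $|\xi|,|\tilde\xi|,|||\mathbf X|||_\alpha,|||\tilde{\mathbf X}|||_\alpha\le M$. Hence the It\^o–Lyons map is a parameter-dependent continuous cross section of the Banach bundle $p:E^{\alpha,\beta}\to\mathscr C^\alpha$: the map $\Phi:\mathbb R^n\times\mathscr C^\alpha\to E^{\alpha,\beta}$ is continuous and $p(\Phi(\xi,\mathbf X))=\mathbf X$ for all $\xi,\mathbf X$.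
   Context: Forests. Labels are $A=\{1,\dots,d\}$. $\mathcal F$ is the set of forests (commutative monomials of non-planar rooted trees with nodes labelled by $A$), including the empty forest $\mathbf 1$; $\mathcal H$ is the real vector space with basis $\mathcal F$, i.e. the polynomial algebra on trees. $|h|$ is the number of nodes; $\mathcal F_{(m)}=\{h\in\mathcal F:|h|\le m\}$, $\mathcal F^+_{(m)}=\mathcal F_{(m)}\setminus\{\mathbf 1\}$; $\mathcal T_{(m)}$ denotes the trees with at most $m$ nodes. $[h]_a$ is the tree obtained by grafting the trees of $h$ on a new root labelled $a$. The coproduct $\Delta$ is the algebra morphism with $\Delta[h]_a=(\mathrm{id}\otimes[\cdot]_a)\Delta h+[h]_a\otimes\mathbf 1$. On $\mathcal H^*$, $\langle\phi\star\psi,h\rangle=\langle\phi\otimes\psi,\Delta h\rangle$. A forest $h$ is identified with the functional $h'\mapsto\delta_{h,h'}$, so $\bar h\star h$ is a finite linear combination of forests. Rough paths. $T>0$ is fixed. An $\alpha$-branched rough path is a family $\mathbf X=(\mathbf X_{s,t})_{s,t\in[0,T]}$ of characters (unital multiplicative linear functionals) of $\mathcal H$ with $\mathbf X_{s,u}\star\mathbf X_{u,t}=\mathbf X_{s,t}$ and $\sup_{s\ne t}|\langle\mathbf X_{s,t},h\rangle|/|t-s|^{\alpha|h|}<\infty$ for all $h\in\mathcal F$. $\mathbf X^h_{s,t}=\langle\mathbf X_{s,t},h\rangle$, $\|F\|_\gamma=\sup_{s\neq t}|F_{s,t}|/|t-s|^\gamma$. $\mathscr C^\alpha$ is the set of these,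 with metric $\rho_\alpha(\mathbf X,\tilde{\mathbf X})=\max_{h\in\mathcal F^+_{(N)}}\|\mathbf X^h-\tilde{\mathbf X}^h\|_{|h|\alpha}$, and $|||\mathbf X|||_\alpha=\max_{h\in\mathcal F^+_{(N)}}\|\mathbf X^h\|_{|h|\alpha}$. Controlled paths ($\mathbb R^n$-valued, i.e. coefficients in $\mathbb R^n$). For a path $\mathbf Z$ with coefficients $\langle h,\mathbf Z_t\rangle\in\mathbb R^n$, $h\in\mathcal F_{(N-1)}$, put $R^h_{s,t}=\langle h,\mathbf Z_t\rangle-\langle\mathbf X_{s,t}\star h,\mathbf Z_s\rangle$ and, for $0<\gamma\le\alpha$, $|||\mathbf Z|||_\gamma=\sum_{h\in\mathcal F_{(N-1)}}(|\langle h,\mathbf Z_0\rangle|+\|R^h\|_{(N-|h|)\gamma})$. $\mathscr D^\alpha_{\mathbf X}$ consists of the $\mathbf Z$ with $|||\mathbf Z|||_\alpha<\infty$; $\mathscr D^{\alpha,\beta}_{\mathbf X}$ is its closure under $|||\cdot|||_\beta$. For $\mathbf Z,\tilde{\mathbf Z}$ controlled by $\mathbf X,\tilde{\mathbf X}$ with respective remainders $R^h,\tilde R^h$, $|||\mathbf Z;\tilde{\mathbf Z}|||_\gamma=\sum_{h\in\mathcal F_{(N-1)}}(|\langle h,\mathbf Z_0-\tilde{\mathbf Z}_0\rangle|+\|R^h-\tilde R^h\|_{(N-|h|)\gamma})$. $E^{\alpha,\beta}=\bigsqcup_{\mathbf X\in\mathscr C^\alpha}\mathscr D^{\alpha,\beta}_{\mathbf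 X}$, $p$ is the projection to the controlling rough path, and the topology of $E^{\alpha,\beta}$ is that of the metric $\rho_\alpha(p(x),p(y))+|||x;y|||_\beta$ (which equals the topology of its Banach bundle structure). Rough differential equations. For $\varphi:\mathbb R^n\to\mathbb R^n$, $D^m\varphi(y):(v_1,\dots,v_m)$ is the $m$-th derivative applied to $v_1,\dots,v_m$. Elementary differentials: $f_{\mathbf 1}(y)=y$, and $f_{[\tau_1\cdots\tau_m]_i}=D^mf_i:(f_{\tau_1},\dots,f_{\tau_m})$ for trees $\tau_1,\dots,\tau_m$ (so $f_{[\mathbf 1]_i}=f_i$). $\sigma(\tau)$ is the symmetry factor of $\tau$ (order of the automorphism group of the labelled rooted tree). $Y$ solves the equation if $Y_t-Y_s=\sum_{\tau\in\mathcal T_{(N)}}\frac1{\sigma(\tau)}f_\tau(Y_s)\mathbf X^\tau_{s,t}+r_{s,t}$ with $\|r\|_{(N+1)\alpha}<\infty$, and $\mathbf Y_t=\sum_{\tau\in\mathcal T_{(N-1)}\cup\{\mathbf 1\}}\frac1{\sigma(\tau)}f_\tau(Y_t)\tau$ (with $\sigma(\mathbf 1)=1$) belongs to $\mathscr D^\alpha_{\mathbf X}$. It is known that for $f_i\in C_b^{N+1}$ (bounded derivatives up to order $N+1$, the function included) there is a unique solution for every $\xi$; $\Phi(\xi,\mathbf X):=\mathbf Y$. *)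

(* Defs.v *)
From HB Require Import structures.
From mathcomp Require Import all_boot all_order all_algebra perm.
From mathcomp Require Import all_classical all_reals all_analysis.

Set Implicit Arguments.
Unset Strict Implicit.
Unset Printing Implicit Defensive.

Import Order.TTheory GRing.Theory Num.Theory.
Import numFieldNormedType.Exports.

Inductive ptree (d : nat) : Type := PNode of 'I_d & seq (ptree d).

Section PlanarTrees.
Variable d : nat.
Implicit Types (t u : ptree d) (s : seq (ptree d)).

Lemma ptree_ind' (P : ptree d -> Prop) :
  (forall a s, foldr (fun t Q => P t /\ Q) True s -> P (PNode a s)) ->
  forall t, P t.
Proof.
move=> H; fix IH 1 => -[a s]; apply: H.
by elim: s => [|t s IHs] //=; split.
Qed.

Fixpoint ptree_encode t : GenTree.tree void :=
  let: PNode a s := t in GenTree.Node a [seq ptree_encode u | u <- s].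

Fixpoint ptree_decode (g : GenTree.tree void) : option (ptree d) :=
  match g with
  | GenTree.Leaf _ => None
  | GenTree.Node k s =>
      omap (fun a => PNode a (pmap ptree_decode s)) (insub k)
  end.

Lemma ptree_encodeK : pcancel ptree_encode ptree_decode.
Proof.
elim/ptree_ind' => a s IHs /=; rewrite valK /=; congr (Some (PNode a _)).
by elim: s IHs => [|t s IH] //= [-> /IH ->].
Qed.

HB.instance Definition _ := Countable.copy (ptree d) (pcan_type ptree_encodeK).

Fixpoint tsize t : nat := let: PNode _ s := t in (sumn (map tsize s)).+1.

Definition ple t u : bool := (pickle t <= pickle u)%N.

Lemma ple_total : total ple. Proof. by move=> t u; exact: leq_total. Qed.
Lemma ple_trans : transitive ple. Proof. by move=> t u v; exact: leq_trans. Qed.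
Lemma ple_anti : antisymmetric ple.
Proof. by move=> t u /anti_leq /(pcan_inj pickleK). Qed.

(* Sorting recursively the children of every node with respect to the (arbitrary)
   total order [ple] selects exactly one planar representative in each class of
   planar trees that differ only by the order of the children. *)
Fixpoint tnorm t : ptree d :=
  let: PNode a s := t in PNode a (sort ple (map tnorm s)).

Definition fnorm s := sort ple (map tnorm s).

Fixpoint tnormal t : bool :=
  let: PNode _ s := t in sorted ple s && all tnormal s.

Definition fnormal s := sorted ple s && all tnormal s.

Lemma tnorm_normal t : tnormal (tnorm t).
Proof.
elim/ptree_ind': t => a s IHs /=; rewrite sort_sorted ?all_sort /=; last first.
  exact: ple_total.
by elim: s IHs => [|t s IH] //= [-> /IH].
Qed.

Lemma fnorm_normal s : fnormal (fnorm s).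
Proof.
apply/andP; split; first by apply: sort_sorted; exact: ple_total.
by rewrite all_sort all_map; apply/allP => t _ /=; exact: tnorm_normal.
Qed.

Lemma tnorm_id t : tnormal t -> tnorm t = t.
Proof.
elim/ptree_ind': t => a s IHs /= /andP[sort_s all_s].
have -> : map tnorm s = s.
  by elim: s IHs all_s {sort_s} => [|t s IH] //= [IHt /IH IHs] /andP[/IHt-> /IHs->].
by rewrite sorted_sort //; exact: ple_trans.
Qed.

Lemma fnorm_id s : fnormal s -> fnorm s = s.
Proof.
move=> /andP[sort_s /allP all_s]; rewrite /fnorm.
rewrite (_ : map tnorm s = s) ?sorted_sort //; first exact: ple_trans.
by rewrite -[RHS]map_id; apply/eq_in_map => t /all_s /tnorm_id.
Qed.

End PlanarTrees.

Record forest (d : nat) :=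
  Forest { planar :> seq (ptree d); planarP : fnormal planar }.

Section Forests.
Variable d : nat.

HB.instance Definition _ := [isSub of forest d for @planar d].
HB.instance Definition _ := [Countable of forest d by <:].

Implicit Types (h : forest d) (s : seq (ptree d)) (t : ptree d).

Definition mkforest s : forest d := Forest (fnorm_normal s).

Lemma mkforestK h : mkforest h = h.
Proof. by apply: val_inj; exact/fnorm_id/planarP. Qed.

Lemma perm_mkforest s1 s2 : perm_eq s1 s2 -> mkforest s1 = mkforest s2.
Proof.
move=> s12; apply: val_inj; apply/perm_sortP.
- exact: ple_total.
- exact: ple_trans.
- exact: ple_anti.
- exact: perm_map.
Qed.

Definition fone : forest d := mkforest [::].
Definition fmul h1 h2 : forest d := mkforest (h1 ++ h2).
Definition graft (a : 'I_d) h : forest d := mkforest [:: PNode a h].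

Definition fsize h : nat := sumn (map (@tsize d) h).

Definition is_tree h : bool := size h == 1.

Lemma val_mkforest s : all (@tnormal d) s -> mkforest s = sort (@ple d) s :> seq _.
Proof.
move=> /allP ns; rewrite /= /fnorm; congr sort.
by rewrite -[RHS]map_id; apply/eq_in_map => t /ns /tnorm_id.
Qed.

Lemma all_tnormal h : all (@tnormal d) h.
Proof. by have /andP[] := planarP h. Qed.

Lemma val_fmul h1 h2 : fmul h1 h2 = sort (@ple d) (h1 ++ h2) :> seq _.
Proof. by rewrite val_mkforest // all_cat !all_tnormal. Qed.

Lemma val_graft a h : graft a h = [:: PNode a h] :> seq _.
Proof. by rewrite val_mkforest //= andbT; exact: planarP. Qed.

Lemma fmulC : commutative fmul.
Proof. by move=> h1 h2; apply: perm_mkforest; rewrite perm_catC. Qed.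

Lemma fmul1f : left_id fone fmul.
Proof. by move=> h; rewrite -[RHS]mkforestK. Qed.

Lemma fmulf1 : right_id fone fmul.
Proof. by move=> h; rewrite fmulC fmul1f. Qed.

Lemma fmulA : associative fmul.
Proof.
move=> h1 h2 h3; apply: perm_mkforest; rewrite !val_fmul.
apply: (@perm_trans _ (h1 ++ h2 ++ h3)).
  by rewrite perm_cat2l perm_sort.
by rewrite catA perm_cat2r perm_sym perm_sort.
Qed.

HB.instance Definition _ := Monoid.isComLaw.Build (forest d) fone fmul fmulA fmulC fmul1f.

(* Planar forests of depth and width at most [m]. *)
Fixpoint pforests (m : nat) : seq (seq (ptree d)) :=
  if m is m'.+1 then
    [::] :: [seq t :: s | t <- [seq PNode a s | a <- enum 'I_d, s <- pforests m'],
                          s <- pforests m']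
  else [:: [::]].

Definition forests_upto (m : nat) : seq (forest d) :=
  undup [seq h <- map mkforest (pforests m) | fsize h <= m]%N.

Lemma mem_pforests m s : (sumn (map (@tsize d) s) <= m)%N -> s \in pforests m.
Proof.
elim: m s => [|m IHm] [|[a s1] s2] //=.
rewrite addSn ltnS => le_m; rewrite in_cons /=; apply/allpairsP.
exists (PNode a s1, s2); split=> //=; last first.
  by apply/IHm/(leq_trans _ le_m)/leq_addl.
apply/allpairsP; exists (a, s1); split=> //=; first exact: mem_enum.
by apply/IHm/(leq_trans _ le_m)/leq_addr.
Qed.

Lemma mem_forests_upto m h : (h \in forests_upto m) = (fsize h <= m)%N.
Proof.
rewrite mem_undup mem_filter andb_idr // => le_m.
by apply/mapP; exists (val h); [exact: mem_pforests | rewrite mkforestK].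
Qed.

End Forests.

(* F_(m), the forests with at most [m] nodes, as a finite type. *)
Notation "''F_(' d ; m )" := (seq_sub (forests_upto d m))
  (at level 0, d, m at level 200, format "''F_(' d ;  m )").

Section Coproduct.
Variable d : nat.
Implicit Types (h : forest d) (t : ptree d).

(* The coproduct of a forest has natural number coefficients: a tensor
   sum_k g_k (x) h_k is represented by the list, with multiplicities, of the
   pairs (g_k, h_k). *)
Definition tensor := seq (forest d * forest d).

Definition tensor_one : tensor := [:: (fone d, fone d)].

Definition tensor_mul (A B : tensor) : tensor :=
  [seq (fmul p.1 q.1, fmul p.2 q.2) | p <- A, q <- B].

Fixpoint tree_coprod t : tensor :=
  let: PNode a s := t in
  rcons [seq (p.1, graft a p.2)
        | p <- foldr tensor_mul tensor_one (map tree_coprod s)]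
        (mkforest [:: t], fone d).

Definition coprod h : tensor :=
  foldr tensor_mul tensor_one (map tree_coprod h).

Lemma tensor_mulr1 (A : tensor) : tensor_mul A tensor_one = A.
Proof.
rewrite /tensor_mul /tensor_one; elim: A => [|[g h] A IHA] //=.
by rewrite !fmulf1 IHA.
Qed.

Lemma tensor_mul1 (A : tensor) : tensor_mul tensor_one A = A.
Proof.
rewrite /tensor_mul /tensor_one /= cats0 -[RHS]map_id.
by apply: eq_map => -[g h] /=; rewrite !fmul1f.
Qed.

Lemma coprod_graft a h :
  coprod (graft a h) =
  rcons [seq (p.1, graft a p.2) | p <- coprod h] (graft a h, fone d).
Proof. by rewrite /coprod val_graft /= tensor_mulr1. Qed.

Lemma coprod_one : coprod (fone d) = tensor_one.
Proof. by []. Qed.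

Lemma perm_tensor_mulr (A B C : tensor) :
  perm_eq B C -> perm_eq (tensor_mul A B) (tensor_mul A C).
Proof.
move=> BC; rewrite /tensor_mul; elim: A => [|p A IHA] //=.
by apply: perm_cat => //; exact: perm_map.
Qed.

Lemma tensor_mulA (A B C : tensor) :
  tensor_mul A (tensor_mul B C) = tensor_mul (tensor_mul A B) C.
Proof.
elim: A => [|p A IHA] //.
transitivity ([seq (fmul p.1 q.1, fmul p.2 q.2) | q <- tensor_mul B C]
              ++ tensor_mul A (tensor_mul B C)); first by [].
rewrite IHA /tensor_mul /= allpairs_cat; congr (_ ++ _).
elim: B {IHA} => [|q B IHB] //=; rewrite map_cat IHB; congr (_ ++ _).
by rewrite -map_comp; apply: eq_map => r /=; rewrite !fmulA.
Qed.

Lemma perm_tensor_mulC (A B : tensor) :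
  perm_eq (tensor_mul A B) (tensor_mul B A).
Proof.
elim: A => [|p A IHA]; first by rewrite /tensor_mul allpairs0r.
rewrite perm_sym; rewrite /tensor_mul (perm_allpairs_consr _ _ (fun=> p) (fun=> A)).
apply: perm_cat; last by rewrite perm_sym.
rewrite [X in perm_eq X _](_ : _ = [seq (fmul p.1 q.1, fmul p.2 q.2) | q <- B]) //.
by apply: eq_map => q; rewrite (fmulC q.1) (fmulC q.2).
Qed.

Lemma perm_foldr_tensor (As Bs : seq tensor) : perm_eq As Bs ->
  perm_eq (foldr tensor_mul tensor_one As) (foldr tensor_mul tensor_one Bs).
Proof.
have foldr_cat_mul (s1 s2 : seq tensor) :
    foldr tensor_mul tensor_one (s1 ++ s2) =
    tensor_mul (foldr tensor_mul tensor_one s1) (foldr tensor_mul tensor_one s2).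
  elim: s1 => [|A s1 IHs] /=; first by rewrite tensor_mul1.
  by rewrite IHs tensor_mulA.
move=> AB; apply/seq.permP => a.
apply: (catCA_perm_subst (F := fun s => count a (foldr tensor_mul tensor_one s))) AB.
move=> s1 s2 s3 /=; move: a; apply/seq.permP; rewrite !foldr_cat_mul !tensor_mulA.
set A := foldr _ _ s1; set B := foldr _ _ s2; set C := foldr _ _ s3.
rewrite (permPl (perm_tensor_mulC _ C)) perm_sym (permPl (perm_tensor_mulC _ C)).
exact/perm_tensor_mulr/perm_tensor_mulC.
Qed.

Lemma coprod_mul h1 h2 :
  perm_eq (coprod (fmul h1 h2)) (tensor_mul (coprod h1) (coprod h2)).
Proof.
have -> : tensor_mul (coprod h1) (coprod h2) =
    foldr tensor_mul tensor_one (map tree_coprod (h1 ++ h2)).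
  rewrite /coprod map_cat; elim: (map _ h1) => [|A s1 IHs] /=.
    by rewrite tensor_mul1.
  by rewrite -IHs tensor_mulA.
by apply/perm_foldr_tensor/perm_map; rewrite val_fmul perm_sort.
Qed.

End Coproduct.

Section Symmetry.
Variable d : nat.
Implicit Types (h : forest d) (s : seq (ptree d)).

(* A node of a planar forest is addressed by the list [:: i0; i1; ..; ik]: start
   at the root of the i0-th tree, move to its i1-th child, and so on. *)
Fixpoint tree_addresses (t : ptree d) : seq (seq nat) :=
  let: PNode _ s := t in
  [::] :: [seq ip.1 :: q | ip <- zip (iota 0 (size s)) (map tree_addresses s),
                           q <- ip.2].

Definition addresses s : seq (seq nat) :=
  [seq ip.1 :: q | ip <- zip (iota 0 (size s)) (map tree_addresses s),
                   q <- ip.2].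

Fixpoint label_at s (p : seq nat) : option 'I_d :=
  if p is i :: q then
    if onth s i is Some (PNode a s') then
      if q is [::] then Some a else label_at s' q
    else None
  else None.

Definition node h := seq_sub (addresses h).

Definition parent h (p q : node h) : bool :=
  val p == take (size (val q)).-1 (val q).

(* For a tree, seen as a one-tree forest, these are the automorphisms of the
   labelled rooted tree; for the empty forest there is exactly one. *)
Definition automorphisms h : {set {perm node h}} :=
  [set g : {perm node h} |
    [forall p, label_at h (val (g p)) == label_at h (val p)] &&
    [forall p, forall q, parent (g p) (g q) == parent p q]].

Definition sigma h : nat := #|automorphisms h|.

End Symmetry.

Local Open Scope classical_set_scope.
Local Open Scope ring_scope.

Section ElementaryDifferentials.
Variables (R : realType) (d n : nat).
Local Notation V := 'rV[R]_n.

(* [iter_diff phi [:: v1; ..; vm] y] is D^m phi(y) : (v1, .., vm). *)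
Fixpoint iter_diff (phi : V -> V) (vs : seq V) : V -> V :=
  if vs is v :: vs' then fun y => 'd (iter_diff phi vs') y v else phi.

(* C^oo: every iterated differential, evaluated at fixed vectors, is Frechet
   differentiable everywhere as a function of the base point. *)
Definition smooth (phi : V -> V) : Prop :=
  forall (vs : seq V) (y : V), differentiable (iter_diff phi vs) y.

(* All derivatives of order at most [k], the function itself included, are bounded
   in operator norm. *)
Definition bounded_derivatives (k : nat) (phi : V -> V) : Prop :=
  exists K : R, forall (vs : seq V) (y : V),
    (size vs <= k)%N -> (forall v, v \in vs -> `|v| <= 1) ->
    `|iter_diff phi vs y| <= K.

Variable f : 'I_d -> V -> V.

Fixpoint tree_elem_diff (t : ptree d) (y : V) : V :=
  let: PNode a s := t in iter_diff (f a) [seq tree_elem_diff u y | u <- s] y.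

(* [f_h] for [h] a tree or the empty forest, and 0 for any other forest. *)
Definition elem_diff (h : forest d) (y : V) : V :=
  match planar h with
  | [::] => y
  | [:: t] => tree_elem_diff t y
  | _ => 0
  end.

End ElementaryDifferentials.

Definition time (R : realType) (T : {posnum R}) : Type :=
  {t : R | 0 <= t <= T%:num}.

Section Time.
Context {R : realType} {T : {posnum R}}.

Lemma time0_subproof : 0 <= (0 : R) <= T%:num.
Proof. by rewrite lexx ltW. Qed.

Definition time0 : time T := exist _ 0 time0_subproof.

(* The Hoelder seminorm ||F||_gamma, possibly infinite. *)
Definition hnorm {V : normedZmodType R} (gamma : R) (F : time T -> time T -> V) :
    \bar R :=
  ereal_sup [set x | exists s t : time T,
    s <> t /\ x = (`|F s t| / `|sval t - sval s| `^ gamma)%:E].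

End Time.

Section Functionals.
Variables (R : realType) (d : nat).

(* H^*: a linear functional on H is given by its values on the basis of forests. *)
Definition dual : Type := forest d -> R.

Definition star (phi psi : dual) : dual :=
  fun h => \sum_(p <- coprod h) phi p.1 * psi p.2.

Definition dirac_forest (h : forest d) : dual := fun h' => (h == h')%:R.

Definition is_character (phi : dual) : Prop :=
  phi (fone d) = 1 /\ forall h1 h2, phi (fmul h1 h2) = phi h1 * phi h2.

End Functionals.

(* N = floor (1 / alpha). *)
Definition level {R : realType} (alpha : R) : nat := Num.truncn alpha^-1.

Record rough_path (R : realType) (d : nat) (T : {posnum R}) (alpha : R) := RoughPath {
  rp_fun :> time T -> time T -> dual R d;
  rp_character : forall s t, is_character (rp_fun s t);
  rp_chen : forall s u t, star (rp_fun s u) (rp_fun u t) = rp_fun s t;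
  rp_holder : forall h : forest d,
    (hnorm (alpha * (fsize h)%:R) (fun s t => rp_fun s t h) < +oo)%E
}.

Section RoughPathMetric.
Context {R : realType} {d : nat} {T : {posnum R}} {alpha : R}.
Local Notation rpath := (rough_path d T alpha).
Local Notation N := (level alpha).

Definition rho (X Y : rpath) : \bar R :=
  \big[maxe/0%E]_(h : 'F_(d; N) | val h != fone d)
     hnorm ((fsize (val h))%:R * alpha) (fun s t => X s t (val h) - Y s t (val h)).

Definition rp_norm (X : rpath) : \bar R :=
  \big[maxe/0%E]_(h : 'F_(d; N) | val h != fone d)
     hnorm ((fsize (val h))%:R * alpha) (fun s t => X s t (val h)).

End RoughPathMetric.

Section ControlledPaths.
Context {R : realType} {d n : nat} {T : {posnum R}} {alpha : R}.
Local Notation rpath := (rough_path d T alpha).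
Local Notation V := 'rV[R]_n.
Local Notation N := (level alpha).

(* A path in the truncated forests with coefficients in R^n: [Z t h] is <h, Z_t>. *)
Definition coef_path : Type := time T -> 'F_(d; N.-1) -> V.

(* <phi, z> for phi in H^*; in particular <h, Z_t> = <dirac_forest h, Z_t> = Z t h. *)
Definition pairing (phi : dual R d) (z : 'F_(d; N.-1) -> V) : V :=
  \sum_(h : 'F_(d; N.-1)) phi (val h) *: z h.

Definition remainder (X : rpath) (Z : coef_path) (h : 'F_(d; N.-1)) (s t : time T) : V :=
  Z t h - pairing (star (X s t) (dirac_forest R (val h))) (Z s).

Definition cp_norm (gamma : R) (X : rpath) (Z : coef_path) : \bar R :=
  (\sum_(h : 'F_(d; N.-1))
    ((`|Z time0 h|%R)%:E +
     hnorm ((N - fsize (val h))%N%:R * gamma)%R (remainder X Z h)))%E.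

Definition cp_dist (gamma : R) (X : rpath) (Z : coef_path) (X' : rpath) (Z' : coef_path) :
    \bar R :=
  (\sum_(h : 'F_(d; N.-1))
    ((`|Z time0 h - Z' time0 h|%R)%:E +
     hnorm ((N - fsize (val h))%N%:R * gamma)%R
       (fun s t => remainder X Z h s t - remainder X' Z' h s t)%R))%E.

Definition controlled (X : rpath) : set coef_path :=
  [set Z | (cp_norm alpha X Z < +oo)%E].

Definition controlled_closure (beta : R) (X : rpath) : set coef_path :=
  [set Z | forall e : R, 0 < e -> exists2 W, controlled X W &
     (cp_norm beta X (fun t h => Z t h - W t h)%R < e%:E)%E].

End ControlledPaths.
Arguments coef_path {R} d n T alpha.

Section Bounds.
Context {R : realType} {T : {posnum R}} {V : normedZmodType R}.
Implicit Types (F G : time T -> time T -> V).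

Lemma hnorm0 gamma : (hnorm gamma (fun _ _ : time T => 0%R : V) <= 0)%E.
Proof. by apply: ge_ereal_sup => _ [s [t [_ ->]]]; rewrite normr0 mul0r. Qed.

Lemma hnorm_subrr gamma F : (hnorm gamma (fun s t => (F s t - F s t)%R) <= 0)%E.
Proof. by apply: ge_ereal_sup => _ [s [t [_ ->]]]; rewrite subrr normr0 mul0r. Qed.

Lemma hnorm_sub_sym gamma F G :
  hnorm gamma (fun s t => F s t - G s t) = hnorm gamma (fun s t => G s t - F s t).
Proof.
rewrite /hnorm; congr ereal_sup; apply/seteqP.
by split=> x [s [t [st ->]]]; exists s, t; rewrite distrC.
Qed.

Lemma hnorm_triangle gamma F G H :
  (hnorm gamma (fun s t => (F s t - H s t)%R) <=
   hnorm gamma (fun s t => (F s t - G s t)%R) +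
   hnorm gamma (fun s t => (G s t - H s t)%R))%E.
Proof.
apply: ge_ereal_sup => _ [s [t [st ->]]].
apply: (@le_trans _ _ ((`|F s t - G s t| / `|sval t - sval s| `^ gamma)%:E +
                       (`|G s t - H s t| / `|sval t - sval s| `^ gamma)%:E)%E).
  rewrite -EFinD lee_fin -mulrDl ler_wpM2r ?invr_ge0 ?powR_ge0 //.
  exact: ler_distD.
by apply: leeD; apply: ereal_sup_ubound; exists s, t.
Qed.

End Bounds.

Section RoughPathTopology.
Context {R : realType} {d : nat} {T : {posnum R}} {alpha : R}.
Local Notation rpath := (rough_path d T alpha).
Implicit Types (X Y Z : rpath).

Lemma rho_refl X : (rho X X <= 0)%E.
Proof.
rewrite /rho; elim/big_ind: _ => // [x y x0 y0|h _]; first by rewrite ge_max x0.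
exact: hnorm_subrr.
Qed.

Lemma rho_sym X Y : rho X Y = rho Y X.
Proof. by apply: eq_bigr => h _; exact: hnorm_sub_sym. Qed.

Lemma rho_ge0 X Y : (0 <= rho X Y)%E.
Proof. by rewrite /rho; elim/big_rec: _ => // h x _ x0; rewrite le_max x0 orbT. Qed.

Lemma rho_triangle X Y Z : (rho X Z <= rho X Y + rho Y Z)%E.
Proof.
rewrite {1}/rho; elim/big_ind: _ => [|x y xl yl|h hP].
- by rewrite adde_ge0 ?rho_ge0.
- by rewrite ge_max xl.
- apply: le_trans (hnorm_triangle _ _ (fun s t => Y s t (val h)) _) _.
  by apply: leeD; apply: (le_bigmax_cond _
    (fun h : 'F_(d; level alpha) => hnorm ((fsize (val h))%:R * alpha) _)).
Qed.

HB.instance Definition _ := gen_eqMixin rpath.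
HB.instance Definition _ := gen_choiceMixin rpath.

Definition rp_ball X (e : R) : set rpath := [set Y | (rho X Y < e%:E)%E].

Lemma rp_ball_center X (e : R) : 0 < e -> rp_ball X e X.
Proof. by move=> e0; apply: le_lt_trans (rho_refl X) _; rewrite lte_fin. Qed.

Lemma rp_ball_sym X Y (e : R) : rp_ball X e Y -> rp_ball Y e X.
Proof. by rewrite /rp_ball /= rho_sym. Qed.

Lemma rp_ball_triangle X Y Z (e1 e2 : R) :
  rp_ball X e1 Y -> rp_ball Y e2 Z -> rp_ball X (e1 + e2) Z.
Proof.
move=> XY YZ; apply: le_lt_trans (rho_triangle X Y Z) _.
by rewrite EFinD; apply: lteD.
Qed.

HB.instance Definition _ := hasNbhs.Build rpath (nbhs_ (entourage_ rp_ball)).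
HB.instance Definition _ := @Nbhs_isPseudoMetric.Build R rpath
  (entourage_ rp_ball) erefl rp_ball rp_ball_center rp_ball_sym rp_ball_triangle
  erefl.

End RoughPathTopology.

(* A point of the disjoint union of the fibres D^{alpha,beta}_X over X; the projection
   p is [base]. *)
Record bundle {R : realType} (d n : nat) (T : {posnum R}) (alpha beta : R) := Bundle {
  base : rough_path d T alpha;
  fibre : coef_path d n T alpha;
  fibreP : controlled_closure beta base fibre
}.

Section BundleTopology.
Context {R : realType} {d n : nat} {T : {posnum R}} {alpha beta : R}.
Local Notation E := (bundle d n T alpha beta).
Implicit Types (x y z : E).

Definition bundle_dist x y : \bar R :=
  (rho (base x) (base y) +
   cp_dist beta (base x) (fibre x) (base y) (fibre y))%E.

Lemma bundle_dist_refl x : (bundle_dist x x <= 0)%E.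
Proof.
apply: adde_le0; first exact: rho_refl.
apply: sume_le0 => h _; apply: adde_le0; first by rewrite subrr normr0.
exact: hnorm_subrr.
Qed.

Lemma bundle_dist_sym x y : bundle_dist x y = bundle_dist y x.
Proof.
congr (_ + _)%E; first exact: rho_sym.
by apply: eq_bigr => h _; rewrite distrC hnorm_sub_sym.
Qed.

Lemma bundle_dist_triangle x y z :
  (bundle_dist x z <= bundle_dist x y + bundle_dist y z)%E.
Proof.
rewrite /bundle_dist addeACA; apply: leeD; first exact: rho_triangle.
rewrite /cp_dist -big_split /=; apply: lee_sum => h _.
rewrite addeACA; apply: leeD; last exact: hnorm_triangle.
by rewrite -EFinD lee_fin ler_distD.
Qed.

HB.instance Definition _ := gen_eqMixin E.
HB.instance Definition _ := gen_choiceMixin E.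

Definition bundle_ball x (e : R) : set E := [set y | (bundle_dist x y < e%:E)%E].

Lemma bundle_ball_center x (e : R) : 0 < e -> bundle_ball x e x.
Proof. by move=> e0; apply: le_lt_trans (bundle_dist_refl x) _; rewrite lte_fin. Qed.

Lemma bundle_ball_sym x y (e : R) : bundle_ball x e y -> bundle_ball y e x.
Proof. by rewrite /bundle_ball /= bundle_dist_sym. Qed.

Lemma bundle_ball_triangle x y z (e1 e2 : R) :
  bundle_ball x e1 y -> bundle_ball y e2 z -> bundle_ball x (e1 + e2) z.
Proof.
move=> xy yz; apply: le_lt_trans (bundle_dist_triangle x y z) _.
by rewrite EFinD; apply: lteD.
Qed.

HB.instance Definition _ := hasNbhs.Build E (nbhs_ (entourage_ bundle_ball)).
HB.instance Definition _ := @Nbhs_isPseudoMetric.Build R E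
  (entourage_ bundle_ball) erefl bundle_ball
  bundle_ball_center bundle_ball_sym bundle_ball_triangle erefl.

End BundleTopology.

Section RDE.
Context {R : realType} {d n : nat} {T : {posnum R}} {alpha : R}.
Local Notation rpath := (rough_path d T alpha).
Local Notation V := 'rV[R]_n.
Local Notation N := (level alpha).
Variable f : 'I_d -> V -> V.

Definition lift_solution (Y : time T -> V) : coef_path d n T alpha :=
  fun t h =>
    if is_tree (val h) || (val h == fone d)
    then (sigma (val h))%:R^-1 *: elem_diff f (val h) (Y t) else 0.

Definition rde_remainder (X : rpath) (Y : time T -> V) (s t : time T) : V :=
  Y t - Y s -
  \sum_(h : 'F_(d; N) | is_tree (val h))
     ((sigma (val h))%:R^-1 * X s t (val h)) *: elem_diff f (val h) (Y s).

Definition rde_solution (xi : V) (X : rpath) (Y : time T -> V) : Prop :=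
  [/\ Y time0 = xi,
      (hnorm (N.+1%:R * alpha)%R (rde_remainder X Y) < +oo)%E &
      controlled X (lift_solution Y)].

(* The lift of the solution started from [xi]; the zero path, which is controlled
   by every rough path, is the default value of the choice operator. *)
Definition ito_lyons_path (xi : V) (X : rpath) : coef_path d n T alpha :=
  xget (fun _ _ => 0) [set lift_solution Y | Y in rde_solution xi X].

Lemma remainder0 (X : rpath) (Z : coef_path d n T alpha) :
  (forall t h, Z t h = 0) -> forall h s t, remainder X Z h s t = 0.
Proof.
move=> Z0 h s t; rewrite /remainder Z0 sub0r /pairing big1 ?oppr0 // => h' _.
by rewrite Z0 scaler0.
Qed.

Lemma cp_norm0 gamma (X : rpath) (Z : coef_path d n T alpha) :
  (forall t h, Z t h = 0) -> (cp_norm gamma X Z <= 0)%E.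
Proof.
move=> Z0; apply: sume_le0 => h _; apply: adde_le0; first by rewrite Z0 normr0.
rewrite (_ : remainder X Z h = fun _ _ => 0); first exact: hnorm0.
by apply/funext => s; apply/funext => t; exact: remainder0.
Qed.

Lemma ito_lyons_controlled xi (X : rpath) : controlled X (ito_lyons_path xi X).
Proof.
rewrite /ito_lyons_path; case: xgetP => [Z _ [Y [_ _ cY] <-] //|_].
by apply: le_lt_trans (cp_norm0 _ _ _) (ltry 0).
Qed.

Lemma ito_lyons_closure (beta : R) xi (X : rpath) :
  controlled_closure beta X (ito_lyons_path xi X).
Proof.
move=> e e0; exists (ito_lyons_path xi X); first exact: ito_lyons_controlled.
by apply: le_lt_trans (cp_norm0 _ _ _) _ => // t h; rewrite subrr.
Qed.

Definition ito_lyons (beta : R) (xi : V) (X : rpath) : bundle d n T alpha beta :=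
  Bundle (ito_lyons_closure beta xi X).

End RDE.

(* Main.v *)
(** Write [Psi_x y = y + \sum_t x t / sigma t *: f_t y], the sum being over the trees with at most
    [N] nodes. Taylor's formula and the compatibility of elementary differentials with the
    coproduct give [f_t (Psi_x y) = \sum_u sigma t / sigma u * <x star t, u> *: f_u y] up to
    order [N + 1 - |t|]; the symmetry factors come in by counting isomorphisms of labelled
    forests. Hence [Psi] is an almost flow along a rough path (Davie): the defect
    [Psi_{X_ut} (Psi_{X_su} y) - Psi_{X_st} y] has order [|t - s|^((N + 1) alpha)], an exponent
    larger than 1. A path [Y] solves the equation iff [J_st = Y_t - Psi_{X_st} Y_s] has that
    order. Since [J_st] differs from [J_su + J_ut] by the defect and by a small multiple of
    [J_su], cutting [s, t] at its midpoint improves every such bound, so that the bounds are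
    uniform in the data; the same argument applied to the difference of two solutions gives the
    Lipschitz estimate, and the remainders of the lifts are read off the local expansion. For
    existence, the Euler scheme on uniform grids satisfies the sewing bound uniformly in the
    mesh, and any pointwise cluster point of it is a solution. *)
From mathcomp Require Import all_boot all_order all_algebra perm.
From mathcomp Require Import all_classical all_reals all_analysis.
From mathcomp Require Import zify ring lra.
Require Import Defs.

Set Implicit Arguments.
Unset Strict Implicit.
Unset Printing Implicit Defensive.
Import Order.TTheory GRing.Theory Num.Theory.

(** * Isomorphisms of labelled forests and symmetry factors *)

(** The sewing argument starts from a bound with an unknown constant. A solution satisfies
    [|J| <= q |t - s|^theta] for some [q] by definition, and one passage through the midpoint turns
    [q] into [k * q + b] with [k < 1]; hence the infimum of the admissible constants is at most
    [b / (1 - k)], however large the initial [q] was. This works only if [k] and [b] are uniform in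
    the data, and for two solutions they must come from Lipschitz bounds. To avoid expanding
    everything twice, size and Lipschitz dependence are carried together by families indexed by
    [bool]. The expansion is an identity between sums over forests, whereas [sigma] counts
    automorphisms of sets of addresses. The bridge has two parts: the recursion for the number of
    isomorphisms, which yields [sigma_mul], and [palm], which exchanges a forest with a marked tree
    for a tree and a forest. Rough paths are given for all pairs of times, so [J] must also be
    bounded for [s > t]. Midpoints treat both orders alike; the Euler scheme runs forward only, and
    its limit needs a separate argument backwards. *)

Section LabelledForests.
Variable d : nat.

(** Only what an isomorphism must respect is kept, so that permutations of [node h] and maps between
    different planar forests are treated alike. Labels are optional because [label_at] is. *)
Record lforest := LForest {
  carrier :> finType;
  lab : carrier -> option 'I_d;
  par : rel carrier
}.

Implicit Types A B : lforest.

Definition is_iso A B (f : A -> B) : Prop :=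
  [/\ bijective f, forall x, lab (f x) = lab x &
      forall x y, par (f x) (f y) = par x y].

Definition isos A B : {set {ffun A -> B}} := [set f : {ffun A -> B} | `[< is_iso f >]].
Lemma isosP A B (f : {ffun A -> B}) : reflect (is_iso f) (f \in isos A B).
Proof. by rewrite finset.in_set; exact: asboolP. Qed.

Definition niso A B : nat := #|isos A B|.

Definition is_root A (x : A) : Prop := forall z, ~~ par z x.

Lemma iso_id A : is_iso (@id A).
Proof. by split => //; exists id. Qed.

Lemma iso_comp A B (D : lforest) (f : A -> B) (g : B -> D) :
  is_iso f -> is_iso g -> is_iso (g \o f).
Proof.
move=> [bf lf pf] [bg lg pg]; split=> [|x|x y] /=; first exact: bij_comp.
  by rewrite lg lf.
by rewrite pg pf.
Qed.

Lemma iso_inv A B (f : A -> B) (g : B -> A) :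
  cancel f g -> cancel g f -> is_iso f -> is_iso g.
Proof.
move=> fK gK [_ lf pf]; split=> [|x|x y]; first by exists f.
  by rewrite -{2}(gK x) lf.
by rewrite -{2}(gK x) -{2}(gK y) pf.
Qed.

Lemma isoV A B (f : A -> B) : is_iso f ->
  exists g : B -> A, [/\ is_iso g, cancel f g & cancel g f].
Proof.
move=> isof; have [[g fK gK] _ _] := isof.
by exists g; split => //; exact: iso_inv isof.
Qed.

Lemma iso_root A B (f : A -> B) x : is_iso f -> is_root x -> is_root (f x).
Proof.
move=> isof rx z; have [g [[_ _ pg] fK gK]] := isoV isof.
by rewrite -pg fK.
Qed.

Lemma eq_iso A B (f : A -> B) (g : {ffun A -> B}) : g =1 f -> is_iso f -> is_iso g.
Proof. by move=> /funext gf; rewrite (_ : (g : A -> B) = f). Qed.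

Definition isomorphic A B : Prop := exists f : A -> B, is_iso f.

Lemma isomorphic_sym A B : isomorphic A B -> isomorphic B A.
Proof. by move=> [f /isoV[g [isog _ _]]]; exists g. Qed.

Lemma isomorphic_trans A B (D : lforest) :
  isomorphic A B -> isomorphic B D -> isomorphic A D.
Proof. by move=> [f isof] [g isog]; exists (g \o f); exact: iso_comp. Qed.

Lemma isos_transport A A' B B' (phi : A' -> A) (psi : B -> B') f :
  is_iso phi -> is_iso psi -> f \in isos A B -> [ffun x => psi (f (phi x))] \in isos A' B'.
Proof.
move=> isophi isopsi /isosP isof; apply/isosP.
by apply: eq_iso (iso_comp (iso_comp isophi isof) isopsi) => z /=; rewrite ffunE.
Qed.

Lemma leq_card_transport A A' B B' (phi : A' -> A) (psi : B -> B')
    (S : {set {ffun A -> B}}) (S' : {set {ffun A' -> B'}}) : is_iso phi -> is_iso psi ->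
  (forall f, f \in S -> [ffun x => psi (f (phi x))] \in S') -> #|S| <= #|S'|.
Proof.
move=> isophi isopsi SS'.
have [psi' [_ psiK _]] := isoV isopsi; have [phi' [_ _ phiK]] := isoV isophi.
rewrite -(card_imset (f := fun f : {ffun A -> B} => [ffun x => psi (f (phi x))])).
  by apply/subset_leq_card/fintype.subsetP => _ /imsetP[f fS ->]; exact: SS'.
move=> f g /ffunP fg; apply/ffunP => x; have := fg (phi' x).
by rewrite !ffunE phiK => /(can_inj psiK).
Qed.

Lemma niso_congr A A' B B' :
  isomorphic A A' -> isomorphic B B' -> niso A B = niso A' B'.
Proof.
move=> [phi /isoV[phi' [i1 k1 k1']]] [psi isopsi].
have [psi' [i2 _ _]] := isoV isopsi; have isophi := iso_inv k1' k1 i1.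
apply/eqP; rewrite eqn_leq (leq_card_transport i1 isopsi); last by move=> f; exact: isos_transport.
by apply: (leq_card_transport isophi i2) => f; exact: isos_transport.
Qed.

Lemma niso_at_congr A B B' (psi : B -> B') x y : is_iso psi ->
  #|[set f in isos A B | f x == y]| = #|[set f in isos A B' | f x == psi y]|.
Proof.
move=> isopsi; have [psi' [i2 k2 _]] := isoV isopsi; have id1 := iso_id A.
apply/eqP; rewrite eqn_leq (leq_card_transport id1 isopsi) => [|f /setIdP[isof /eqP fx]].
  apply: (leq_card_transport id1 i2) => f /setIdP[isof /eqP fx].
  by apply/setIdP; rewrite ffunE fx k2 isos_transport.
by apply/setIdP; rewrite ffunE fx isos_transport.
Qed.

Definition rooted (a : 'I_d) A : lforest :=
  @LForest (option A) (fun x => if x is Some z then lab z else Some a)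
    (fun x y => match y with
       | None => false
       | Some z => if x is Some w then par w z else [forall w, ~~ par w z]
     end).

Definition disjoint_union A B : lforest :=
  @LForest (A + B)%type
    (fun x => match x with inl z => lab z | inr z => lab z end)
    (fun x y => match x, y with
       | inl z, inl w => par z w
       | inr z, inr w => par z w
       | _, _ => false
     end).

Lemma rooted_parE a A (x : A) :
  reflect (is_root x) (par (None : rooted a A) (Some x)).
Proof. exact: (iffP forallP). Qed.

(** An arbitrary relation [par] may have cycles. This induction principle excludes them and lets an
    isomorphism be followed from the roots downwards. *)
Definition root_generated A : Prop := forall P : A -> Prop,
  (forall x, is_root x -> P x) -> (forall x y, par x y -> P x -> P y) ->
  forall x, P x.

Lemma disjoint_union_congr A A' B B' : isomorphic A A' -> isomorphic B B' ->
  isomorphic (disjoint_union A B) (disjoint_union A' B').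
Proof.
move=> [f [[f' fK f'K] lf pf]] [g [[g' gK g'K] lg pg]].
exists (fun x : disjoint_union A B =>
  match x with inl z => inl (f z) | inr z => inr (g z) end : disjoint_union A' B').
split.
- exists (fun x => match x with inl z => inl (f' z) | inr z => inr (g' z) end).
  + by case=> z; rewrite ?fK ?gK.
  + by case=> z; rewrite ?f'K ?g'K.
- by case=> z /=.
- by case=> z [] w /=.
Qed.

Section Split.
Variables (a b : 'I_d) (A0 A1 B0 B1 : lforest).
Local Notation A := (disjoint_union (rooted a A0) A1).
Local Notation B := (disjoint_union (rooted b B0) B1).

(** Children of the distinguished root go to children of its image, and no edge leaves the left
    branch; the claim spreads from the roots of [A0] to all its nodes. *)
Lemma iso_split_branch (f : A -> B) : root_generated A0 -> is_iso f ->
  f (inl None) = inl None ->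
  exists f0 : A0 -> B0, forall x, f (inl (Some x)) = inl (Some (f0 x)).
Proof.
move=> genA [_ _ pf] f_root.
suff /choice[f0 f0E] : forall x, exists y, f (inl (Some x)) = inl (Some y) by exists f0.
apply: genA => [x /(rooted_parE a) rx|x y xy [x' fx]].
  have : par (f (inl None)) (f (inl (Some x))) by rewrite pf; exact: rx.
  by rewrite f_root; case: (f _) => [[z|]|z] //= _; exists z.
have : par (f (inl (Some x))) (f (inl (Some y))) by rewrite pf.
by rewrite fx; case: (f _) => [[z|]|z] //= _; exists z.
Qed.

End Split.

(** A node of [A1] sent into the left branch would be brought back into the left branch by the
    inverse isomorphism, which splits as well. *)
Lemma iso_split_rest a b A0 A1 B0 B1 (f : disjoint_union (rooted a A0) A1 ->
    disjoint_union (rooted b B0) B1) : root_generated B0 ->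
  is_iso f -> f (inl None) = inl None ->
  exists f1 : A1 -> B1, forall x, f (inr x) = inr (f1 x).
Proof.
move=> genB isof f_root; have [g [isog fK gK]] := isoV isof.
have g_root : g (inl None) = inl None by rewrite -f_root fK.
have [g0 g0E] := iso_split_branch genB isog g_root.
suff /choice[f1 f1E] : forall x, exists y, f (inr x) = inr y by exists f1.
move=> x.
case fx : (f (inr x)) => [[z|]|z]; last by exists z.
- by have := fK (inr x); rewrite fx g0E.
- by have := fK (inr x); rewrite fx g_root.
Qed.

Definition glue a b A0 A1 B0 B1 (p : {ffun A0 -> B0} * {ffun A1 -> B1}) :
    {ffun disjoint_union (rooted a A0) A1 -> disjoint_union (rooted b B0) B1} :=
  [ffun x : disjoint_union (rooted a A0) A1 => match x with
    | inl None => inl None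
    | inl (Some z) => inl (Some (p.1 z))
    | inr z => inr (p.2 z)
    end : disjoint_union (rooted b B0) B1].

Arguments glue a b {A0 A1 B0 B1} p.

Lemma glue_iso a A0 A1 B0 B1 (p : {ffun A0 -> B0} * {ffun A1 -> B1}) :
  is_iso p.1 -> is_iso p.2 -> is_iso (glue a a p).
Proof.
case: p => f0 f1 /= iso0 iso1.
have [g0 [isog0 f0K g0K]] := isoV iso0; have [g1 [_ f1K g1K]] := isoV iso1.
have [_ l0 p0] := iso0; have [_ l1 p1] := iso1; split.
- exists (glue a a (finfun g0, finfun g1)).
  + by move=> [[z|]|z]; rewrite !ffunE /= ?ffunE ?f0K ?f1K.
  + by move=> [[z|]|z]; rewrite !ffunE /= ?ffunE ?g0K ?g1K.
- by move=> [[z|]|z]; rewrite !ffunE /=.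
- move=> [[z|]|z] [[w|]|w]; rewrite !ffunE /= ?p0 ?p1 //.
  apply/(rooted_parE a)/(rooted_parE a) => [|rw]; last exact: iso_root.
  by move=> /(iso_root isog0); rewrite f0K.
Qed.

(** For equal labels [glue] is a bijection from pairs of isomorphisms onto the isomorphisms that
    match the two roots. Root generation is asked on both sides because the inverse has to split
    too. *)
Lemma niso_split a b A0 A1 B0 B1 : root_generated A0 -> root_generated B0 ->
  #|[set f in isos (disjoint_union (rooted a A0) A1)
                   (disjoint_union (rooted b B0) B1)
     | f (inl None) == inl None]| = (a == b) * (niso A0 B0 * niso A1 B1).
Proof.
move=> genA genB; case: eqVneq => [<-{b}|ab]; last first.
  apply: eq_card0 => f; apply/negbTE/negP => /setIdP[/isosP[_ l _] /eqP f_root].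
  by have := l (inl None); rewrite f_root /= => -[ba]; rewrite ba eqxx in ab.
rewrite mul1n /niso -cardsX -(card_imset (f := glue a a)); last first.
  move=> [f0 f1] [g0 g1] /ffunP fg; congr (_, _); apply/ffunP => x.
    by have := fg (inl (Some x)); rewrite !ffunE /= => -[].
  by have := fg (inr x); rewrite !ffunE /= => -[].
apply: eq_card => f; apply/setIdP/imsetP.
- move=> [/isosP isof /eqP f_root].
  have [f0 f0E] := iso_split_branch genA isof f_root.
  have [f1 f1E] := iso_split_rest genB isof f_root.
  have [g [isog fK gK]] := isoV isof.
  have g_root : g (inl None) = inl None by rewrite -f_root fK.
  have [g0 g0E] := iso_split_branch genB isog g_root.
  have [g1 g1E] := iso_split_rest genA isog g_root.
  have [_ lf pf] := isof.
  exists (finfun f0, finfun f1); last first.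
    by apply/ffunP => -[[z|]|z]; rewrite !ffunE /= ?ffunE.
  apply/setXP; split; apply/isosP.
    apply: (eq_iso (f := f0)); first by move=> x; rewrite ffunE.
    split.
    + exists g0 => x.
        by have := fK (inl (Some x)); rewrite f0E g0E => -[].
      by have := gK (inl (Some x)); rewrite g0E f0E => -[].
    + by move=> x; have := lf (inl (Some x)); rewrite f0E.
    + by move=> x y; have := pf (inl (Some x)) (inl (Some y)); rewrite !f0E.
  apply: (eq_iso (f := f1)); first by move=> x; rewrite ffunE.
  split.
  + exists g1 => x.
      by have := fK (inr x); rewrite f1E g1E => -[].
    by have := gK (inr x); rewrite g1E f1E => -[].
  + by move=> x; have := lf (inr x); rewrite f1E.
  + by move=> x y; have := pf (inr x) (inr y); rewrite !f1E.
- move=> [[f0 f1]] /setXP[/isosP i0 /isosP i1] ->.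
  by rewrite ffunE eqxx; split => //; apply/isosP; exact: glue_iso.
Qed.

End LabelledForests.

(** * Planar forests as labelled forests of addresses *)

Section Addresses.
Variable d : nat.
Implicit Types (s : seq (ptree d)) (t : ptree d) (p q : seq nat).

Definition label t : 'I_d := let: PNode a _ := t in a.
Definition children t : seq (ptree d) := let: PNode _ s := t in s.
Definition omit (j : nat) s : seq (ptree d) := take j s ++ drop j.+1 s.

Lemma nil_addresses s : [::] \in addresses s = false.
Proof. by apply/negP => /allpairsPdep[x [y [_ _]]]. Qed.

(** This recursion on the first letter replaces the nested [zip] of the definition in what
    follows. *)
Lemma cons_addresses s i q :
  (i :: q \in addresses s) =
  if onth s i is Some t then (q == [::]) || (q \in addresses (children t)) else false.
Proof.
have -> : (i :: q \in addresses s) =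
    if onth s i is Some t then q \in tree_addresses t else false.
  rewrite /addresses; set z := zip _ _.
  have sz : size z = size s by rewrite size_zip size_iota size_map minnn.
  have nthz t0 k : k < size s ->
      nth (0, [::]) z k = (k, tree_addresses (nth t0 s k)).
    move=> ks; rewrite nth_zip ?size_iota ?size_map // nth_iota //.
    by rewrite (nth_map t0).
  case si : (onth s i) => [t|].
    have ltis : i < size s by rewrite -onthTE si.
    have st : nth t s i = t by apply: onth_nth si.
    apply/allpairsPdep/idP => [[x [y [/(nthP (0, [::]))[k]]]]|qt].
      rewrite sz => ks; rewrite (nthz t) // => <- /= yk [ik qy].
      by rewrite qy -st ik.
    exists (i, tree_addresses t), q; split => //.
    apply/(nthP (0, [::])); exists i; rewrite ?sz // (nthz t) //.
    by rewrite st.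
  have ltis : size s <= i by rewrite -onthNE si.
  apply/allpairsPdep => -[x [y [/(nthP (0, [::]))[k]]]].
  rewrite sz => ks; have [t] : exists t : ptree d, true.
    by case: (s) ks => [//|t *]; exists t.
  rewrite (nthz t) // => _ <- /= _ [ik _].
  by move: ltis; rewrite ik leqNgt ks.
case: (onth s i) => // -[a s'] /=.
by rewrite inE.
Qed.

Lemma addresses_prefix s p i : p != [::] -> rcons p i \in addresses s -> p \in addresses s.
Proof.
elim: p s => // j p IHp s _; rewrite rcons_cons !cons_addresses.
case: (onth s j) => // -[a s'] /=; case: p IHp => // k p IHp /orP[//|].
by move=> /IHp ->; rewrite ?orbT.
Qed.

(** Defined for arbitrary planar lists, since the inductions remove a tree from a list or pass to
    the children of a node. For a forest [h] the carrier is [node h] and [par] is [parent]. *)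
Definition plf s : lforest d :=
  @LForest d (seq_sub (addresses s)) (fun x => label_at s (val x))
    (fun x y => val x == take (size (val y)).-1 (val y)).

Lemma plf_cons s (x : plf s) : exists i q, ssval x = i :: q.
Proof.
case: (ssval x) (ssvalP x) => [|i q _]; last by exists i, q.
by rewrite nil_addresses.
Qed.

Lemma plf_rootP s (x : plf s) : is_root x <-> size (ssval x) = 1.
Proof.
split=> [rx|x1 y]; last first.
  rewrite /= x1 take0; apply/negP => /eqP y0.
  by have := ssvalP y; rewrite y0 nil_addresses.
case/lastP def_x : (ssval x) (ssvalP x) => [|q i].
  by rewrite nil_addresses.
rewrite size_rcons; have [->//|q0] := eqVneq q [::].
move=> /(addresses_prefix q0) qs; have := rx (SeqSub qs).
by rewrite /= def_x size_rcons /= -cats1 take_cat ltnn subnn take0 cats0 eqxx.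
Qed.

Lemma plf_root_generated s : root_generated (plf s).
Proof.
move=> P Proot Pstep x; have [k] := ubnP (size (ssval x)).
elim: k x => // k IHk x xk.
case/lastP def_x : (ssval x) (ssvalP x) xk => [|q i].
  by rewrite nil_addresses.
rewrite size_rcons; have [q0|q0] := eqVneq q [::].
  by move=> _ _; apply: Proot; apply/plf_rootP; rewrite def_x q0.
move=> /(addresses_prefix q0) qs qk; apply: (Pstep (SeqSub qs)); last exact: IHk.
by rewrite /= def_x size_rcons /= -cats1 take_cat ltnn subnn take0 cats0 eqxx.
Qed.

Lemma onth_omit j s i : j < size s -> onth (omit j s) i = onth s (bump j i).
Proof.
move=> js; rewrite /omit onth_cat size_take js /bump.
case: ltnP => ij.
  by rewrite add0n -[in RHS](cat_take_drop j s) onth_cat size_take js ij.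
rewrite -[in RHS](cat_take_drop j.+1 s) onth_cat size_take_min.
have -> : minn j.+1 (size s) = j.+1 by apply/minn_idPl.
by rewrite ltnNge ltnS ij /=; congr onth; lia.
Qed.

Definition raw_split j s t (x : disjoint_union (rooted (label t) (plf (children t)))
    (plf (omit j s))) : seq nat :=
  match x with
  | inl None => [:: j]
  | inl (Some q) => j :: val q
  | inr p => bump j (head 0 (val p)) :: behead (val p)
  end.

(** The addresses that start with [j] form the tree [t]. The others are the addresses of [omit j s]
    with the first letter renumbered by [bump j], which skips exactly [j]. *)
Lemma plf_split j s t : onth s j = Some t ->
  exists2 psi : disjoint_union (rooted (label t) (plf (children t))) (plf (omit j s)) -> plf s,
    is_iso psi & val (psi (inl None)) = [:: j].
Proof.
move=> sj; have js : j < size s by rewrite -onthTE sj.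
have mem_raw (x : disjoint_union (rooted (label t) (plf (children t))) (plf (omit j s))) :
    raw_split x \in addresses s.
  case: x => [[q|]|p] /=; rewrite ?cons_addresses ?sj //; first by rewrite (ssvalP q) orbT.
  have := ssvalP p; have [i [q ->]] := plf_cons p.
  by rewrite !cons_addresses onth_omit.
pose psi x : plf s := SeqSub (mem_raw x).
exists psi => //.
have psi_inj : injective psi.
  move=> x y /(congr1 (@ssval _ _)) /=; case: x y => [[p|]|p] [[q|]|q] //=.
  - by move=> [] /val_inj ->.
  - by move=> [] pq; have [i [p']] := plf_cons p; rewrite pq.
  - by move=> [] /eqP; rewrite (negbTE (neq_bump _ _)).
  - by move=> [] pq; have [i [p']] := plf_cons q; rewrite -pq.
  - by move=> [] /eqP; rewrite (negbTE (neq_bump _ _)).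
  - by move=> [] /esym/eqP; rewrite (negbTE (neq_bump _ _)).
  - by move=> [] /esym/eqP; rewrite (negbTE (neq_bump _ _)).
  - have [i [p' def_p]] := plf_cons p; have [k [q' def_q]] := plf_cons q.
    rewrite def_p def_q /= => -[/(can_inj (bumpK j)) ik pq].
    by congr inr; apply: val_inj; rewrite /= def_p def_q ik pq.
have psi_surj y : exists x, psi x = y.
  have [i [q def_y]] := plf_cons y; have := ssvalP y; rewrite def_y cons_addresses.
  have [ij|ij] := eqVneq i j.
    rewrite ij sj; have [q0 _|q0 /= qt] := eqVneq q [::].
      by exists (inl None); apply: val_inj; rewrite /= def_y q0 ij.
    by exists (inl (Some (SeqSub qt))); apply: val_inj; rewrite /= def_y ij.
  move=> iqs; have uq : unbump j i :: q \in addresses (omit j s).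
    by rewrite cons_addresses onth_omit // unbumpK.
  by exists (inr (SeqSub uq)); apply: val_inj; rewrite /= def_y unbumpK.
have [g gK] := choice psi_surj.
split.
- by exists g => // x; apply: psi_inj; rewrite gK.
- case=> [[q|]|p] /=; first 2 last.
  + by have [i [p' ->]] := plf_cons p; rewrite /= onth_omit.
  + by rewrite sj; case: (t) (q) => a s' {}q /=; have [i [q' ->]] := plf_cons q.
  + by rewrite sj; case: (t).
- move=> x [[q|]|p] /=.
  + have [k [q' def_q]] := plf_cons q.
    case: x => [[x|]|x] /=; rewrite def_q /= ?eqseq_cons ?eqxx //=.
      apply/eqP/forallP => [q'0|rq].
        have : is_root q by apply/plf_rootP; rewrite def_q; case: (q') q'0.
        by move=> rq w; have := rq w; rewrite /= def_q.
      have /plf_rootP : is_root q by move=> w; have := rq w; rewrite /= def_q.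
      by rewrite def_q; case: (q').
    by rewrite eq_sym (negbTE (neq_bump _ _)).
  + by case: x => [[x|]|x].
  + have [k [p' def_p]] := plf_cons p.
    case: x => [[x|]|x] /=; rewrite !def_p /=; case: p' {def_p} => [|i p'] //=.
    * by rewrite eqseq_cons (negbTE (neq_bump _ _)).
    * by rewrite eqseq_cons (negbTE (neq_bump _ _)).
    * by have [m [x' ->]] := plf_cons x.
    * have [m [x' ->]] := plf_cons x.
      by rewrite /= !eqseq_cons (can_eq (bumpK j)).
Qed.

End Addresses.

(** * Counting isomorphisms and the multiplicativity of symmetry factors *)

Section SymmetryFactor.
Variable d : nat.
Implicit Types (s : seq (ptree d)) (t u : ptree d) (h : forest d).

Definition nforest s1 s2 : nat := niso (plf s1) (plf s2).
(** An isomorphism of trees maps root to root, so that only the children remain to be matched;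
    [nforest_single] shows that this is the number of isomorphisms. *)
Definition ntree t u : nat := (label t == label u) * nforest (children t) (children u).

Lemma sigmaE h : sigma h = nforest h h.
Proof.
rewrite /sigma /nforest /niso -(card_imset (f := fun g : {perm node h} => [ffun x => g x])); last first.
  by move=> g1 g2 /ffunP g12; apply/permP => x; have := g12 x; rewrite !ffunE.
apply: eq_card => f; apply/imsetP/isosP => [[g + ->]|[bf lf pf]].
  rewrite finset.in_set => /andP[/forallP lg /forallP pg].
  have isog : @is_iso d (plf h) (plf h) g.
    split=> [|x|x y]; first by exists (perm_inv g); [exact: permK|exact: permKV].
      exact/eqP/lg.
    by have /forallP /(_ y) /eqP := pg x.
  by apply: eq_iso isog => x; rewrite ffunE.
exists (perm (bij_inj bf)); last by apply/ffunP => x; rewrite ffunE permE.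
rewrite finset.in_set; apply/andP; split; apply/forallP => x.
  by rewrite permE; apply/eqP/lf.
by apply/forallP => y; rewrite !permE; apply/eqP/pf.
Qed.

Lemma omit0 t s : omit 0 (t :: s) = s.
Proof. by rewrite /omit /= drop0. Qed.

(* An isomorphism from [t :: s1] to [s2] maps the root of [t] to the root of a tree [u] of
   [s2], and then consists of isomorphisms from [t] to [u] and from [s1] to the rest of [s2]. *)
Lemma nforest_cons t s1 s2 :
  nforest (t :: s1) s2 = \sum_(j < size s2) ntree t (nth t s2 j) * nforest s1 (omit j s2).
Proof.
have [psi0 iso0 _] := @plf_split d 0 (t :: s1) t erefl.
rewrite /nforest -(niso_congr (ex_intro _ psi0 iso0) (ex_intro _ id (iso_id _))).
rewrite omit0 {psi0 iso0}.
set D := disjoint_union _ _; rewrite {1}/niso.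
(* The root of the first tree goes to a root of [plf s2], that is, to a one-letter address. The
   inserted sum of indicators over [j] therefore equals 1. *)
rewrite -sum1_card (eq_bigr (fun f : {ffun D -> plf s2} =>
    \sum_(j < size s2) (ssval (f (inl None)) == [:: nat_of_ord j] : nat))); last first.
  move=> f /isosP isof; have : is_root (f (inl None)).
    by apply: iso_root isof _ => -[[z|]|z].
  have [i [q def_f]] := plf_cons (f (inl None)); rewrite plf_rootP def_f.
  case: q def_f => // def_f _; have := ssvalP (f (inl None)).
  rewrite def_f cons_addresses; case si : (onth s2 i) => [u|] // _.
  have lti : i < size s2 by rewrite -onthTE si.
  rewrite (bigD1 (Ordinal lti)) //= eqxx big1 // => j.
  by rewrite -val_eqE eq_sym eqseq_cons andbT /= => /negbTE ->.
rewrite exchange_big /=; apply: eq_bigr => j _.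
have sj : onth s2 j = Some (nth t s2 j) by rewrite onthE (nth_map t).
have [psi isopsi psi_root] := plf_split sj.
rewrite -big_mkcondr sum1_card /=.
rewrite /ntree /nforest -mulnA -niso_split; try exact: plf_root_generated.
rewrite (niso_at_congr _ _ isopsi); apply: eq_card => f.
rewrite !finset.in_set unfold_in /= finset.in_set; congr (_ && _).
by rewrite -psi_root.
Qed.

Lemma perm_omit j s t : onth s j = Some t -> perm_eq s (t :: omit j s).
Proof.
move=> sj; have js : j < size s by rewrite -onthTE sj.
rewrite -[X in perm_eq X _](cat_take_drop j) (drop_nth t js).
have -> : nth t s j = t by apply: onth_nth sj.
by rewrite /omit perm_catC /= perm_cons perm_catC.
Qed.

Lemma perm_plf s1 s2 : perm_eq s1 s2 -> isomorphic (plf s1) (plf s2).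
Proof.
elim: s1 s2 => [|t s1 IHs] s2.
  by move=> /perm_size/esym/size0nil ->; exists id; exact: iso_id.
move=> s12; have /onthP[j sj] : t \in s2 by rewrite -(perm_mem s12) mem_head.
have [psi2 iso2 _] := plf_split sj.
have [psi1 iso1 _] := @plf_split d 0 (t :: s1) t erefl.
have s12' : perm_eq s1 (omit j s2).
  by rewrite -(perm_cons t) (perm_trans s12) // perm_omit.
apply: isomorphic_trans (ex_intro _ psi2 iso2).
apply: (isomorphic_trans (isomorphic_sym (ex_intro _ psi1 iso1))).
rewrite omit0; apply: disjoint_union_congr (IHs _ s12').
by exists id; exact: iso_id.
Qed.

Lemma perm_nforest s1 s1' s2 s2' :
  perm_eq s1 s1' -> perm_eq s2 s2' -> nforest s1 s2 = nforest s1' s2'.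
Proof. by move=> s1P s2P; apply: niso_congr; exact: perm_plf. Qed.

Lemma nforest00 : nforest [::] [::] = 1.
Proof.
have E0 (A : Type) (x : plf ([::] : seq (ptree d))) : A.
  by have := ssvalP x.
rewrite /nforest /niso; apply/eqP/cards1P; exists [ffun x => E0 _ x].
apply/setP => f; rewrite finset.in_set1; apply/isosP/eqP => [_|_].
  by apply/ffunP => x; exact: E0.
by split=> [|x|x]; [exists (E0 _) => x|..]; exact: E0.
Qed.

Lemma all_omit (P : pred (ptree d)) j s : all P s -> all P (omit j s).
Proof.
move=> /allP Ps; apply/allP => t; rewrite /omit mem_cat => /orP[/mem_take|/mem_drop]; exact: Ps.
Qed.

(** By [nforest_cons] some tree of [s2] is isomorphic to the first tree of [s1]; by induction on the
    number of nodes their children are permutations of each other, and sorted lists that are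
    permutations of each other coincide. *)
Lemma nforest_perm s1 s2 : all (@tnormal d) s1 -> all (@tnormal d) s2 ->
  nforest s1 s2 != 0 -> perm_eq s1 s2.
Proof.
have [k] := ubnP (sumn (map (@tsize d) s1)).
elim: k s1 s2 => // k IHk [|t s1] s2 sk.
  move=> _ _; case: s2 => // u s2.
  rewrite /nforest /niso cards_eq0 => /set0Pn[f /isosP isof].
  have [g _] := isoV isof.
  have [psi _ _] := @plf_split d 0 (u :: s2) u erefl.
  by have := ssvalP (g (psi (inl None))).
move=> /= /andP[nt ns1] ns2; rewrite nforest_cons => nz.
have [j] : exists j : 'I_(size s2), ntree t (nth t s2 j) * nforest s1 (omit j s2) != 0.
  apply/existsP; apply: contraNT nz; rewrite negb_exists => /forallP nz.
  by rewrite big1 // => j _; apply/eqP; rewrite -[_ == _]negbK; exact: nz.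
have sj : onth s2 j = Some (nth t s2 j) by rewrite onthE (nth_map t).
rewrite muln_eq0 negb_or => /andP[ntj nsj].
have tj : t = nth t s2 j.
  have : tnormal (nth t s2 j) by move/allP: ns2; apply; exact: mem_nth.
  move: ntj nt sk; rewrite /ntree; case: (t) (nth t s2 j) => a r [b r'] /=.
  rewrite muln_eq0 negb_or eqb0 negbK => /andP[/eqP <- nr] /andP[sr ar] sk /andP[sr' ar'].
  congr PNode; apply: (sorted_eq (@ple_trans d) (@ple_anti d)) => //.
  by apply: IHk => //; lia.
rewrite perm_sym (perm_trans (perm_omit sj)) // -tj perm_cons perm_sym.
apply: IHk => //; last exact: all_omit.
move: sk; case: (t) => a r /=; lia.
Qed.

Lemma ntree_neq0 t u : tnormal t -> tnormal u -> ntree t u != 0 -> t = u.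
Proof.
rewrite /ntree; case: t u => a r [b r'] /= /andP[sr ar] /andP[sr' ar'].
rewrite muln_eq0 negb_or eqb0 negbK => /andP[/eqP <- nr].
congr PNode; apply: (sorted_eq (@ple_trans d) (@ple_anti d)) => //.
exact: nforest_perm.
Qed.

Lemma nforest_single t u : nforest [:: t] [:: u] = ntree t u.
Proof.
by rewrite nforest_cons big_ord1 /= /omit /= nforest00 muln1.
Qed.

Lemma sigma_graft a h : sigma (graft a h) = sigma h.
Proof.
by rewrite !sigmaE (_ : planar _ = [:: PNode a h]) ?val_graft // nforest_single /ntree /= eqxx mul1n.
Qed.

Lemma sigma_one : sigma (fone d) = 1.
Proof. by rewrite sigmaE nforest00. Qed.

Lemma sigma_gt0 h : 0 < sigma h.
Proof.
rewrite sigmaE card_gt0; apply/set0Pn; exists [ffun x => x].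
apply/isosP; apply: eq_iso (iso_id (plf h)) => x; by rewrite ffunE.
Qed.

Definition tree_forest t : forest d := mkforest [:: t].

Lemma val_tree_forest t : tnormal t -> tree_forest t = [:: t] :> seq _.
Proof. by move=> nt; rewrite val_mkforest //= nt. Qed.

(** In the recursion for [nforest (t :: h) (t :: h)] only the trees equal to [t] contribute, by
    [ntree_neq0], and each of them contributes the same product. *)
Lemma sigma_mul t h : tnormal t ->
  sigma (fmul (tree_forest t) h) =
  count_mem t (fmul (tree_forest t) h) * (sigma (tree_forest t) * sigma h).
Proof.
move=> nt; set th := fmul _ _.
have thP : perm_eq th (t :: h) by rewrite val_fmul val_tree_forest // perm_sort.
rewrite (seq.permP thP) !sigmaE (perm_nforest thP thP) nforest_cons val_tree_forest //.
rewrite nforest_single -sum1_count (big_nth t) big_mkord big_distrl /= [RHS]big_mkcond /=.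
apply: eq_bigr => j _; have [tj|tj] := eqVneq (nth t (t :: h) j) t.
  rewrite mul1n; congr (_ * _); first by rewrite tj.
  apply: perm_nforest => //.
  rewrite -(perm_cons t) perm_sym; apply: perm_omit.
  by rewrite onthE (nth_map t) // tj.
rewrite (_ : ntree _ _ = 0) //; apply/eqP; apply: contra_neqT tj => ntj.
apply/esym/ntree_neq0 => //.
have /allP : all (@tnormal d) (t :: h) by rewrite /= nt all_tnormal.
by apply; exact: mem_nth.
Qed.

End SymmetryFactor.

(** * Sums over forests and the coproduct *)

Section ForestSizes.
Variable d : nat.
Implicit Types (s : seq (ptree d)) (t u : ptree d) (h g : forest d).

Lemma perm_forest h1 h2 : perm_eq h1 h2 -> h1 = h2.
Proof. by move=> /perm_mkforest; rewrite !mkforestK. Qed.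

Lemma perm_sumn (s1 s2 : seq nat) : perm_eq s1 s2 -> sumn s1 = sumn s2.
Proof. by move=> s12; rewrite !sumnE; apply: perm_big. Qed.

Lemma tsize_tnorm t : tsize (tnorm t) = tsize t.
Proof.
elim/ptree_ind': t => a s IHs /=; congr _.+1.
rewrite (@perm_sumn _ (map (@tsize d) (map (@tnorm d) s))) ?perm_map ?perm_sort //.
by elim: s IHs => //= t s IH [-> /IH ->].
Qed.

Lemma fsize_mkforest s : fsize (mkforest s) = sumn (map (@tsize d) s).
Proof.
rewrite /fsize /= /fnorm (@perm_sumn _ (map (@tsize d) (map (@tnorm d) s))); last first.
  by rewrite perm_map ?perm_sort.
by rewrite -map_comp; congr sumn; apply: eq_map => t /=; exact: tsize_tnorm.
Qed.

Lemma fsize_mul h g : fsize (fmul h g) = fsize h + fsize g.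
Proof. by rewrite fsize_mkforest map_cat sumn_cat. Qed.

Lemma fsize_tree t : fsize (tree_forest t) = tsize t.
Proof. by rewrite fsize_mkforest /= addn0. Qed.

Lemma fsize_graft a h : fsize (graft a h) = (fsize h).+1.
Proof. by rewrite fsize_mkforest /= addn0. Qed.

Lemma fsize_one : fsize (fone d) = 0.
Proof. by []. Qed.

Lemma tsize_gt0 t : 0 < tsize t. Proof. by case: t. Qed.

Lemma size_fsize h : size h <= fsize h.
Proof.
rewrite /fsize; elim: (planar h) => //= t s IHs.
by have := tsize_gt0 t; lia.
Qed.

Lemma fsize_eq0 h : fsize h = 0 -> h = fone d.
Proof.
move=> h0; apply: val_inj => /=; have := size_fsize h; rewrite h0.
by case: (planar h).
Qed.

Lemma mem_tsize t h : t \in planar h -> tsize t <= fsize h.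
Proof. by move=> th; rewrite /fsize (perm_sumn (perm_map _ (perm_to_rem th))) /= leq_addr. Qed.

Lemma mem_tnormal t h : t \in planar h -> tnormal t.
Proof. by move: t; apply/allP; exact: all_tnormal. Qed.

Definition without t h : forest d := mkforest (rem t h).

Lemma rem_normal t h : all (@tnormal d) (rem t h).
Proof. by apply/allP => u /mem_rem; exact: mem_tnormal. Qed.

Lemma mul_withoutK t h : t \in planar h -> fmul (tree_forest t) (without t h) = h.
Proof.
move=> th; apply: perm_forest; rewrite val_fmul perm_sort val_tree_forest ?(mem_tnormal th) //.
by rewrite val_mkforest ?rem_normal // perm_sym (perm_trans (perm_to_rem th)) //=
  perm_cons perm_sym perm_sort.
Qed.

Lemma perm_tree_mul t h : tnormal t -> perm_eq (fmul (tree_forest t) h) (t :: h).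
Proof. by move=> nt; rewrite val_fmul perm_sort val_tree_forest. Qed.

Lemma without_mulK t h : tnormal t -> without t (fmul (tree_forest t) h) = h.
Proof.
move=> nt; rewrite -[RHS]mkforestK; apply: perm_mkforest.
rewrite -(perm_cons t) -(permPr (perm_tree_mul h nt)) perm_sym.
by apply: perm_to_rem; rewrite (perm_mem (perm_tree_mul h nt)) mem_head.
Qed.

Lemma tree_mul_inj t : tnormal t -> injective (fmul (tree_forest t)).
Proof. by move=> nt; apply: (can_inj (g := without t)) => h; exact: without_mulK. Qed.

Lemma graft_tree a h : graft a h = tree_forest (PNode a h).
Proof. by []. Qed.

Lemma tree_forest_neq1 t : tree_forest t != fone d.
Proof. by apply/eqP => /(congr1 (@fsize d)); rewrite fsize_tree fsize_one; have := tsize_gt0 t; lia. Qed.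

Lemma tree_forest_inj t u : tnormal t -> tnormal u ->
  tree_forest t = tree_forest u -> t = u.
Proof. by move=> nt nu /(congr1 (@planar d)); rewrite !val_tree_forest // => -[]. Qed.

Definition ntrees (K : nat) : seq (ptree d) :=
  if K is K'.+1 then [seq PNode a (planar h) | a <- enum 'I_d, h <- forests_upto d K']
  else [::].

Lemma mem_ntrees K t : (t \in ntrees K) = tnormal t && (tsize t <= K).
Proof.
case: K => [|K]; first by have := tsize_gt0 t; case: tnormal => //=; case: tsize.
apply/allpairsP/andP => [[[a h] [_ /= hK ->]]|[nt tK]].
  by split; [exact: planarP|rewrite mem_forests_upto in hK].
case: t nt tK => a s nt tK; exists (a, Forest nt); rewrite mem_enum; split=> //.
by rewrite /= mem_forests_upto.
Qed.

Lemma ntrees_uniq K : uniq (ntrees K).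
Proof.
case: K => // K; apply: allpairs_uniq; rewrite ?enum_uniq ?undup_uniq //.
by move=> [a h] [b g] _ _ /= [-> /val_inj ->].
Qed.

Lemma forests_upto_uniq K : uniq (forests_upto d K).
Proof. exact: undup_uniq. Qed.

Lemma big_forests_upto_tree (V : nmodType) K (F : forest d -> V) :
  (\sum_(h <- forests_upto d K | is_tree h) F h = \sum_(t <- ntrees K) F (tree_forest t))%R.
Proof.
rewrite -big_filter -(big_map (@tree_forest d) xpredT F); apply: perm_big.
apply: uniq_perm.
- by rewrite filter_uniq // forests_upto_uniq.
- rewrite map_inj_in_uniq ?ntrees_uniq // => t u.
  by rewrite !mem_ntrees => /andP[nt _] /andP[nu _]; exact: tree_forest_inj.
move=> h; rewrite mem_filter mem_forests_upto; apply/andP/mapP => [[/eqP h1 hK]|[t]].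
  case def_h : (planar h) h1 => [|t [|]] // _.
  have nt : tnormal t by apply: (@mem_tnormal _ h); rewrite def_h mem_head.
  exists t; last by apply: perm_forest; rewrite val_tree_forest // def_h.
  by rewrite mem_ntrees nt; move: hK; rewrite /fsize def_h /= addn0.
rewrite mem_ntrees => /andP[nt tK] ->.
by rewrite fsize_tree /is_tree val_tree_forest.
Qed.

Lemma big_ntrees (V : nmodType) K (F : ptree d -> V) :
  (\sum_(t <- ntrees K.+1) F t =
   \sum_(a : 'I_d) \sum_(h <- forests_upto d K) F (PNode a h))%R.
Proof. by rewrite big_allpairs_dep /= big_enum. Qed.

End ForestSizes.

Local Open Scope ring_scope.

(** * Sums over forests with a marked tree *)

Section Palm.
Variables (R : realType) (d : nat) (V : lmodType R).
Implicit Types (s : seq (ptree d)) (t u : ptree d) (h g : forest d).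

Definition weight h : R := (sigma h)%:R^-1.

Lemma weight_mul t h : tnormal t ->
  weight (fmul (tree_forest t) h) * (count_mem t (fmul (tree_forest t) h))%:R =
  weight (tree_forest t) * weight h.
Proof.
move=> nt; rewrite /weight sigma_mul // !natrM.
have c0 : (count_mem t (fmul (tree_forest t) h))%:R != 0 :> R.
  rewrite pnatr_eq0 -lt0n -has_count; apply/hasP; exists t => //=.
  by rewrite (perm_mem (perm_tree_mul h nt)) mem_head.
have s0 g : (sigma g)%:R != 0 :> R by rewrite pnatr_eq0 -lt0n sigma_gt0.
by field; rewrite c0 !s0.
Qed.

(* Both sides count the pairs of a forest and one of its trees. *)
Lemma palm K (U : ptree d -> forest d -> V) :
  \sum_(h <- forests_upto d K) weight h *: \sum_(t <- planar h) U t (without t h) =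
  \sum_(t <- ntrees d K) \sum_(g <- forests_upto d (K - tsize t))
     (weight (tree_forest t) * weight g) *: U t g.
Proof.
transitivity (\sum_(h <- forests_upto d K) \sum_(t <- ntrees d K)
    (weight h * (count_mem t h)%:R) *: U t (without t h)).
  apply: eq_big_seq => h; rewrite mem_forests_upto => hK.
  rewrite (eq_big_seq (fun t => \sum_(u <- ntrees d K | u == t) U u (without u h))); last first.
    move=> t th; rewrite -big_filter (_ : [seq u <- _ | _] = [:: t]) ?big_seq1 //.
    apply: (filter_pred1_uniq (ntrees_uniq d K)).
    by rewrite mem_ntrees (mem_tnormal th) (leq_trans (mem_tsize th)).
  rewrite (exchange_big_dep xpredT) //= scaler_sumr; apply: eq_bigr => u _.
  rewrite (eq_bigl (pred1 u)); last by move=> t; rewrite /= eq_sym.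
  by rewrite big_const_seq iter_addr_0 -scaler_nat scalerA.
rewrite exchange_big /=; apply: eq_big_seq => t; rewrite mem_ntrees => /andP[nt tK].
rewrite (bigID (fun h => t \in planar h)) /= addrC big1 ?add0r; last first.
  by move=> h /count_memPn ->; rewrite mulr0 scale0r.
rewrite -big_filter (perm_big [seq fmul (tree_forest t) g | g <- forests_upto d (K - tsize t)]).
  by rewrite big_map; apply: eq_bigr => g _; rewrite weight_mul // without_mulK.
apply: uniq_perm.
- by rewrite filter_uniq // forests_upto_uniq.
- by rewrite map_inj_uniq ?forests_upto_uniq //; exact: tree_mul_inj.
move=> h; rewrite mem_filter mem_forests_upto; apply/andP/mapP => [[th hK]|[g]].
  exists (without t h); last by rewrite mul_withoutK.
  by rewrite mem_forests_upto; move: hK; rewrite -{1}(mul_withoutK th) fsize_mul fsize_tree; lia.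
rewrite mem_forests_upto => gK ->.
by rewrite fsize_mul fsize_tree (perm_mem (perm_tree_mul g nt)) mem_head; split=> //; lia.
Qed.

End Palm.

(** * Coproducts of forests and expansions in forests *)

Section CoproductSums.
Variables (R : realType) (d : nat).
Implicit Types (s : seq (ptree d)) (t u : ptree d) (h g : forest d) (x : dual R d).

(** The coproduct on planar lists that need not be normal, so that inductions can run along the
    list; on a forest it is [coprod] by conversion. *)
Definition coprods s : tensor d := foldr (@tensor_mul d) (tensor_one d) (map (@tree_coprod d) s).

Lemma perm_coprods s1 s2 : perm_eq s1 s2 -> perm_eq (coprods s1) (coprods s2).
Proof. by move=> s12; apply/perm_foldr_tensor/perm_map. Qed.

Lemma tree_coprodE a h : tree_coprod (PNode a (planar h)) =
  rcons [seq (p.1, graft a p.2) | p <- coprod h] (graft a h, fone d).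
Proof. by []. Qed.

Lemma coprod_tree t : tnormal t -> coprod (tree_forest t) = tree_coprod t.
Proof. by move=> nt; rewrite /coprod val_tree_forest //= tensor_mulr1. Qed.

(** In terms of admissible cuts, the second factor is the trunk. Unless it is empty it contains the
    root, and it is then connected. *)
Lemma tree_coprod_trunk t q : q \in tree_coprod t ->
  q.2 = fone d \/ exists2 u, tnormal u & q.2 = tree_forest u.
Proof.
case: t => a s /=; rewrite mem_rcons in_cons => /orP[/eqP ->|/mapP[p _ ->]]; first by left.
by right; exists (PNode a p.2) => //; exact: planarP.
Qed.

Lemma size_coprods s p : p \in coprods s ->
  (fsize p.1 + fsize p.2 = sumn (map (@tsize d) s))%N.
Proof.
pose ok t := forall q, q \in tree_coprod t -> (fsize q.1 + fsize q.2 = tsize t)%N.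
suff okT t : ok t.
  elim: s p => [|t s IHs] p /=; first by rewrite inE => /eqP ->.
  move=> /allpairsP[[q r] [/= qt rs ->]]; rewrite /= !fsize_mul.
  by rewrite -(okT _ _ qt) -(IHs _ rs) addnACA.
elim/ptree_ind': t => a {p} s IHs q /=.
rewrite mem_rcons in_cons => /orP[/eqP -> |/mapP[p ps ->]] /=.
  by rewrite fsize_tree addn0.
rewrite fsize_graft addnS; congr _.+1.
elim: s IHs p ps {q} => [|t s IH] /= => [_ p|[okt oks] p]; first by rewrite inE => /eqP ->.
move=> /allpairsP[[q r] [/= qt rs ->]]; rewrite /= !fsize_mul.
by rewrite -(okt _ qt) -(IH oks _ rs) addnACA.
Qed.

Section Sums.
Variables (x : dual R d) (charx : is_character x) (V : lmodType R).

Lemma coprods_cons t s (phi : forest d -> V) :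
  \sum_(p <- coprods (t :: s)) x p.1 *: phi p.2 =
  \sum_(q <- tree_coprod t) x q.1 *:
     \sum_(p <- coprods s) x p.1 *: phi (fmul q.2 p.2).
Proof.
rewrite /coprods /= big_allpairs_dep /=; apply: eq_bigr => q _.
rewrite scaler_sumr; apply: eq_bigr => p _.
by rewrite charx.2 scalerA.
Qed.

Lemma sum_rem_cons t s (F : ptree d -> seq (ptree d) -> V) :
  (forall u s1 s2, perm_eq s1 s2 -> F u s1 = F u s2) ->
  \sum_(u <- t :: s) F u (rem u (t :: s)) =
  F t s + \sum_(u <- s) F u (t :: rem u s).
Proof.
move=> permF; rewrite big_cons /= eqxx; congr (_ + _).
apply: eq_big_seq => u us; case: eqVneq => // tu; apply: permF.
by rewrite tu; exact: perm_to_rem.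
Qed.

(** The number <x star u, t> for trees ([star_tree]): [x] is summed over the pruned parts of the
    cuts of [t] whose trunk is [u]. *)
Definition cut t u : R := \sum_(q <- tree_coprod t) x q.1 * (q.2 == tree_forest u)%:R.

(** A double count as in [palm], now marking a copy of [u] in the trunk. The marked copy is the
    trunk of a cut of one tree [t] of [s], and the rest comes from cuts of the other trees. *)
Lemma coprods_palm u s (phi : forest d -> V) : tnormal u ->
  \sum_(p <- coprods s) (x p.1 * (count_mem u p.2)%:R) *: phi p.2 =
  \sum_(t <- s) cut t u *:
    \sum_(p <- coprods (rem t s)) x p.1 *: phi (fmul (tree_forest u) p.2).
Proof.
move=> nu; elim: s phi => [|t s IHs] phi.
  by rewrite /coprods /= big_seq1 big_nil /= mulr0 scale0r.
rewrite (@sum_rem_cons t s (fun t r => cut t u *: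
    \sum_(p <- coprods r) x p.1 *: phi (fmul (tree_forest u) p.2))); last first.
  by move=> v s1 s2 s12; congr (_ *: _); apply: perm_big; exact: perm_coprods.
(* The copies of [u] in a product of trunks are counted separately in the trunk of [t] and in that
   of [s]. *)
transitivity (\sum_(q <- tree_coprod t) x q.1 *: \sum_(p <- coprods s)
    (x p.1 * ((q.2 == tree_forest u)%:R + (count_mem u p.2)%:R)) *: phi (fmul q.2 p.2)).
  rewrite (eq_bigr (fun p : forest d * forest d => x p.1 *: ((count_mem u p.2)%:R *: phi p.2))); last first.
    by move=> p _; rewrite scalerA.
  rewrite (coprods_cons t s (fun h : forest d => (count_mem u h)%:R *: phi h)).
  apply: eq_big_seq => q qt; congr (_ *: _); apply: eq_bigr => p _.
  rewrite scalerA; congr ((_ * _) *: _); case: (tree_coprod_trunk qt) => [->|[v nv ->]].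
    by rewrite fmul1f eq_sym (negbTE (tree_forest_neq1 u)) add0r.
  rewrite (seq.permP (perm_tree_mul p.2 nv)) /= natrD; congr (_%:R + _).
  by case: (eqVneq v u) => [->|vu]; [rewrite eqxx|rewrite (introF eqP) // => /tree_forest_inj vu'; rewrite vu' ?eqxx in vu].
under eq_bigr => q _ do under eq_bigr => p _ do rewrite mulrDr scalerDl.
under eq_bigr => q _ do rewrite big_split scalerDr.
rewrite big_split /=; congr (_ + _).
  rewrite /cut scaler_suml; apply: eq_bigr => q _.
  case: eqVneq => [->|_]; last first.
    by rewrite mulr0 scale0r big1 ?scaler0 // => p _; rewrite mulr0 scale0r.
  by rewrite mulr1; congr (_ *: _); apply: eq_bigr => p _; rewrite mulr1.
under eq_bigr => q _ do rewrite (IHs (fun h => phi (fmul q.2 h))) scaler_sumr.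
rewrite exchange_big /=; apply: eq_bigr => v _.
rewrite (coprods_cons t (rem v s) (fun h => phi (fmul (tree_forest u) h))) scaler_sumr; apply: eq_bigr => q _.
rewrite !scalerA mulrC; congr (_ *: _); apply: eq_bigr => p _.
by rewrite !fmulA (fmulC q.2).
Qed.

End Sums.

Section Characters.
Variables (x : dual R d) (charx : is_character x).

Lemma fmul_eq1 g h : (fmul g h == fone d) = (g == fone d) && (h == fone d).
Proof.
apply/eqP/andP => [gh1|[/eqP -> /eqP ->]]; last exact: fmul1f.
have : (fsize g + fsize h = 0)%N by rewrite -fsize_mul gh1.
move=> /eqP; rewrite addn_eq0 => /andP[/eqP g0 /eqP h0].
by rewrite (fsize_eq0 g0) (fsize_eq0 h0) !eqxx.
Qed.

Lemma mkforest_cons t s : tnormal t -> all (@tnormal d) s ->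
  mkforest (t :: s) = fmul (tree_forest t) (mkforest s).
Proof.
move=> nt ns; apply: perm_forest.
rewrite (permPr (perm_tree_mul _ nt)) !val_mkforest //= ?nt // perm_sort perm_cons.
by rewrite perm_sym perm_sort.
Qed.

Lemma coprods_one s : all (@tnormal d) s ->
  \sum_(p <- coprods s) x p.1 * (p.2 == fone d)%:R = x (mkforest s).
Proof.
elim: s => [|t s IHs] => [_|/= /andP[nt ns]].
  by rewrite /coprods /= big_seq1 mulr1.
rewrite (coprods_cons charx t s (fun h => (h == fone d)%:R : R^o)) mkforest_cons // charx.2.
case: t nt => a r nt; rewrite (tree_coprodE a (Forest nt)) big_rcons /= big_map.
rewrite [X in X + _]big1 ?add0r => [|q _ /=].
  rewrite -(IHs ns) -[LHS]/(_ * _); congr (_ * _); apply: eq_bigr => p _.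
  by rewrite fmul1f.
rewrite big1 ?scaler0 // => p _.
by rewrite fmul_eq1 (negbTE (tree_forest_neq1 _)) scaler0.
Qed.

Lemma star_dirac1 h : star x (dirac_forest R (fone d)) h = x h.
Proof.
rewrite -[in RHS](mkforestK h) -(coprods_one (all_tnormal h)).
by apply: eq_bigr => p _; rewrite /dirac_forest eq_sym.
Qed.

Lemma star_tree t u : tnormal t ->
  star x (dirac_forest R (tree_forest u)) (tree_forest t) = cut x t u.
Proof.
by move=> nt; rewrite /star coprod_tree //; apply: eq_bigr => q _; rewrite /dirac_forest eq_sym.
Qed.

(** [coprods_palm] evaluated on the indicator of the forest [uh]; the multiplicity on the left is
    the one that also appears in [sigma_mul]. *)
Lemma star_mul u h g : tnormal u ->
  star x (dirac_forest R (fmul (tree_forest u) h)) g * (count_mem u (fmul (tree_forest u) h))%:R =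
  \sum_(t <- planar g) cut x t u * star x (dirac_forest R h) (without t g).
Proof.
move=> nu; set uh := fmul _ _.
transitivity (\sum_(p <- coprods g) (x p.1 * (count_mem u p.2)%:R) * (p.2 == uh)%:R).
  rewrite /star big_distrl /=; apply: eq_bigr => p _.
  rewrite /dirac_forest eq_sym; case: eqVneq => [->|_]; first by rewrite !mulr1.
  by rewrite !mulr0 mul0r.
rewrite (coprods_palm charx g (fun k => (k == uh)%:R : R^o) nu).
apply: eq_big_seq => t tg; congr (_ * _).
rewrite /star [RHS](perm_big (coprods (rem t g))) /=; last first.
  by apply: perm_coprods; rewrite /without val_mkforest ?rem_normal // perm_sort.
apply: eq_bigr => p _; rewrite /dirac_forest eq_sym /uh.
by rewrite (inj_eq (tree_mul_inj nu)).
Qed.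

Lemma graft_inj a b h g : (graft a h == graft b g) = (a == b) && (h == g).
Proof.
apply/eqP/andP => [/(congr1 (@planar d))|[/eqP -> /eqP ->] //].
by rewrite !val_graft => -[-> /val_inj ->].
Qed.

Lemma cut_graft a b h g : cut x (PNode b (planar g)) (PNode a (planar h)) =
  (a == b)%:R * star x (dirac_forest R h) g.
Proof.
rewrite /cut tree_coprodE big_rcons /= mulr0 addr0.
rewrite big_map /star big_distrr /=; apply: eq_bigr => p _.
rewrite -graft_tree graft_inj /dirac_forest [h == _]eq_sym [a == _]eq_sym.
by case: eqVneq; case: eqVneq; rewrite ?mul1r ?mulr1 ?mulr0 ?mul0r.
Qed.

Lemma star_tree_one u : star x (dirac_forest R (tree_forest u)) (fone d) = 0.
Proof.
by rewrite /star coprod_one big_seq1 /dirac_forest (negbTE (tree_forest_neq1 u)) mulr0.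
Qed.

Section Expansions.
Variable V : lmodType R.
Implicit Types (S : forest d -> V).

(** For a tree [h] and elementary differentials [S] this is the predicted value of [f_h] after a
    step of the flow; for the empty forest it is the exponential series split up in
    [dual_sum_one]. *)
Definition dual_sum h (K : nat) S : V :=
  \sum_(g <- forests_upto d K)
    ((sigma h)%:R * weight R g * star x (dirac_forest R h) g) *: S g.

Definition cut_coef u t : R :=
  (sigma (tree_forest u))%:R * weight R (tree_forest t) * cut x t u.

(** [sigma_mul] absorbs the multiplicity in [star_mul], and [palm] then turns forests with a marked
    tree into pairs. Removing [u] from the index thus removes a tree [t] from each argument. *)
Lemma dual_sum_mul u h K S : tnormal u ->
  dual_sum (fmul (tree_forest u) h) K S =
  \sum_(t <- ntrees d K)
    cut_coef u t *: dual_sum h (K - tsize t) (fun g => S (fmul (tree_forest t) g)).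
Proof.
move=> nu; have := palm K (fun t g => ((sigma (tree_forest u))%:R * (sigma h)%:R *
  cut x t u * star x (dirac_forest R h) g) *: S (fmul (tree_forest t) g)).
rewrite /dual_sum => palmK.
transitivity (\sum_(t <- ntrees d K) \sum_(g <- forests_upto d (K - tsize t))
     (weight R (tree_forest t) * weight R g) *: (((sigma (tree_forest u))%:R * (sigma h)%:R *
  cut x t u * star x (dirac_forest R h) g) *: S (fmul (tree_forest t) g))); last first.
  apply: eq_bigr => t _; rewrite scaler_sumr; apply: eq_bigr => g _.
  by rewrite !scalerA /cut_coef; congr (_ *: _); ring.
rewrite -palmK; apply: eq_bigr => g _.
transitivity ((weight R g * ((sigma (tree_forest u))%:R * (sigma h)%:R) *
   (\sum_(t <- planar g) cut x t u * star x (dirac_forest R h) (without t g))) *: S g).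
  by rewrite -star_mul // sigma_mul // !natrM; congr (_ *: _); ring.
rewrite -!scalerA; congr (_ *: _); rewrite scaler_suml !scaler_sumr.
apply: eq_big_seq => t tg; rewrite mul_withoutK // !scalerA.
by congr (_ *: _); ring.
Qed.

(** The part with [j] trees, truncated at [K] nodes, of the exponential of the sum of
    [x t / sigma t] times [t] over all trees [t]. [exp_sumS] is the usual recursion between
    successive terms of an exponential. *)
Definition exp_sum (j K : nat) S : V :=
  \sum_(g <- forests_upto d K | size g == j) (weight R g * x g) *: S g.

Lemma exp_sumS j K S :
  j.+1%:R *: exp_sum j.+1 K S =
  \sum_(t <- ntrees d K) (weight R (tree_forest t) * x (tree_forest t)) *:
    exp_sum j (K - tsize t) (fun g => S (fmul (tree_forest t) g)).
Proof.
have := palm K (fun t g => if size g == j then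
  (x (tree_forest t) * x g) *: S (fmul (tree_forest t) g) else 0).
rewrite /exp_sum => palmK.
transitivity (\sum_(t <- ntrees d K) \sum_(g <- forests_upto d (K - tsize t))
  (weight R (tree_forest t) * weight R g) *: (if size g == j then
  (x (tree_forest t) * x g) *: S (fmul (tree_forest t) g) else 0)); last first.
  apply: eq_bigr => t _; rewrite scaler_sumr [RHS]big_mkcond.
  apply: eq_bigr => g _; case: ifP => _; last by rewrite scaler0.
  by rewrite !scalerA; congr (_ *: _); ring.
rewrite -palmK scaler_sumr big_mkcond; apply: eq_bigr => g _.
rewrite (eq_big_seq (fun t => if size g == j.+1 then x g *: S g else 0)); last first.
  move=> t tg; have szg : size g = (size (without t g)).+1.
    rewrite -{1}(mul_withoutK tg) (perm_size (perm_tree_mul _ (mem_tnormal tg))) //.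
  by rewrite szg eqSS -charx.2 mul_withoutK.
case: ifP => [/eqP gj|_]; last by rewrite big1 ?scaler0.
rewrite big_const_seq iter_addr_0 count_predT gj -[in RHS]scaler_nat !scalerA.
by congr (_ *: _); ring.
Qed.

Lemma exp_sum0 K S : exp_sum 0 K S = S (fone d).
Proof.
rewrite /exp_sum -big_filter (_ : [seq g <- _ | _] = [:: fone d]).
  by rewrite big_seq1 /weight sigma_one charx.1 invr1 mulr1 scale1r.
rewrite (@eq_in_filter _ _ (pred1 (fone d))).
  by rewrite filter_pred1_uniq ?forests_upto_uniq // mem_forests_upto.
move=> g _ /=; apply/eqP/eqP => [/size0nil g0|-> //].
by apply: val_inj.
Qed.

Lemma dual_sum_one K m S : (K < m)%N ->
  dual_sum (fone d) K S = \sum_(j < m) exp_sum j K S.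
Proof.
move=> Km; rewrite /exp_sum (exchange_big_dep xpredT) //=.
apply: eq_big_seq => g; rewrite mem_forests_upto => gK.
have gm : (size g < m)%N by rewrite (leq_ltn_trans (size_fsize g)) // (leq_ltn_trans gK).
rewrite (big_pred1 (Ordinal gm)); last by move=> j; rewrite eq_sym.
by rewrite sigma_one mul1r star_dirac1.
Qed.

End Expansions.
End Characters.
End CoproductSums.

(** * Iterated differentials *)

Import numFieldNormedType.Exports.
Local Open Scope classical_set_scope.
Local Open Scope ring_scope.

Section MeanValue.
Variables (R : realType) (n : nat).
Local Notation V := 'rV[R]_n.

Lemma rV_norm_le (v : V) (C : R) : 0 <= C -> (forall j, `|v 0 j| <= C) -> `|v| <= C.
Proof.
move=> C0 vC; rewrite /Num.norm /= mx_normrE; apply: bigmax_le => // -[i j] _ /=.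
by rewrite (ord1 i).
Qed.

Lemma coord_norm_le (v : V) j : `|v 0 j| <= `|v|.
Proof.
rewrite [leRHS]/Num.norm /= mx_normrE.
exact: (le_bigmax _ (fun ij : 'I_1 * 'I_n => `|v ij.1 ij.2|) (0, j)).
Qed.

Lemma is_derive_coord (F : R -> V) (r : R) (dF : V) j :
  is_derive r 1 F dF -> is_derive r 1 (fun r => F r 0 j) (dF 0 j).
Proof.
move=> dFr; have derF : derivable F r 1 by case: dFr.
apply: DeriveDef; first by have /derivable_mxP := derF; apply.
have <- : 'D_1 F r = dF by case: dFr.
by rewrite derive_mx // mxE.
Qed.

Lemma mean_value_coord (F dF : R -> V) (a : R) j : 0 < a ->
  (forall r : R, is_derive r 1 F (dF r)) ->
  exists2 c, 0 <= c <= a & F a 0 j - F 0 0 j = dF c 0 j * a.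
Proof.
move=> a0 dFr; have dFj r := is_derive_coord j (dFr r).
have [|c + ->] := @MVT R (fun r => F r 0 j) (fun r => dF r 0 j) 0 a a0 (fun x _ => dFj x).
  apply: continuous_subspaceT => x; apply: differentiable_continuous.
  exact/derivable1_diffP.
by rewrite in_itv /= => /andP[c0 ca]; exists c; rewrite ?subr0 // !ltW.
Qed.

(** The norm is the maximum of the coordinates, so the real mean value theorem suffices, although
    the intermediate point depends on the coordinate. *)
Lemma mean_value_le (F dF : R -> V) (C : R) :
  (forall r : R, is_derive r 1 F (dF r)) -> (forall r : R, 0 <= r <= 1 -> `|dF r| <= C) ->
  `|F 1 - F 0| <= C.
Proof.
move=> dFr dFC; have C0 : 0 <= C by rewrite (le_trans _ (dFC 0 _)) ?lexx ?ler01.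
apply: rV_norm_le => // j; rewrite !mxE.
have [c c01 ->] := mean_value_coord j ltr01 dFr.
by rewrite mulr1 (le_trans (coord_norm_le _ _)) // dFC.
Qed.

Lemma is_derive_line (g : V -> V) (z v : V) (r : R) :
  differentiable g (z + r *: v) ->
  is_derive r 1 (fun r => g (z + r *: v)) ('d g (z + r *: v) v).
Proof.
move=> dg; have dl : is_diff r (fun r : R => z + r *: v) (fun r => r *: v).
  by apply: is_diff_eq => /=; apply/funext => h; rewrite /= add0r.
have dgl : differentiable (g \o (fun r : R => z + r *: v)) r by apply: differentiable_comp.
apply: DeriveDef; first exact/derivable1_diffP.
rewrite deriveE // diff_comp //= diff_val.
by rewrite scale1r.
Qed.

End MeanValue.

Lemma diff_lincomb (R : realType) (V W : normedModType R) (F G : V -> W) (a : R) (y u : V) :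
  differentiable F y -> differentiable G y ->
  'd (fun z => a *: F z + G z) y u = a *: 'd F y u + 'd G y u.
Proof.
move=> dF dG; have daF : differentiable (a \*: F) y by exact: differentiableZ.
rewrite (_ : (fun z => _) = (a \*: F) + G) //.
have D := congr1 (fun h : V -> W => h u) (diffD daF dG).
have Z := congr1 (fun h : V -> W => h u) (diffZ a dF).
by apply: (etrans D); apply: (congr1 (fun w => w + 'd G y u) Z).
Qed.

Section IteratedDifferentials.
Variables (R : realType) (n : nat).
Local Notation V := 'rV[R]_n.
Variables (phi : V -> V) (smooth_phi : smooth phi).
Implicit Types (l vs : seq V) (u v w y z : V).

Lemma iter_diff_linear l r (a : R) v w y :
  iter_diff phi (l ++ (a *: v + w) :: r) y =
  a *: iter_diff phi (l ++ v :: r) y + iter_diff phi (l ++ w :: r) y.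
Proof.
elim: l y => [|u l IHl] y /=; first by rewrite linearP.
have -> : iter_diff phi (l ++ (a *: v + w) :: r) =
    (fun z => a *: iter_diff phi (l ++ v :: r) z + iter_diff phi (l ++ w :: r) z).
  by apply/funext => z; rewrite IHl.
exact: diff_lincomb.
Qed.

Lemma iter_diffD l (r : seq V) v w y :
  iter_diff phi (l ++ (v + w) :: r) y =
  iter_diff phi (l ++ v :: r) y + iter_diff phi (l ++ w :: r) y.
Proof. by have := iter_diff_linear l r 1 v w y; rewrite !scale1r. Qed.

Lemma iter_diff0 l r y : iter_diff phi (l ++ 0 :: r) y = 0.
Proof.
have := iter_diffD l r 0 0 y; rewrite addr0 => /(congr1 (fun x => x - iter_diff phi (l ++ 0 :: r) y)).
by rewrite subrr addrK.
Qed.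

Lemma iter_diffZ l r (a : R) v y :
  iter_diff phi (l ++ (a *: v) :: r) y = a *: iter_diff phi (l ++ v :: r) y.
Proof. by have := iter_diff_linear l r a v 0 y; rewrite iter_diff0 !addr0. Qed.

Lemma iter_diffB l (r : seq V) v w y :
  iter_diff phi (l ++ (v - w) :: r) y =
  iter_diff phi (l ++ v :: r) y - iter_diff phi (l ++ w :: r) y.
Proof. by rewrite iter_diffD -scaleN1r iter_diffZ scaleN1r. Qed.

Lemma iter_diff_sum l r y I (s : seq I) (P : pred I) (F : I -> V) :
  iter_diff phi (l ++ (\sum_(i <- s | P i) F i) :: r) y =
  \sum_(i <- s | P i) iter_diff phi (l ++ F i :: r) y.
Proof.
elim/big_rec2: _ => [|i x1 x2 _ <-]; first exact: iter_diff0.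
exact: iter_diffD.
Qed.

Lemma is_derive_iter_diff vs z v (r : R) :
  is_derive r 1 (fun r : R => iter_diff phi vs (z + r *: v)) (iter_diff phi (v :: vs) (z + r *: v)).
Proof. exact: is_derive_line. Qed.

Lemma second_difference vs u v y (a : R) j : 0 < a ->
  exists c : R * R, [/\ 0 <= c.1 <= a, 0 <= c.2 <= a &
  (iter_diff phi vs (y + a *: v + a *: u) - iter_diff phi vs (y + a *: u)
   - (iter_diff phi vs (y + a *: v) - iter_diff phi vs y)) 0 j =
  iter_diff phi [:: v, u & vs] (y + c.1 *: u + c.2 *: v) 0 j * a * a].
Proof.
move=> a0.
have d1 (r : R) := is_deriveB (@is_derive_iter_diff vs (y + a *: v) u r) (@is_derive_iter_diff vs y u r).
have [c1 c1a] := mean_value_coord j a0 d1.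
rewrite !fctE scale0r !addr0.
have d2 (r : R) := @is_derive_iter_diff (u :: vs) (y + c1 *: u) v r.
have [c2 c2a] := mean_value_coord j a0 d2.
move=> E2; rewrite !mxE => E1.
exists (c1, c2); split=> //=; rewrite E1 [y + _ + _]addrAC.
by rewrite scale0r addr0 /= in E2; rewrite /= E2.
Qed.

Lemma iter_diff_near vs y (e : R) : 0 < e ->
  exists2 del, 0 < del & forall z, `|z| < del ->
    `|iter_diff phi vs (y + z) - iter_diff phi vs y| < e.
Proof.
move=> e0; have /differentiable_continuous/cvgrPdist_lt/(_ _ e0) := smooth_phi vs y.
move=> /nbhs_ballP[del /= del0 D]; exists del => // z zd; rewrite distrC; apply: D.
by rewrite -ball_normE /= opprD addrA subrr sub0r normrN.
Qed.

(* Schwarz: both mixed derivatives are limits of the same second difference. *)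
Lemma iter_diff_swap vs u v y :
  iter_diff phi [:: v, u & vs] y = iter_diff phi [:: u, v & vs] y.
Proof.
apply/rowP => j; apply/eqP; rewrite -subr_eq0 -normr_le0.
apply/ler_addgt0Pl => e e0; rewrite addr0.
have e20 : 0 < e / 2 by rewrite divr_gt0.
have [d1 d10 D1] := iter_diff_near [:: v, u & vs] y e20.
have [d2 d20 D2] := iter_diff_near [:: u, v & vs] y e20.
(* This side keeps every intermediate point inside both neighbourhoods; the added 1 keeps the
   denominator positive when [u] and [v] vanish. *)
pose a := Num.min d1 d2 / (2 * (`|u| + `|v| + 1)).
have uv0 : 0 < `|u| + `|v| + 1 by rewrite ltr_wpDl // addr_ge0.
have a0 : 0 < a by rewrite divr_gt0 ?lt_min ?d10 // mulr_gt0.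
have [c [c1 c2 E1]] := second_difference vs u v y j a0.
have [c' [c1' c2' E2]] := second_difference vs v u y j a0.
have small (p q : R) (p' q' : V) : 0 <= p <= a -> 0 <= q <= a ->
    `|p'| + `|q'| = `|u| + `|v| -> `|p *: p' + q *: q'| < Num.min d1 d2.
  move=> /andP[p0 pa] /andP[q0 qa] pq.
  apply: (@le_lt_trans _ _ (a * (`|u| + `|v|))).
    rewrite -pq (le_trans (ler_normD _ _)) // !normrZ !ger0_norm // mulrDr.
    by apply: lerD; apply: ler_wpM2r.
  rewrite /a mulrAC ltr_pdivrMr; last by rewrite mulr_gt0.
  have : 0 < Num.min d1 d2 by rewrite lt_min d10.
  by move: (Num.min _ _) uv0 => m uv0 m0; rewrite ltr_pM2l //; have := normr_ge0 u; have := normr_ge0 v; lra.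
have m1 : Num.min d1 d2 <= d1 by rewrite ge_min lexx.
have m2 : Num.min d1 d2 <= d2 by rewrite ge_min lexx orbT.
have A := D1 _ (lt_le_trans (small _ _ _ _ c1 c2 erefl) m1).
have B := D2 _ (lt_le_trans (small _ _ _ _ c1' c2' (addrC _ _)) m2).
rewrite !addrA in A B.
have := ltrD (le_lt_trans (coord_norm_le _ j) A) (le_lt_trans (coord_norm_le _ j) B).
have -> : (iter_diff phi [:: u, v & vs] (y + c'.1 *: v + c'.2 *: u) -
    iter_diff phi [:: u, v & vs] y) 0 j =
    iter_diff phi [:: v, u & vs] (y + c.1 *: u + c.2 *: v) 0 j -
    iter_diff phi [:: u, v & vs] y 0 j :> R.
  rewrite !mxE; congr (_ - _); have aa : a != 0 by rewrite gt_eqF.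
  apply: (mulIf aa); apply: (mulIf aa); rewrite -E1 -E2 !mxE.
  by rewrite (addrAC y); ring.
rewrite -splitr !mxE => AB; apply/ltW/(le_lt_trans _ AB).
by rewrite [X in _ <= X + _]distrC; exact: ler_distD.
Qed.

Lemma iter_diff_perm vs ws y : perm_eq vs ws -> iter_diff phi vs y = iter_diff phi ws y.
Proof.
elim: vs ws y => [|v vs IHvs] ws y; first by move=> /perm_size/esym/size0nil ->.
move=> vws; have vw : v \in ws by rewrite -(perm_mem vws) mem_head.
have -> : iter_diff phi (v :: vs) = iter_diff phi (v :: rem v ws).
  apply/funext => z /=; suff -> : iter_diff phi vs = iter_diff phi (rem v ws) by [].
  apply/funext => z'; apply: IHvs; rewrite -(perm_cons v).
  exact: perm_trans vws (perm_to_rem vw).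
elim: ws y vw {vws} => //= w ws IHws y; rewrite inE eq_sym; case: eqVneq => [->//|_ /= vw].
rewrite [LHS]iter_diff_swap /=; congr ('d _ y w).
by apply/funext => z; rewrite -IHws.
Qed.

Definition norm_prod vs : R := \prod_(v <- vs) `|v|.

(** [bounded_derivatives] speaks of arguments of norm at most 1 only; homogeneity in each argument
    gives the bound for all vectors. *)
Lemma iter_diff_le k (K : R) :
  (forall vs y, (size vs <= k)%N -> (forall v, v \in vs -> `|v| <= 1) ->
     `|iter_diff phi vs y| <= K) ->
  forall vs y, (size vs <= k)%N -> `|iter_diff phi vs y| <= K * norm_prod vs.
Proof.
move=> phiK vs y vsk.
(* [l] collects the arguments that are already normalised. *)
suff gen r l : (size (l ++ r) <= k)%N -> (forall v, v \in l -> `|v| <= 1) ->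
    `|iter_diff phi (l ++ r) y| <= K * norm_prod r by apply: (gen vs [::]) => //= v; rewrite in_nil.
elim: r l => [|v r IHr] l.
  by rewrite cats0 /norm_prod big_nil mulr1; exact: phiK.
rewrite /norm_prod big_cons => sk l1.
have [->|v0] := eqVneq v 0; first by rewrite iter_diff0 // !normr0 mul0r mulr0.
have nv0 : `|v| != 0 by rewrite normr_eq0.
have -> : v = `|v| *: (`|v|^-1 *: v) by rewrite scalerA mulfV // scale1r.
rewrite iter_diffZ // normrZ normr_id [in leRHS]normrZ normr_id.
rewrite [X in `|v| * X * _]normrZ normfV normr_id mulVf // mulr1 mulrCA ler_pM2l ?normr_gt0 //.
rewrite -cat_rcons; apply: IHr; first by move: sk; rewrite cat_rcons !size_cat.
move=> w; rewrite mem_rcons in_cons => /orP[/eqP ->|/l1 //].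
by rewrite normrZ normfV normr_id mulVf // lexx.
Qed.

End IteratedDifferentials.

(** * Orders of magnitude *)

(* A pair of [W]-valued functions of a parameter [om : Om] is encoded as
   [F : Om -> bool -> W].  [lipO del mu F] bounds both members by [C * mu] and their
   difference by [C * mu * del]: one calculus of orders of magnitude thereby gives
   the size of an expression and its Lipschitz dependence on the data at once. *)
Definition lipO (R : realType) (Om : Type) (del : Om -> R) (W : normedModType R)
    (mu : Om -> R) (F : Om -> bool -> W) : Prop :=
  exists2 C : R, 0 <= C & forall om,
    (forall b, `|F om b| <= C * mu om) /\ `|F om true - F om false| <= C * mu om * del om.

(** Meant for base points: they range over the whole space, so only their difference can be
    controlled. *)
Definition lip (R : realType) (Om : Type) (del : Om -> R) (W : normedModType R)
    (F : Om -> bool -> W) : Prop :=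
  exists2 C : R, 0 <= C & forall om, `|F om true - F om false| <= C * del om.

Section LipO.
Variables (R : realType) (Om : Type) (del : Om -> R).
Hypothesis del_ge0 : forall om, 0 <= del om.
Local Notation O := (lipO del).

Section Module.
Variable W : normedModType R.
Implicit Types (mu nu : Om -> R) (F G : Om -> bool -> W).

Lemma lipO_le (K : R) mu nu F : 0 <= K -> (forall om, mu om <= K * nu om) ->
  O mu F -> O nu F.
Proof.
move=> K0 munu [C C0 FC]; exists (C * K) => [|om]; first exact: mulr_ge0.
have [F1 F2] := FC om; have mn : C * mu om <= C * K * nu om.
  by rewrite -mulrA ler_wpM2l.
split=> [b|]; first exact: le_trans (F1 b) mn.
by apply: le_trans F2 _; rewrite ler_wpM2r.
Qed.

Lemma eq_lipO mu nu F G : (forall om b, F om b = G om b) -> mu =1 nu -> O mu F -> O nu G.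
Proof.
move=> FG /funext <-; congr (O mu _).
by apply/funext => om; apply/funext => b.
Qed.

Lemma lipO0 mu : (forall om, 0 <= mu om) -> O mu (fun _ _ => 0 : W).
Proof.
move=> mu0; exists 0 => // om; rewrite !mul0r subrr normr0.
by split.
Qed.

Lemma lipOD mu F G : O mu F -> O mu G -> O mu (fun om b => F om b + G om b).
Proof.
move=> [C C0 FC] [D D0 GD]; exists (C + D) => [|om]; first exact: addr_ge0.
have [F1 F2] := FC om; have [G1 G2] := GD om; rewrite !mulrDl; split=> [b|].
  by rewrite (le_trans (ler_normD _ _)) // lerD.
by rewrite opprD addrACA (le_trans (ler_normD _ _)) // lerD.
Qed.

Lemma lipOZ (k : R) mu F : O mu F -> O mu (fun om b => k *: F om b).
Proof.
move=> [C C0 FC]; exists (`|k| * C) => [|om]; first exact: mulr_ge0.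
have [F1 F2] := FC om; split=> [b|].
  by rewrite normrZ -mulrA ler_wpM2l.
by rewrite -scalerBr normrZ -!mulrA ler_wpM2l // mulrA.
Qed.

Lemma lipO_sum (I : eqType) (s : seq I) mu (F : I -> Om -> bool -> W) :
  (forall om, 0 <= mu om) -> (forall i, i \in s -> O mu (F i)) ->
  O mu (fun om b => \sum_(i <- s) F i om b).
Proof.
move=> mu0; elim: s => [|i s IHs] Fs.
  by apply: (eq_lipO _ (fun=> erefl) (lipO0 mu0)) => om b; rewrite big_nil.
have Os : O mu (fun om b => \sum_(i <- s) F i om b).
  by apply: IHs => j js; apply: Fs; rewrite inE js orbT.
apply: (eq_lipO _ (fun=> erefl) (lipOD (Fs i (mem_head _ _)) Os)) => om b.
by rewrite big_cons.
Qed.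

Lemma lipO_scale mu nu (g : Om -> bool -> R) F :
  O mu g -> O nu F -> O (fun om => mu om * nu om) (fun om b => g om b *: F om b).
Proof.
(* The factor 2 pays for the two terms of the product rule in the difference. *)
move=> [C C0 gC] [D D0 FD]; exists (2 * (C * D)) => [|om].
  by rewrite !mulr_ge0.
have [g1 g2] := gC om; have [F1 F2] := FD om.
have Cmu : 0 <= C * mu om by exact: le_trans (normr_ge0 _) (g1 true).
have Dnu : 0 <= D * nu om by exact: le_trans (normr_ge0 _) (F1 true).
have E : 2 * (C * D) * (mu om * nu om) = C * mu om * (D * nu om) + C * mu om * (D * nu om).
  by ring.
rewrite E; split=> [b|].
  by rewrite normrZ; apply: ler_wpDl; [exact: mulr_ge0|exact: ler_pM].
have -> : g om true *: F om true - g om false *: F om false =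
    (g om true - g om false) *: F om true + g om false *: (F om true - F om false).
  by rewrite scalerBl scalerBr addrA subrK.
rewrite mulrDl (le_trans (ler_normD _ _)) // !normrZ lerD //.
  by rewrite mulrAC ler_pM.
by rewrite -mulrA ler_pM // mulrA.
Qed.

Lemma lipO_lip (B : R) mu F : (forall om, mu om <= B) -> O mu F -> lip del F.
Proof.
move=> muB [C C0 FC]; exists (C * `|B|) => [|om]; first exact: mulr_ge0.
have [_ F2] := FC om; apply: le_trans F2 _; rewrite ler_wpM2r // ler_wpM2l //.
exact: le_trans (muB om) (ler_norm _).
Qed.

Lemma lipD F G : lip del F -> lip del G -> lip del (fun om b => F om b + G om b).
Proof.
move=> [C C0 FC] [D D0 GD]; exists (C + D) => [|om]; first exact: addr_ge0.
rewrite mulrDl opprD addrACA (le_trans (ler_normD _ _)) // lerD //.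
Qed.

Lemma lip_add (B : R) nu (z v : Om -> bool -> W) : lip del z -> O nu v -> (forall om, 0 <= nu om <= B) ->
  lip del (fun om b => z om b + v om b).
Proof.
move=> zL vO nuB; apply: lipD zL _; apply: (lipO_lip (B := B) _ vO) => om.
by case/andP: (nuB om).
Qed.

End Module.
End LipO.

Section Pullback.
Variables (R : realType) (Om Om' : Type) (del : Om -> R) (p : Om' -> Om).
Variable W : normedModType R.

(** Parameters can be added, such as the point of a segment in [lipO_taylor_rem], or restricted, as
    in [rconfig]. *)
Lemma lipO_pull mu (F : Om -> bool -> W) :
  lipO del mu F -> lipO (del \o p) (mu \o p) (fun om => F (p om)).
Proof. by move=> [C C0 FC]; exists C => // om; exact: FC. Qed.

Lemma lip_pull (F : Om -> bool -> W) : lip del F -> lip (del \o p) (fun om => F (p om)).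
Proof. by move=> [C C0 FC]; exists C => // om; exact: FC. Qed.
End Pullback.

(** * Orders of magnitude of iterated differentials and Taylor remainders *)

Section LipOSequences.
Variables (R : realType) (n : nat).
Local Notation V := 'rV[R]_n.

(** The order of a list of arguments is the product of their orders, as a multilinear map
    requires. *)
Inductive lipOs (Om : Type) (del : Om -> R) :
    (Om -> R) -> seq (Om -> bool -> V) -> Prop :=
| lipOs_nil : lipOs del (fun=> 1) [::]
| lipOs_cons mu nu a s : (forall om, 0 <= mu om) -> lipO del mu a -> lipOs del nu s ->
    lipOs del (fun om => mu om * nu om) (a :: s).

Definition values (Om : Type) (s : seq (Om -> bool -> V)) om b := [seq a om b | a <- s].

Lemma lipOs_pull (Om Om' : Type) (del : Om -> R) (p : Om' -> Om) mu s :
  lipOs del mu s ->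
  lipOs (del \o p) (mu \o p) [seq (fun om => a (p om)) | a <- s].
Proof.
elim=> [|mu' nu a s' mu0 Oa _ IH] /=; first exact: lipOs_nil.
apply: (@lipOs_cons _ _ (mu' \o p) (nu \o p)) => // [om|]; first exact: mu0.
exact: lipO_pull.
Qed.

Variables (phi : V -> V) (smooth_phi : smooth phi) (m : nat) (K : R).
Hypothesis K_ge0 : 0 <= K.
Hypothesis phi_le : forall vs y, (size vs <= m)%N -> `|iter_diff phi vs y| <= K * norm_prod vs.

Lemma norm_prod_cat (l r : seq V) : norm_prod (l ++ r) = norm_prod l * norm_prod r.
Proof. exact: big_cat. Qed.

Lemma norm_prod_ge0 (l : seq V) : 0 <= norm_prod l.
Proof. exact: prodr_ge0. Qed.

Lemma iter_diff_lip vs z1 z0 : (size vs < m)%N ->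
  `|iter_diff phi vs z1 - iter_diff phi vs z0| <= K * norm_prod vs * `|z1 - z0|.
Proof.
move=> vsm; have D (r : R) := @is_derive_iter_diff _ _ _ smooth_phi vs z0 (z1 - z0) r.
have := mean_value_le (C := K * norm_prod vs * `|z1 - z0|) D.
rewrite scale1r scale0r addr0 [z0 + _]addrC subrK; apply => r _.
rewrite (le_trans (phi_le _ _)) // /norm_prod big_cons.
by rewrite [`|z1 - z0| * _]mulrC mulrA.
Qed.

Section FixedOm.
Variables (Om : Type) (del : Om -> R).
Hypothesis del_ge0 : forall om, 0 <= del om.

Lemma lipOs_ge0 mu s : lipOs del mu s -> forall om, 0 <= mu om.
Proof. by elim=> [|mu' nu a s' mu0 Oa _ IH] om //; apply: mulr_ge0. Qed.

Lemma lipOs_norm mu s : lipOs del mu s ->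
  exists2 C : R, 0 <= C & forall om b, norm_prod (values s om b) <= C * mu om.
Proof.
elim=> [|mu' nu a s' mu0 [C C0 aC] Os [D D0 sD]].
  by exists 1 => // om b; rewrite mulr1 /norm_prod big_nil.
exists (C * D) => [|om b]; first exact: mulr_ge0.
rewrite /norm_prod /= big_cons mulrACA ler_pM ?norm_prod_ge0 ?sD //.
exact: (aC om).1.
Qed.

(** The arguments are switched from [true] to [false] one at a time; [l] holds those already
    switched, together with any that stay fixed. *)
Lemma lipOs_telescope mu s : lipOs del mu s ->
  exists2 C : R, 0 <= C & forall om l y, (size l + size s <= m)%N ->
    `|iter_diff phi (l ++ values s om true) y - iter_diff phi (l ++ values s om false) y|
      <= C * norm_prod l * mu om * del om.
Proof.
elim=> [|mu' nu a s' mu0 [Ca Ca0 aC] Os [D D0 sD]].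
  by exists 0 => // om l y _; rewrite subrr normr0 !mul0r.
have [Cs Cs0 sC] := lipOs_norm Os.
exists (K * Ca * Cs + D * Ca) => [|om l y sz]; first by rewrite addr_ge0 ?mulr_ge0.
have [a1 a2] := aC om; rewrite /= in sz *.
have -> : iter_diff phi (l ++ a om true :: values s' om true) y -
    iter_diff phi (l ++ a om false :: values s' om false) y =
    iter_diff phi (l ++ (a om true - a om false) :: values s' om true) y +
    (iter_diff phi (rcons l (a om false) ++ values s' om true) y -
     iter_diff phi (rcons l (a om false) ++ values s' om false) y).
  by rewrite iter_diffB // !cat_rcons addrA subrK.
rewrite !mulrDl (le_trans (ler_normD _ _)) //; apply: lerD.
  apply: le_trans (phi_le _ _) _; first by rewrite size_cat /= size_map.
  rewrite norm_prod_cat /norm_prod big_cons -/(norm_prod _) -/(norm_prod _).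
  have -> : K * Ca * Cs * norm_prod l * (mu' om * nu om) * del om =
      K * (norm_prod l * ((Ca * mu' om * del om) * (Cs * nu om))) by ring.
  rewrite ler_wpM2l // ler_wpM2l ?norm_prod_ge0 // ler_pM ?norm_prod_ge0 //.
have := sD om (rcons l (a om false)) y; rewrite size_rcons addSnnS => /(_ sz) H.
apply: le_trans H _; rewrite -cats1 norm_prod_cat {2}/norm_prod big_seq1.
have -> : D * Ca * norm_prod l * (mu' om * nu om) * del om =
    D * (norm_prod l * (Ca * mu' om)) * nu om * del om by ring.
rewrite ler_wpM2r // ler_wpM2r //; first exact: (lipOs_ge0 Os).
by rewrite ler_wpM2l // ler_wpM2l ?norm_prod_ge0.
Qed.

(** The inequality on [size s] is strict because the dependence on the base point costs one more
    derivative. *)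
Lemma lipO_iter_diff mu s z : lipOs del mu s -> lip del z -> (size s < m)%N ->
  lipO del mu (fun om b => iter_diff phi (values s om b) (z om b)).
Proof.
move=> Os [Cz Cz0 zC] sm; have [C1 C10 s1] := lipOs_norm Os.
have [C2 C20 s2] := lipOs_telescope Os; have mu0 := lipOs_ge0 Os.
exists (K * C1 + (K * C1 * Cz + C2)) => [|om].
  by rewrite !addr_ge0 ?mulr_ge0.
have P0 : 0 <= C1 * mu om by rewrite mulr_ge0.
split=> [b|].
  rewrite (le_trans (phi_le _ _)) ?size_map 1?ltnW //.
  rewrite mulrDl; apply: ler_wpDr; first by rewrite mulr_ge0 ?addr_ge0 ?mulr_ge0.
  by rewrite -mulrA ler_wpM2l.
have -> : iter_diff phi (values s om true) (z om true) -
    iter_diff phi (values s om false) (z om false) =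
    (iter_diff phi (values s om true) (z om true) -
     iter_diff phi (values s om true) (z om false)) +
    (iter_diff phi (values s om true) (z om false) -
     iter_diff phi (values s om false) (z om false)) by rewrite addrA subrK.
apply: le_trans (ler_normD _ _) _; rewrite !mulrDl.
apply: ler_wpDl; first by rewrite !mulr_ge0.
apply: lerD.
  apply: le_trans (iter_diff_lip _ _ _) _; first by rewrite size_map.
  have -> : K * C1 * Cz * mu om * del om = K * (C1 * mu om) * (Cz * del om) by ring.
  by apply: ler_pM; rewrite ?mulr_ge0 ?norm_prod_ge0 // ler_wpM2l.
have := s2 om [::] (z om false); rewrite /norm_prod big_nil mulr1 => -> //.
exact: ltnW.
Qed.

End FixedOm.

(** The extra arguments [vs] make the notion stable under differentiation: along the segment, the
    derivative lowers the order by one and adds [v] to [vs] ([is_derive_taylor_rem]). *)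
Definition taylor_rem (k : nat) (vs : seq V) (z v : V) : V :=
  iter_diff phi vs (z + v) -
  \sum_(j < k) (j`!%:R)^-1 *: iter_diff phi (nseq j v ++ vs) z.

Lemma nseqS_cat (T : Type) j (x : T) s : nseq j.+1 x ++ s = nseq j x ++ x :: s.
Proof. by elim: j => //= j ->. Qed.

Lemma iter_diff_nseqZ j (r : R) v vs z :
  iter_diff phi (nseq j (r *: v) ++ vs) z = r ^+ j *: iter_diff phi (nseq j v ++ vs) z.
Proof.
elim: j vs => [|j IHj] vs; first by rewrite expr0 scale1r.
by rewrite !nseqS_cat IHj iter_diffZ // scalerA -exprSr.
Qed.

Lemma taylor_rem0 k vs z : taylor_rem k.+1 vs z 0 = 0.
Proof.
rewrite /taylor_rem big_ord_recl big1 => [|j _].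
  by rewrite addr0 addr0 /= fact0 invr1 scale1r subrr.
by rewrite lift0 nseqS_cat iter_diff0 // scaler0.
Qed.

Lemma is_derive_powZ j (w : V) (r : R) :
  is_derive r 1 (fun r : R => r ^+ j.+1 *: w) ((j.+1%:R * r ^+ j) *: w).
Proof.
have dX : differentiable (fun r : R => r ^+ j.+1) r.
  apply/derivable1_diffP; exact: exprn_derivable.
have dXw : differentiable (fun r : R => r ^+ j.+1 *: w) r by exact: differentiableZl.
apply: DeriveDef; first exact/derivable1_diffP.
rewrite deriveE // diffZl //=; congr (_ *: w).
by rewrite -deriveE // exp_derive [LHS]mulr1.
Qed.

Lemma is_derive_taylor_rem k vs z v (r : R) :
  is_derive r 1 (fun r : R => taylor_rem k.+1 vs z (r *: v))
    (taylor_rem k (v :: vs) z (r *: v)).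
Proof.
have -> : (fun r : R => taylor_rem k.+1 vs z (r *: v)) =
    (fun r : R => iter_diff phi vs (z + r *: v)) -
    (cst (iter_diff phi vs z) +
     \sum_(j < k) (fun r : R => r ^+ j.+1 *:
        ((j.+1)`!%:R^-1 *: iter_diff phi (nseq j.+1 v ++ vs) z))).
  apply/funext => q; rewrite /taylor_rem big_ord_recl fact0 invr1 scale1r.
  rewrite !fctE fct_sumE; congr (_ - (_ + _)); apply: eq_bigr => j _.
  rewrite iter_diff_nseqZ.
  by rewrite !scalerA mulrC.
have -> : taylor_rem k (v :: vs) z (r *: v) = iter_diff phi (v :: vs) (z + r *: v) -
   (0 + \sum_(j < k) (j.+1%:R * r ^+ j) *:
        ((j.+1)`!%:R^-1 *: iter_diff phi (nseq j.+1 v ++ vs) z)).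
  rewrite add0r /taylor_rem; congr (_ - _); apply: eq_bigr => j _.
  rewrite iter_diff_nseqZ !scalerA; congr (_ *: iter_diff phi _ z).
    have j0 : (j`!)%:R != 0 :> R by rewrite pnatr_eq0 -lt0n fact_gt0.
    have j1 : j.+1%:R != 0 :> R by rewrite pnatr_eq0.
    by rewrite factS natrM invfM [RHS]mulrACA mulfV // mul1r mulrC.
  by rewrite nseqS_cat.
apply: is_deriveB; first exact: is_derive_iter_diff.
apply: is_deriveD; apply: is_derive_sum => j; exact: is_derive_powZ.
Qed.

Lemma lipO_taylor_rem k (Om : Type) (del : Om -> R) mu s z v nu (B : R) :
  (forall om, 0 <= del om) -> lipOs del mu s -> lip del z -> lipO del nu v ->
  (forall om, 0 <= nu om <= B) -> (size s + k < m)%N ->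
  lipO del (fun om => mu om * nu om ^+ k)
    (fun om b => taylor_rem k (values s om b) (z om b) (v om b)).
Proof.
elim: k Om del mu s z v nu => [|k IHk] Om del mu s z v nu del0 Os zL vO nuB sk.
  have zvL := lip_add del0 zL vO nuB.
  rewrite addn0 in sk; apply: (eq_lipO _ _ (lipO_iter_diff del0 Os zvL sk)).
    by move=> om b; rewrite /taylor_rem big_ord0 subr0.
  by move=> om; rewrite expr0 mulr1.
(* The mean value inequality needs a bound on the derivative that is uniform in [r]. Making [r] part
   of the parameter gives it from the induction hypothesis. *)
pose Om' := (Om * {r : R | 0 <= r <= 1})%type.
pose del' : Om' -> R := del \o fst.
pose v' (om : Om') b := sval om.2 *: v om.1 b.
have v'O : lipO del' (nu \o fst) v'.
  have [C C0 vC] := vO; exists C => // -[om [r r01]]; have [r0 r1] := andP r01.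
  have [v1 v2] := vC om; rewrite /v' /del' /=; split=> [b|].
    rewrite normrZ ger0_norm // (le_trans _ (v1 b)) // -[leRHS]mul1r ler_wpM2r //.
  rewrite -scalerBr normrZ ger0_norm // (le_trans _ v2) // -[leRHS]mul1r ler_wpM2r //.
have s'O : lipOs del' ((fun om => nu om * mu om) \o fst)
    [seq (fun om : Om' => a om.1) | a <- v :: s].
  apply: (lipOs_pull fst); apply: lipOs_cons => // om.
  by case/andP: (nuB om).
have [||||C C0 TC] := IHk Om' del' _ _ (fun om : Om' => z om.1) v' _ _ s'O _ v'O.
- by move=> om; exact: del0.
- exact: (lip_pull fst).
- by move=> om; exact: nuB.
- by rewrite size_map /=; lia.
exists C => // om.
have E (r : R) : 0 <= r <= 1 -> exists om' : Om', om'.1 = om /\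
    (forall b', taylor_rem k (v om b' :: values s om b') (z om b') (r *: v om b') =
    taylor_rem k (values [seq (fun om : Om' => a om.1) | a <- v :: s] om' b')
       (z om'.1 b') (v' om' b')).
  move=> r01; exists (om, exist _ r r01); split => // b'.
  by rewrite /values -map_comp.
have D b (r : R) := @is_derive_taylor_rem k (values s om b) (z om b) (v om b) r.
have muE : mu om * nu om ^+ k.+1 = nu om * mu om * nu om ^+ k by rewrite exprS; ring.
rewrite muE; split=> [b|].
  have := mean_value_le (C := C * (nu om * mu om * nu om ^+ k)) (D b).
  rewrite scale1r scale0r taylor_rem0 subr0; apply=> r r01.
  have [om' [omE ->]] := E r r01; have [H _] := TC om'.
  by have := H b; rewrite /= omE.
(* For the Lipschitz part, the mean value inequality is applied to the difference of the two
   remainders. *)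
have DB (r : R) := is_deriveB (D true r) (D false r).
have := mean_value_le (C := C * (nu om * mu om * nu om ^+ k) * del om) DB.
rewrite !fctE !scale1r !scale0r !taylor_rem0 !subr0; apply=> r r01.
have [om' [omE E']] := E r r01; have [_ H] := TC om'.
by rewrite !E'; have := H; rewrite /= /del' /= omE.
Qed.

End LipOSequences.

(** * Local expansion of the truncated flow *)

Local Notation tsizes s := (sumn (map (@tsize _) s)).

Lemma big_ntrees_le (V : nmodType) d K N (F : ptree d -> V) : (K <= N)%N ->
  \sum_(t <- ntrees d K) F t = \sum_(t <- ntrees d N) if (tsize t <= K)%N then F t else 0.
Proof.
move=> KN; rewrite -big_mkcond -[RHS]big_filter; apply: perm_big.
apply: uniq_perm; rewrite ?filter_uniq ?ntrees_uniq // => t.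
by rewrite mem_filter !mem_ntrees; case: tnormal => //=; lia.
Qed.

Section Children.
Variable d : nat.
Local Open Scope nat_scope.

Lemma mem_children t (s : seq (ptree d)) : t \in s -> (tsize t <= tsizes s)%N.
Proof.
by move=> ts; rewrite (perm_sumn (perm_map _ (perm_to_rem ts))) /= leq_addr.
Qed.

Lemma size_children (s : seq (ptree d)) : (size s <= tsizes s)%N.
Proof. by elim: s => //= u r IH; have := tsize_gt0 u; lia. Qed.

Lemma ptree_ind_mem (P : ptree d -> Prop) :
  (forall a (s : seq (ptree d)), (forall t, t \in s -> P t) -> P (PNode a s)) -> forall t, P t.
Proof.
move=> H; elim/ptree_ind' => a s IHs; apply: H.
elim: s IHs => //= u s IH [Pu /IH Ps] t; rewrite inE => /orP[/eqP -> //|]; exact: Ps.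
Qed.

End Children.

Section Characters.
Variables (R : realType) (d : nat).

Lemma cut_small (x : dual R d) t u : (tsize t < tsize u)%N -> cut x t u = 0.
Proof.
move=> tu; rewrite /cut big_seq big1 // => q qt.
have := @size_coprods d [:: t] q; rewrite /coprods /= tensor_mulr1 => /(_ qt).
case: eqVneq => [->|]; last by rewrite mulr0.
by rewrite fsize_tree; lia.
Qed.

(** The terms of the coproduct are sorted by their trunk: the empty trunk gives the first summand, a
    trunk [u] gives the corresponding term of the sum. *)
Lemma cut_sum N (x z : dual R d) t : tnormal t -> (tsize t <= N)%N ->
  is_character x -> z (fone d) = 1 ->
  star x z (tree_forest t) =
  x (tree_forest t) + \sum_(u <- ntrees d N) z (tree_forest u) * cut x t u.
Proof.
move=> nt tN charx z1; rewrite /star coprod_tree //.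
transitivity (\sum_(q <- tree_coprod t) (x q.1 * (q.2 == fone d)%:R +
    \sum_(u <- ntrees d N) z (tree_forest u) * (x q.1 * (q.2 == tree_forest u)%:R))).
  apply: eq_big_seq => q qt.
  have := @size_coprods d [:: t] q; rewrite /coprods /= tensor_mulr1 => /(_ qt) sq.
  case: (tree_coprod_trunk qt) => [q1|[u nu qu]].
    rewrite q1 eqxx big1 ?addr0 ?z1 // => u _.
    by rewrite eq_sym (negbTE (tree_forest_neq1 u)) !mulr0.
  rewrite qu (negbTE (tree_forest_neq1 u)) mulr0 add0r.
  rewrite (bigD1_seq u) ?ntrees_uniq //=; last first.
    by rewrite mem_ntrees nu; move: sq; rewrite qu fsize_tree; lia.
  rewrite eqxx mulr1 mulrC [X in _ + X]big_seq_cond big1 ?addr0 // => v.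
  rewrite mem_ntrees => /andP[/andP[nv _] vu].
  case: eqVneq => [/tree_forest_inj uv|_]; last by rewrite !mulr0.
  by rewrite uv ?eqxx in vu.
rewrite big_split /= exchange_big /=; congr (_ + _); last first.
  by apply: eq_bigr => u _; rewrite /cut big_distrr.
have nt1 : all (@tnormal d) [:: t] by rewrite /= nt.
by rewrite -(coprods_one charx nt1) /coprods /= tensor_mulr1.
Qed.

End Characters.

Local Notation wcoef x t := (weight _ (tree_forest t) * x (tree_forest t)).

Section LocalExpansion.
Variables (R : realType) (d n N : nat).
Local Notation V := 'rV[R]_n.
Variables (f : 'I_d -> V -> V) (K : R).
Hypothesis smooth_f : forall i, smooth (f i).
Hypothesis K_ge0 : 0 <= K.
Hypothesis f_le : forall i vs y, (size vs <= N.+1)%N ->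
  `|iter_diff (f i) vs y| <= K * norm_prod vs.

Variables (Om : Type) (del eps : Om -> R) (E : R).
Hypothesis del_ge0 : forall om, 0 <= del om.
Hypothesis eps_bound : forall om, 0 <= eps om <= E.
Local Notation O := (lipO del).
Local Notation one := (fun _ : Om => 1 : R).

Lemma lipO_ext (W : normedModType R) mu (F G : Om -> bool -> W) :
  O mu F -> (forall om b, F om b = G om b) -> O mu G.
Proof. by move=> OF FG; exact: (eq_lipO FG (fun=> erefl) OF). Qed.

Lemma eps_ge0 om : 0 <= eps om. Proof. by case/andP: (eps_bound om). Qed.

Lemma epsX_ge0 k om : 0 <= eps om ^+ k. Proof. by rewrite exprn_ge0 ?eps_ge0. Qed.

Lemma lipO_pow (W : normedModType R) i j (F : Om -> bool -> W) : (i <= j)%N ->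
  O (fun om => eps om ^+ j) F -> O (fun om => eps om ^+ i) F.
Proof.
move=> ij; apply: (@lipO_le _ _ _ del_ge0 _ (`|E| ^+ (j - i))) => [|om]; first exact: exprn_ge0.
have /andP[e0 eE] := eps_bound om.
rewrite -[in leLHS](subnK ij) exprD ler_wpM2r ?exprn_ge0 // lerXn2r ?nnegrE //.
exact: le_trans eE (ler_norm _).
Qed.

Lemma lipO_pow1 (W : normedModType R) j (F : Om -> bool -> W) :
  O (fun om => eps om ^+ j) F -> O one F.
Proof. by move=> OF; have := lipO_pow (leq0n j) OF. Qed.

Lemma lipO_scale_pow (W : normedModType R) i j k (g : Om -> bool -> R) (F : Om -> bool -> W) :
  (k <= i + j)%N -> O (fun om => eps om ^+ i) g -> O (fun om => eps om ^+ j) F ->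
  O (fun om => eps om ^+ k) (fun om b => g om b *: F om b).
Proof.
move=> kij Og OF; apply: lipO_pow kij _.
by apply: (eq_lipO _ _ (lipO_scale Og OF)) => // om; rewrite exprD.
Qed.

Lemma lipO_pow0 (W : normedModType R) i : O (fun om => eps om ^+ i) (fun _ _ => 0 : W).
Proof. by apply: lipO0 => om; exact: epsX_ge0. Qed.

Definition unit_list (s : seq (Om -> bool -> V)) : Prop :=
  foldr (fun a P => O one a /\ P) True s.

Lemma unit_list_cat r s : unit_list r -> unit_list s -> unit_list (r ++ s).
Proof. by elim: r => //= a r IH [Oa /IH ur] /ur. Qed.

Lemma unit_list_map (I : eqType) (s : seq I) (A : I -> Om -> bool -> V) :
  (forall i, i \in s -> O one (A i)) -> unit_list [seq A i | i <- s].
Proof.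
elim: s => //= i s IHs As; split; first exact/As/mem_head.
by apply: IHs => j js; apply: As; rewrite inE js orbT.
Qed.

Lemma unit_list_nseq j a : O one a -> unit_list (nseq j a).
Proof. by move=> Oa; elim: j => //= j IHj; split. Qed.

Lemma unit_listP s : unit_list s -> exists2 mu, lipOs del mu s & mu =1 one.
Proof.
elim: s => [_|a s IHs [Oa /IHs[mu Os mu1]]]; first by exists one => //; exact: lipOs_nil.
exists (fun om => one om * mu om); first exact: lipOs_cons.
by move=> om; rewrite mul1r mu1.
Qed.

Lemma unit_list_lipOs (mu0 nu : Om -> R) a l r : (forall om, 0 <= nu om) -> O nu a ->
  mu0 =1 nu -> unit_list l -> unit_list r ->
  exists2 mu, lipOs del mu (l ++ a :: r) & mu =1 mu0.
Proof.
move=> nu0 Oa E0; elim: l => [_|b l IHl [Ob ul]] ur.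
  have [mu Or mu1] := unit_listP ur; exists (fun om => nu om * mu om).
    exact: lipOs_cons.
  by move=> om; rewrite mu1 mulr1.
have [mu Ol mu1] := IHl ul ur; exists (fun om => one om * mu om); first exact: lipOs_cons.
by move=> om; rewrite mul1r mu1.
Qed.

Lemma values_cat (l r : seq (Om -> bool -> V)) om b :
  values (l ++ r) om b = values l om b ++ values r om b.
Proof. exact: map_cat. Qed.

Lemma values_map (I : Type) (s : seq I) (A : I -> Om -> bool -> V) om b :
  values [seq A i | i <- s] om b = [seq A i om b | i <- s].
Proof. by rewrite /values -map_comp. Qed.

Lemma values_nseq j (a : Om -> bool -> V) om b : values (nseq j a) om b = nseq j (a om b).
Proof. exact: map_nseq. Qed.

Lemma lipO_iter_unit i s z : unit_list s -> lip del z -> (size s <= N)%N ->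
  O one (fun om b => iter_diff (f i) (values s om b) (z om b)).
Proof.
move=> /unit_listP[mu Os mu1] zL sN.
have := lipO_iter_diff (smooth_f i) K_ge0 (f_le i) del_ge0 Os zL sN.
by move=> H; exact: (eq_lipO (fun _ _ => erefl) mu1 H).
Qed.

(** Telescoping between two families of arguments, each of which is itself a pair of functions; [l]
    holds the arguments already replaced. *)
Lemma lipO_iter_replace (I : eqType) i (s : seq I) (A A' : I -> Om -> bool -> V) (nu : Om -> R) l z :
  (forall om, 0 <= nu om) -> unit_list l -> lip del z -> (size l + size s <= N)%N ->
  (forall i, i \in s -> O one (A i) /\ O one (A' i)) ->
  (forall i, i \in s -> O nu (fun om b => A i om b - A' i om b)) ->
  O nu (fun om b => iter_diff (f i) (values l om b ++ [seq A j om b | j <- s]) (z om b)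
    - iter_diff (f i) (values l om b ++ [seq A' j om b | j <- s]) (z om b)).
Proof.
move=> nu0; elim: s l => [|j s IHs] l ul zL sz AO AA'.
  by apply: lipO_ext (lipO0 _ _ nu0) _ => om b; rewrite subrr.
have [Aj A'j] := AO j (mem_head _ _).
have As k : k \in s -> O one (A k) /\ O one (A' k).
  by move=> ks; apply: AO; rewrite inE ks orbT.
have AA's k : k \in s -> O nu (fun om b => A k om b - A' k om b).
  by move=> ks; apply: AA'; rewrite inE ks orbT.
have us : unit_list [seq A k | k <- s] by apply: unit_list_map => k /As[].
have [mu Omu muE] := unit_list_lipOs nu0 (AA' j (mem_head _ _)) (frefl nu) ul us.
have O1 := lipO_iter_diff (smooth_f i) K_ge0 (f_le i) del_ge0 Omu zL.
rewrite size_cat /= size_map ltnS in O1; have {}O1 := O1 sz.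
have ul' : unit_list (rcons l (A' j)).
  by rewrite -cats1; apply: unit_list_cat.
have sz2 : (size (rcons l (A' j)) + size s <= N)%N by rewrite size_rcons addSnnS.
have O2 := IHs (rcons l (A' j)) ul' zL sz2 As AA's.
have O1' := eq_lipO (fun _ _ => erefl) muE O1.
apply: lipO_ext (lipOD O1' O2) _ => om b.
rewrite values_cat /= values_map iter_diffB // /values map_rcons !cat_rcons.
by rewrite addrA subrK.
Qed.

Definition td (z : Om -> bool -> V) (t : ptree d) om b : V := tree_elem_diff f t (z om b).

Lemma lipO_td z t : lip del z -> (tsize t <= N.+1)%N -> O one (td z t).
Proof.
move=> zL; elim/ptree_ind': t => a s IHs sz.
have us : unit_list [seq td z u | u <- s].
  rewrite /= ltnS in sz; elim: s IHs sz => //= u s IH [Ou /IH us] sz; split.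
    by apply: Ou; lia.
  by apply: us; lia.
have szN : (size [seq td z u | u <- s] <= N)%N.
  rewrite size_map; move: sz; rewrite /= ltnS; apply: leq_trans.
  by elim: (s) => //= u r IH; have := tsize_gt0 u; lia.
apply: lipO_ext (lipO_iter_unit a us zL szN) _ => om b.
by rewrite values_map.
Qed.

(** At each node the base point is moved by a first-order Taylor formula and the arguments by
    induction. One derivative is spent on this, whence [N] instead of [N.+1]. *)
Lemma lipO_td_incr z v (nu : Om -> R) (B : R) t : lip del z -> O nu v ->
  (forall om, 0 <= nu om <= B) -> (tsize t <= N)%N ->
  O nu (fun om b => td (fun om b => z om b + v om b) t om b - td z t om b).
Proof.
move=> zL vO nuB; have nu0 om : 0 <= nu om by case/andP: (nuB om).
have zvL := lip_add del_ge0 zL vO nuB.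
elim/ptree_ind_mem: t => a s IHs /= sz.
have tN u : u \in s -> (tsize u <= N)%N by move=> /mem_children; lia.
have szs : (size s < N)%N by exact: leq_ltn_trans (size_children s) sz.
have us : unit_list [seq td (fun om b => z om b + v om b) u | u <- s].
  by apply: unit_list_map => u us; apply: lipO_td => //; rewrite ltnW // ltnS tN.
have [mu Omu mu1] := unit_listP us.
have O1 := @lipO_taylor_rem _ _ _ (smooth_f a) _ _ K_ge0 (f_le a) 1 _ _ _ _ _ _ _ _
  del_ge0 Omu zL vO nuB.
rewrite size_map in O1; rewrite addn1 ltnS in O1; have {}O1 := O1 szs.
have O2 : O nu (fun om b => iter_diff (f a) (values [::] om b ++
      [seq td (fun om b => z om b + v om b) u om b | u <- s]) (z om b)
    - iter_diff (f a) (values [::] om b ++ [seq td z u om b | u <- s]) (z om b)).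
  apply: lipO_iter_replace => //; first by rewrite add0n ltnW.
    by move=> u us'; split; apply: lipO_td => //; rewrite ltnW // ltnS tN.
  by move=> u us'; apply: IHs => //; exact: tN.
have O1' := eq_lipO (nu := nu) (fun _ _ => erefl) _ O1.
apply: lipO_ext (lipOD (O1' _) O2) _ => [om|om b].
  by rewrite mu1 expr1 mul1r.
rewrite /taylor_rem big_ord1 fact0 invr1 scale1r /= values_map.
by rewrite addrA subrK.
Qed.

Local Notation Oeps k := (lipO del (fun om => eps om ^+ k)).

Variables (x : Om -> bool -> dual R d) (y : Om -> bool -> V).
Hypothesis charx : forall om b, is_character (x om b).
Hypothesis xO : forall h : forest d, (fsize h <= N)%N ->
  Oeps (fsize h) (fun om b => x om b h).
Hypothesis yL : lip del y.

Definition increment (x : dual R d) (y : V) : V :=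
  \sum_(t <- ntrees d N) wcoef x t *: tree_elem_diff f t y.

(* The sum of [sigma t / sigma u * <x star t, u> *: f_u y] over the trees [u]. *)
Definition transport (x : dual R d) (y : V) (t : ptree d) : V :=
  \sum_(u <- ntrees d N) cut_coef x t u *: tree_elem_diff f u y.

Local Notation F := (td y).
Let v om b := increment (x om b) (y om b).
Let P t om b := transport (x om b) (y om b) t.

Lemma lipO_weight t : (tsize t <= N)%N ->
  Oeps (tsize t) (fun om b => wcoef (x om b) t).
Proof.
move=> tN; have xt : (fsize (tree_forest t) <= N)%N by rewrite fsize_tree.
by have := lipOZ (weight R (tree_forest t)) (xO xt); rewrite fsize_tree.
Qed.

Lemma lipO_elem t : (tsize t <= N.+1)%N -> O one (F t).
Proof. exact: (lipO_td yL). Qed.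

Lemma lipO_cut_coef t u : (tsize u <= N)%N ->
  Oeps (tsize u - tsize t) (fun om b => cut_coef (x om b) t u).
Proof.
move=> uN; suff cutO : Oeps (tsize u - tsize t) (fun om b => cut (x om b) u t).
  exact: (lipOZ ((sigma (tree_forest t))%:R * weight R (tree_forest u)) cutO).
apply: lipO_sum => [om|q qu]; first exact: epsX_ge0.
have := @size_coprods d [:: u] q; rewrite /coprods /= tensor_mulr1 => /(_ qu) sq.
case: eqVneq => [q2|_]; last first.
  by apply: lipO_ext (@lipO_pow0 _ _) _ => om b; rewrite mulr0.
rewrite q2 fsize_tree /= addn0 in sq.
set k := fsize q.1 in sq *.
have -> : (tsize u - tsize t = k)%N by rewrite -sq addnK.
apply: lipO_ext (xO (h := q.1) _) _ => [|om b]; last by rewrite mulr1.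
by apply: leq_trans uN; rewrite -sq leq_addr.
Qed.

Lemma lipO_increment : Oeps 1 v.
Proof.
apply: lipO_sum => [om|t]; first exact: epsX_ge0.
rewrite mem_ntrees => /andP[_ tN].
apply: (lipO_scale_pow (i := tsize t) (j := 0)).
- by rewrite addn0; exact: tsize_gt0.
- exact: lipO_weight.
- by apply: lipO_elem; rewrite ltnW // ltnS.
Qed.

Let yvL : lip del (fun om b => y om b + v om b).
Proof. exact: (lip_add del_ge0 yL lipO_increment (fun om => eps_bound om)). Qed.

(** An intermediate stage of the expansion of [f a] at the moved point: [j] copies of the increment
    and the transports of [s] are still to be expanded, while the trees of [r] have already been
    produced. *)
Definition monomial a j (s r : seq (ptree d)) om b : V :=
  iter_diff (f a) (nseq j (v om b) ++ [seq P t om b | t <- s] ++ [seq F t om b | t <- r]) (y om b).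

Definition small (r : seq (ptree d)) : Prop := forall t, t \in r -> tnormal t && (tsize t <= N)%N.

Lemma small_cons t r : t \in ntrees d N -> small r -> small (t :: r).
Proof. by rewrite mem_ntrees => tN rN u; rewrite inE => /orP[/eqP ->|/rN]. Qed.

Lemma lipO_transport t : O one (P t).
Proof.
apply: lipO_sum => // u; rewrite mem_ntrees => /andP[_ uN].
apply: (lipO_scale_pow (i := tsize u - tsize t) (j := 0) (k := 0)) => //.
- exact: lipO_cut_coef.
- by apply: lipO_elem; rewrite ltnW // ltnS.
Qed.

Lemma lipO_monomial a j s r : small r ->
  (j + size s + size r <= N)%N -> O one (monomial a j s r).
Proof.
move=> rN sz.
have ul : unit_list (nseq j v ++ [seq P t | t <- s] ++ [seq F t | t <- r]).
  apply: unit_list_cat; first by apply: unit_list_nseq; exact: (lipO_pow1 lipO_increment).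
  apply: unit_list_cat; first by apply: unit_list_map => t _; exact: lipO_transport.
  by apply: unit_list_map => t /rN /andP[_ tN]; apply: lipO_elem; rewrite ltnW // ltnS.
apply: lipO_ext (lipO_iter_unit a ul yL _) _.
  by rewrite !size_cat size_nseq !size_map addnA.
by move=> om b; rewrite !values_cat !values_map values_nseq.
Qed.

Lemma monomialS a j s r om b : monomial a j.+1 s r om b =
  \sum_(t <- ntrees d N) wcoef (x om b) t *:
    monomial a j s (t :: r) om b.
Proof.
set w := [seq P t om b | t <- s] ++ [seq F t om b | t <- r].
transitivity (iter_diff (f a) ([::] ++ increment (x om b) (y om b) :: (nseq j (v om b) ++ w)) (y om b)).
  by [].
rewrite /increment iter_diff_sum //; apply: eq_bigr => t _.
rewrite iter_diffZ //; congr (_ *: _); apply: iter_diff_perm => //.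
rewrite /w cat0s map_cons -cat1s -[_ :: [seq F t0 om b | t0 <- r]]cat1s.
by rewrite perm_catCA perm_cat2l perm_catCA.
Qed.

Lemma monomial_cons a j u s r om b : monomial a j (u :: s) r om b =
  \sum_(t <- ntrees d N) cut_coef (x om b) u t *: monomial a j s (t :: r) om b.
Proof.
set w := [seq P t om b | t <- s] ++ [seq F t om b | t <- r].
transitivity (iter_diff (f a) (nseq j (v om b) ++ transport (x om b) (y om b) u :: w) (y om b)).
  by [].
rewrite /transport iter_diff_sum //; apply: eq_bigr => t _.
rewrite iter_diffZ //; congr (_ *: _); apply: iter_diff_perm => //.
rewrite /w perm_cat2l map_cons -cat1s -[_ :: [seq F t0 om b | t0 <- r]]cat1s.
by rewrite perm_catCA.
Qed.

Definition elementary a (r : seq (ptree d)) om b (g : forest d) : V :=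
  iter_diff (f a) [seq F t om b | t <- planar g ++ r] (y om b).

Lemma elementary_mul a r om b t g : tnormal t ->
  elementary a r om b (fmul (tree_forest t) g) = elementary a (t :: r) om b g.
Proof.
move=> nt; apply: iter_diff_perm => //; apply: perm_map.
apply: (@perm_trans _ ((t :: g) ++ r)); first by rewrite perm_cat2r; exact: perm_tree_mul.
by rewrite /= -cat1s perm_catCA.
Qed.

(** Expanding one copy of the increment by [monomialS] mirrors [exp_sumS], the factorial supplying
    the factor [j.+1]. The two sides differ only by forests with more than [J] nodes. *)
Lemma lipO_exp_sum a j J r : small r -> (j + size r <= N)%N -> (J + size r <= N)%N ->
  Oeps J.+1 (fun om b => (j`!%:R)^-1 *: monomial a j [::] r om b -
                exp_sum (x om b) j J (elementary a r om b)).
Proof.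
elim: j J r => [|j IHj] J r rN sj sJ.
  apply: lipO_ext (@lipO_pow0 _ _) _ => om b.
  by rewrite exp_sum0 // fact0 invr1 scale1r subrr.
have JN : (J <= N)%N by lia.
have body : Oeps J.+1 (fun om b => (j.+1%:R : R)^-1 *: \sum_(t <- ntrees d N)
    wcoef (x om b) t *:
      ((j`!%:R)^-1 *: monomial a j [::] (t :: r) om b -
       if (tsize t <= J)%N then exp_sum (x om b) j (J - tsize t) (elementary a (t :: r) om b)
       else 0)).
  apply: lipOZ; apply: lipO_sum => [om|t tN].
    exact: epsX_ge0.
  have rN' := small_cons tN rN; move: tN; rewrite mem_ntrees => /andP[nt tN].
  have t0 := tsize_gt0 t; case: leqP => tJ.
    apply: (lipO_scale_pow (i := tsize t) (j := (J - tsize t).+1)).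
    - by lia.
    - exact: lipO_weight.
    - by apply: IHj => //=; lia.
  (* A tree with more than [J] nodes has no counterpart in the truncated sum, but its coefficient
     alone has order [J.+1]. *)
  apply: (lipO_scale_pow (i := tsize t) (j := 0)).
  - by rewrite addn0.
  - exact: lipO_weight.
  - apply: lipO_ext (lipOZ _ (lipO_monomial a (j := j) (s := [::]) (r := t :: r) rN' _)) _.
    + by rewrite /=; lia.
    + by move=> om b; rewrite subr0.
apply: lipO_ext body _ => om b.
have j0 : j.+1%:R != 0 :> R by rewrite pnatr_eq0.
have -> : exp_sum (x om b) j.+1 J (elementary a r om b) =
   (j.+1%:R)^-1 *: \sum_(t <- ntrees d N)
    wcoef (x om b) t *:
      if (tsize t <= J)%N then exp_sum (x om b) j (J - tsize t) (elementary a (t :: r) om b)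
      else 0.
  apply: (scalerI j0); rewrite scalerA mulfV // scale1r exp_sumS // (big_ntrees_le _ JN).
  apply: eq_big_seq => t; rewrite mem_ntrees => /andP[nt tN].
  case: ifP => _; last by rewrite scaler0.
  congr (_ *: _); apply: eq_bigr => g _; congr (_ *: _).
  exact: elementary_mul.
rewrite factS natrM invfM -scalerA monomialS -scalerBr; congr (_ *: _).
rewrite scaler_sumr -sumrB; apply: eq_bigr => t _.
by rewrite scalerBr; congr (_ - _); rewrite !scalerA mulrC.
Qed.

(** Both sides obey the same recursion in [s], by [monomial_cons] and [dual_sum_mul]; each tree [u]
    lowers the order by [tsize u], as the coefficient for [t] has order [tsize t - tsize u]. The
    bound on [k] guarantees that in the base case the Taylor sum reaches every forest with at most
    [J] nodes. *)
Lemma lipO_dual_sum a J k s r : all (@tnormal d) s ->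
  small r ->
  (k + size s + size r <= N.+1)%N -> (J + size r <= N)%N ->
  (J.+1 - tsizes s <= k)%N ->
  Oeps (J.+1 - tsizes s)
    (fun om b => \sum_(j < k) (j`!%:R)^-1 *: monomial a j s r om b -
       dual_sum (x om b) (mkforest s) J (elementary a r om b)).
Proof.
elim: s J r => [|u s IHs] J r ns rN sz sJ Jk.
  rewrite /= subn0 in Jk *.
  have body : Oeps J.+1 (fun om b => \sum_(j <- index_enum 'I_k)
      ((j`!%:R)^-1 *: monomial a j [::] r om b - exp_sum (x om b) j J (elementary a r om b))).
    apply: lipO_sum => [om|j _]; first exact: epsX_ge0.
    by apply: lipO_exp_sum => //; have := ltn_ord j; rewrite /= addn0 in sz; lia.
  by apply: lipO_ext body _ => om b; rewrite (dual_sum_one (charx om b) _ Jk) sumrB.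
have JN : (J <= N)%N by lia.
move: ns => /= /andP[nu ns].
have body : Oeps (J.+1 - (tsize u + tsizes s)) (fun om b =>
    \sum_(t <- ntrees d N) cut_coef (x om b) u t *:
      (\sum_(j < k) (j`!%:R)^-1 *: monomial a j s (t :: r) om b -
       if (tsize t <= J)%N
       then dual_sum (x om b) (mkforest s) (J - tsize t) (elementary a (t :: r) om b)
       else 0)).
  apply: lipO_sum => [om|t tN]; first exact: epsX_ge0.
  have rN' := small_cons tN rN; move: tN; rewrite mem_ntrees => /andP[nt tN].
  have t0 := tsize_gt0 t.
  (* A trunk is never larger than the tree it is cut from, so these coefficients vanish. *)
  have [tu|ut] := ltnP (tsize t) (tsize u).
    apply: lipO_ext (@lipO_pow0 _ _) _ => om b.
    by rewrite /cut_coef cut_small // mulr0 scale0r.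
  case: leqP => tJ.
    apply: (lipO_scale_pow (i := (tsize t - tsize u))
        (j := (J - tsize t).+1 - tsizes s)).
    - by lia.
    - exact: lipO_cut_coef.
    - by apply: IHs => //=; rewrite /= in sz Jk; lia.
  apply: (lipO_scale_pow (i := (tsize t - tsize u)) (j := 0)).
  - by lia.
  - exact: lipO_cut_coef.
  - have body : O one (fun om b => \sum_(j <- index_enum 'I_k)
      ((j`!%:R)^-1 *: monomial a j s (t :: r) om b)).
      apply: lipO_sum => // j _; apply: lipOZ; apply: lipO_monomial => //.
      by have := ltn_ord j; rewrite /= in sz *; lia.
    by apply: lipO_ext body _ => om b; rewrite subr0.
apply: lipO_ext body _ => om b.
rewrite mkforest_cons // dual_sum_mul // (big_ntrees_le _ JN).
under [X in _ = X - _]eq_bigr => j _ do rewrite monomial_cons scaler_sumr.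
rewrite exchange_big /= -sumrB.
apply: eq_big_seq => t; rewrite mem_ntrees => /andP[nt tN].
rewrite scalerBr scaler_sumr; congr (_ - _).
  by apply: eq_bigr => j _; rewrite !scalerA mulrC.
case: ifP => _; last by rewrite scaler0.
congr (_ *: _); apply: eq_bigr => g _; congr (_ *: _).
by rewrite elementary_mul.
Qed.

(** Grafting a root keeps the symmetry factors, and the cuts that leave a trunk keep the root and
    its label. Trees with at most [N] nodes thus correspond to forests with at most [N.-1]. *)
Lemma dual_sum_transport a h om b : (0 < N)%N ->
  dual_sum (x om b) h N.-1 (elementary a [::] om b) = P (PNode a (planar h)) om b.
Proof.
move=> N0; rewrite /P /transport -{2}(prednK N0) big_ntrees (bigD1 a) //= [X in _ + X]big1.
  rewrite addr0; apply: eq_bigr => g _.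
  rewrite /cut_coef cut_graft eqxx mul1r -!graft_tree sigma_graft /weight sigma_graft.
  by rewrite /elementary cats0.
move=> c ca; rewrite big1 // => g _.
by rewrite /cut_coef cut_graft eq_sym (negbTE ca) mul0r mulr0 scale0r.
Qed.

(** Three errors of order [N.+1 - tsize t] add up: replacing the children by their transports
    ([O1]), expanding in the base point ([O2']), and identifying the Taylor sum with the coproduct
    ([O3]). *)
Lemma lipO_td_transport t : tnormal t -> (tsize t <= N)%N ->
  Oeps (N.+1 - tsize t) (fun om b => td (fun om b => y om b + v om b) t om b - P t om b).
Proof.
elim/ptree_ind_mem: t => a s IHs nt /= sz.
have ns : all (@tnormal d) s by case/andP: (nt).
pose k := (N - tsizes s)%N.
have sk : (size s + k <= N)%N by have := size_children s; rewrite /k; lia.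
rewrite subSS -/k.
have uN u : u \in s -> (tsize u <= tsizes s)%N by exact: mem_children.
have O1 : Oeps k (fun om b =>
    iter_diff (f a) (values [::] om b ++ [seq td (fun om b => y om b + v om b) u om b | u <- s])
      (y om b + v om b) -
    iter_diff (f a) (values [::] om b ++ [seq P u om b | u <- s]) (y om b + v om b)).
  apply: (lipO_iter_replace a (epsX_ge0 k) _ yvL) => //.
  - by rewrite add0n; exact: leq_trans (leq_addr k _) sk.
  - move=> u us; split; last exact: lipO_transport.
    apply: (lipO_td yvL).
    by apply: leq_trans (uN u us) _; rewrite ltnW // ltnW.
  - move=> u us; have := uN u us => uNs.
    apply: (lipO_pow (j := N.+1 - tsize u)); first by rewrite /k; lia.
    by apply: IHs => //; [exact: (allP ns)|lia].
have us : unit_list [seq P u | u <- s].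
  by apply: unit_list_map => u _; exact: lipO_transport.
have [mu Omu mu1] := unit_listP us.
have eB om : 0 <= eps om ^+ 1 <= E by rewrite expr1.
have O2 := @lipO_taylor_rem _ _ _ (smooth_f a) _ _ K_ge0 (f_le a) k _ _ _ _ _ _ _ _
  del_ge0 Omu yL lipO_increment eB.
rewrite size_map ltnS in O2; have {}O2 := O2 sk.
have O2' : Oeps k (fun om b => taylor_rem (f a) k (values [seq P u | u <- s] om b)
    (y om b) (v om b)).
  by apply: (eq_lipO _ _ O2) => // om; rewrite mu1 expr1 mul1r.
have O3 : Oeps (N.-1.+1 - tsizes s) (fun om b =>
    \sum_(j < k) (j`!%:R)^-1 *: monomial a j s [::] om b -
    dual_sum (x om b) (mkforest s) N.-1 (elementary a [::] om b)).
  apply: lipO_dual_sum => //=.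
  - by rewrite addn0; lia.
  - by rewrite addn0; lia.
  - by rewrite /k; lia.
have kE : (N.-1.+1 - tsizes s = k)%N by rewrite /k; lia.
rewrite kE in O3; apply: lipO_ext (lipOD (lipOD O1 O2') O3) _ => om b.
have sE : planar (mkforest s) = s.
  by rewrite -[mkforest s]/(mkforest (planar (Forest nt))) mkforestK.
rewrite /= dual_sum_transport ?sE; last by lia.
rewrite values_map /taylor_rem.
rewrite /monomial; under eq_bigr => j _ do rewrite cats0.
by rewrite subrKA subrKA /td.
Qed.

(** The coefficient [z t], of order [tsize t], meets an error of order [N.+1 - tsize t], so that
    every tree yields order [N.+1]. The main terms recombine into [star x z] by [cut_sum], and the
    factors [sigma t] cancel. *)
Lemma lipO_defect (z : Om -> bool -> dual R d) :
  (forall om b, z om b (fone d) = 1) ->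
  (forall h : forest d, (fsize h <= N)%N -> Oeps (fsize h) (fun om b => z om b h)) ->
  Oeps N.+1 (fun om b => v om b + increment (z om b) (y om b + v om b)
     - increment (star (x om b) (z om b)) (y om b)).
Proof.
move=> z1 zO.
have body : Oeps N.+1 (fun om b => \sum_(t <- ntrees d N)
   wcoef (z om b) t *:
   (td (fun om b => y om b + v om b) t om b - P t om b)).
  apply: lipO_sum => [om|t]; first exact: epsX_ge0.
  rewrite mem_ntrees => /andP[nt tN].
  apply: (lipO_scale_pow (i := tsize t) (j := N.+1 - tsize t)).
  - by lia.
  - have tN' : (fsize (tree_forest t) <= N)%N by rewrite fsize_tree.
    by have := lipOZ (weight R (tree_forest t)) (zO _ tN'); rewrite fsize_tree.
  - exact: lipO_td_transport.
apply: lipO_ext body _ => om b.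
under eq_bigr => t _ do rewrite scalerBr.
rewrite sumrB [v om b + _]addrC -addrA; congr (_ + _).
rewrite -[RHS]opprB; congr (- _); rewrite /v /increment -sumrB.
under eq_bigr => t _ do rewrite /P /transport scaler_sumr.
rewrite exchange_big /=; apply: eq_big_seq => u; rewrite mem_ntrees => /andP[nu uN].
rewrite (cut_sum nu uN (charx om b) (z1 om b)) -scalerBl -mulrBr addrAC subrr add0r.
rewrite mulr_sumr scaler_suml; apply: eq_bigr => t _; rewrite scalerA; congr (_ *: _).
rewrite /cut_coef /weight; have s0 : (sigma (tree_forest t))%:R != 0 :> R.
  by rewrite pnatr_eq0 -lt0n sigma_gt0.
by field; rewrite pnatr_eq0 -!lt0n !sigma_gt0.
Qed.

Lemma lipO_increment_incr (r : Om -> bool -> V) (nu : Om -> R) (B : R) :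
  O nu r -> (forall om, 0 <= nu om <= B) ->
  O (fun om => eps om * nu om)
    (fun om b => increment (x om b) (y om b + r om b) - increment (x om b) (y om b)).
Proof.
move=> rO nuB; have nu0 om : 0 <= nu om by case/andP: (nuB om).
have e0 := eps_ge0.
have body : O (fun om => eps om * nu om) (fun om b => \sum_(t <- ntrees d N)
   wcoef (x om b) t *:
   (td (fun om b => y om b + r om b) t om b - F t om b)).
  apply: lipO_sum => [om|t]; first exact: mulr_ge0.
  rewrite mem_ntrees => /andP[nt tN].
  have wO := lipO_pow (tsize_gt0 t) (lipO_weight tN).
  apply: (eq_lipO _ _ (lipO_scale wO
    (lipO_td_incr yL rO nuB tN))) => //.
apply: lipO_ext body _ => om b.
by under eq_bigr => t _ do rewrite scalerBr; rewrite sumrB.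
Qed.

(** Controlled paths stop at [N.-1] nodes while the flow uses [N]; the trees with exactly [N] nodes
    are moved into the remainder. *)
Lemma lipO_top_degree k (g : ptree d -> Om -> bool -> R) :
  (forall u, (tsize u <= N)%N -> Oeps (tsize u - k) (g u)) ->
  Oeps (N - k) (fun om b => \sum_(u <- ntrees d N) g u om b *: F u om b -
    \sum_(u <- ntrees d N.-1) g u om b *: F u om b).
Proof.
move=> gO; have body : Oeps (N - k) (fun om b => \sum_(u <- ntrees d N)
    if (tsize u <= N.-1)%N then 0 else g u om b *: F u om b).
  apply: lipO_sum => [om|u]; first exact: epsX_ge0.
  rewrite mem_ntrees => /andP[_ uN]; case: leqP => uN1; first exact: lipO_pow0.
  have uE : tsize u = N by lia.
  apply: (lipO_scale_pow (i := tsize u - k) (j := 0)).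
  - by rewrite addn0 uE.
  - exact: gO.
  - by apply: lipO_elem; rewrite ltnW // ltnS.
apply: lipO_ext body _ => om b; rewrite (big_ntrees_le _ (leq_pred N)) -sumrB.
by apply: eq_bigr => u _; case: ifP; rewrite ?subrr ?subr0.
Qed.

Lemma lipO_remainder_tree (r : Om -> bool -> V) t : Oeps N.+1 r -> tnormal t -> (tsize t <= N)%N ->
  Oeps (N - tsize t) (fun om b => td (fun om b => y om b + v om b + r om b) t om b -
    \sum_(u <- ntrees d N.-1) cut_coef (x om b) t u *: F u om b).
Proof.
move=> rO nt tN; have EB om : 0 <= eps om ^+ N.+1 <= `|E| ^+ N.+1.
  have /andP[e0 eE] := eps_bound om; rewrite exprn_ge0 //= lerXn2r ?nnegrE //.
  exact: le_trans eE (ler_norm _).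
have O1 := lipO_pow (leq_trans (leq_subr (tsize t) N) (leqnSn N)) (lipO_td_incr yvL rO EB tN).
have O2 := lipO_pow (leq_sub2r (tsize t) (leqnSn N)) (lipO_td_transport nt tN).
have O3 := lipO_top_degree (g := fun u om b => cut_coef (x om b) t u) (lipO_cut_coef t).
by apply: lipO_ext (lipOD (lipOD O1 O2) O3) _ => om b; rewrite !subrKA.
Qed.

Lemma lipO_remainder_one (r : Om -> bool -> V) : Oeps N.+1 r ->
  Oeps N (fun om b => v om b + r om b - \sum_(u <- ntrees d N.-1)
    wcoef (x om b) u *: F u om b).
Proof.
move=> rO; have := lipO_top_degree (k := 0)
  (g := fun u om b => wcoef (x om b) u).
rewrite subn0 => O3; apply: lipO_ext (lipOD (lipO_pow (leqnSn N) rO) (O3 _)) _ => [u uN|om b].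
  by rewrite subn0; exact: lipO_weight.
by rewrite addrA [r om b + _]addrC.
Qed.

End LocalExpansion.

(** * Rough paths and remainders *)

Section Counit.
Variables (R : realType) (d : nat).

Definition counit : dual R d := fun h => (h == fone d)%:R.

Lemma counit_character : is_character counit.
Proof.
split=> [|h1 h2]; first by rewrite /counit eqxx.
by rewrite /counit fmul_eq1 -natrM mulnb.
Qed.

Lemma coprods_counit (V : lmodType R) s (phi : forest d -> V) : all (@tnormal d) s ->
  \sum_(p <- coprods s) counit p.1 *: phi p.2 = phi (mkforest s).
Proof.
pose ok t := tnormal t -> forall phi : forest d -> V,
  \sum_(q <- tree_coprod t) counit q.1 *: phi q.2 = phi (tree_forest t).
have gen r (psi : forest d -> V) : foldr (fun t Q => ok t /\ Q) True r ->
    all (@tnormal d) r -> \sum_(p <- coprods r) counit p.1 *: psi p.2 = psi (mkforest r).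
  elim: r psi => [|t r IHr] psi => [_ _|/= [okt okr] /andP[nt nr]].
    by rewrite /coprods /= big_seq1 /counit eqxx scale1r.
  rewrite (coprods_cons counit_character) mkforest_cons //.
  under eq_bigr => q _ do rewrite (IHr (fun h => psi (fmul q.2 h))) //.
  exact: (okt nt (fun h => psi (fmul h (mkforest r)))).
have okT t : ok t.
  elim/ptree_ind': t => a {phi} r IHr nt phi.
  have nr : all (@tnormal d) r by case/andP: (nt).
  rewrite (tree_coprodE a (Forest nt)) big_rcons /= big_map /=.
  rewrite /counit graft_tree (negbTE (tree_forest_neq1 _)) scale0r addr0.
  rewrite [LHS](gen r (fun g => phi (graft a g)) IHr nr) graft_tree.
  congr (phi (tree_forest (PNode a _))).
  by rewrite -[mkforest r]/(mkforest (planar (Forest nt))) mkforestK.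
by apply: gen; elim: s.
Qed.

(** By Chen's relation this applies to [X t t], on which the Hoelder norms say nothing. Induction on
    the size: for a tree, [star x x = x] says that [x t] plus terms that vanish by induction is
    zero. *)
Lemma idempotent_character (x : dual R d) : is_character x -> star x x = x ->
  forall h, h != fone d -> x h = 0.
Proof.
move=> charx xx h; have [k] := ubnP (fsize h).
elim: k h => // k IHk h hk h1.
have x1 := charx.1.
case def_h : (planar h) => [|t s].
  by move: h1; rewrite (_ : h = fone d) ?eqxx //; apply: perm_forest; rewrite def_h.
have th : t \in planar h by rewrite def_h mem_head.
have nt := mem_tnormal th; have t0 := tsize_gt0 t.
have hE := mul_withoutK th; have szh : (tsize t + fsize (without t h) = fsize h)%N.
  by rewrite -[in RHS]hE fsize_mul fsize_tree.
have [g1|g1] := eqVneq (without t h) (fone d); last first.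
  by rewrite -hE charx.2 (IHk (without t h)) ?mulr0 //; lia.
rewrite g1 fmulf1 in hE; rewrite -hE; rewrite g1 fsize_one addn0 in szh.
have := cut_sum nt (leqnn (tsize t)) charx x1; rewrite xx => /eqP.
rewrite -subr_eq0 opprD addrA subrr sub0r oppr_eq0 => /eqP xt.
rewrite -[RHS]xt (bigD1_seq t) ?ntrees_uniq ?mem_ntrees ?nt ?leqnn //=.
(* A trunk with as many nodes as [t] leaves an empty pruned part, where [x] and the counit agree. *)
have cutE u : tsize u = tsize t -> cut x t u = cut counit t u.
  move=> ut; apply: eq_big_seq => q qt; case: eqVneq => [q2|]; last by rewrite !mulr0.
  have := @size_coprods d [:: t] q; rewrite /coprods /= tensor_mulr1 => /(_ qt).
  rewrite q2 fsize_tree ut addn0 -[RHS]add0n => /addIn/fsize_eq0 ->.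
  by rewrite x1 /counit eqxx.
have cutT u : cut counit t u = (tree_forest t == tree_forest u)%:R.
  have nt1 : all (@tnormal d) [:: t] by rewrite /= nt.
  have := coprods_counit (fun g => (g == tree_forest u)%:R : R^o) nt1.
  by rewrite /coprods /= tensor_mulr1.
rewrite cutE // cutT eqxx mulr1 big_seq_cond big1 ?addr0 // => u.
rewrite mem_ntrees => /andP[/andP[nu ut] utn].
have [uk|uk] := ltnP (tsize u) (tsize t).
  by rewrite (IHk (tree_forest u)) ?mul0r ?tree_forest_neq1 // fsize_tree; lia.
have uE : tsize u = tsize t by lia.
rewrite cutE // cutT; case: eqVneq => [/tree_forest_inj E|_]; last by rewrite mulr0.
by rewrite E ?eqxx in utn.
Qed.

End Counit.

(** * Hoelder norms and pointwise bounds *)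

Section Hoelder.
Variables (R : realType) (T : {posnum R}) (W : normedZmodType R).
Implicit Types (s t : time T) (F : time T -> time T -> W).

Definition dist s t : R := `|sval t - sval s|.

Lemma time_inj s t : sval s = sval t -> s = t.
Proof.
case: s t => [s ps] [t pt] /= st; move: pt; rewrite -st => pt.
by congr exist; exact: bool_irrelevance.
Qed.

Lemma dist_gt0 s t : s <> t -> 0 < dist s t.
Proof.
move=> st; rewrite /dist normr_gt0 subr_eq0; apply/eqP => ts.
by apply: st; apply: time_inj.
Qed.

Lemma dist_ge0 s t : 0 <= dist s t. Proof. exact: normr_ge0. Qed.

Lemma dist_sym s t : dist s t = dist t s. Proof. exact: distrC. Qed.

Lemma dist_le s t : dist s t <= T%:num.
Proof.
rewrite /dist; case: s t => [s /= /andP[s0 sT]] [t /= /andP[t0 tT]].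
rewrite ler_norml; apply/andP; split; lra.
Qed.

Lemma hnorm_le gamma F (C : R) :
  (forall s t, s <> t -> `|F s t| <= C * dist s t `^ gamma) -> (hnorm gamma F <= C%:E)%E.
Proof.
move=> FC; apply: ge_ereal_sup => _ [s [t [st ->]]].
by rewrite lee_fin ler_pdivrMr ?powR_gt0 ?dist_gt0 //; exact: FC.
Qed.

Lemma hnorm_bound gamma F (C : R) : (hnorm gamma F <= C%:E)%E ->
  forall s t, s <> t -> `|F s t| <= C * dist s t `^ gamma.
Proof.
move=> FC s t st; rewrite -ler_pdivrMr ?powR_gt0 ?dist_gt0 // -lee_fin.
by apply: le_trans FC; apply: ereal_sup_ubound; exists s, t.
Qed.

Lemma hnorm_fin gamma F : (hnorm gamma F < +oo)%E ->
  exists C : R, forall s t, s <> t -> `|F s t| <= C * dist s t `^ gamma.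
Proof.
move=> Foo; exists `|fine (hnorm gamma F)|; apply: hnorm_bound.
case: (hnorm gamma F) Foo => [r _|//|_] /=; last by rewrite leNye.
by rewrite lee_fin ler_norm.
Qed.

End Hoelder.

Section Level.
Variables (R : realType) (alpha : R).
Hypothesis alpha01 : 0 < alpha < 1.

Lemma level_exponent : 1 < (level alpha).+1%:R * alpha.
Proof.
have /andP[a0 a1] := alpha01.
have := truncnS_gt alpha^-1; rewrite -/(level alpha) => H.
by rewrite -(@ltr_pM2r _ alpha^-1) ?invr_gt0 // mul1r mulfK // gt_eqF.
Qed.

Lemma powR_exprn (x : R) k : 0 <= x -> (x `^ alpha) ^+ k = x `^ (k%:R * alpha).
Proof. by move=> x0; rewrite -powR_mulrn ?powR_ge0 // -powRrM mulrC. Qed.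

End Level.

Section RoughBounds.
Variables (R : realType) (d : nat) (T : {posnum R}) (alpha : R).
Hypothesis alpha01 : 0 < alpha < 1.
Local Notation rpath := (rough_path d T alpha).
Local Notation N := (level alpha).
Implicit Types (X : rpath) (s t : time T) (h : forest d).

Lemma rough_path_diag X t h : h != fone d -> X t t h = 0.
Proof.
by apply: idempotent_character; [exact: rp_character|exact: rp_chen].
Qed.

Lemma bigmax_forest_le (F : forest d -> \bar R) (C : \bar R) h :
  (\big[maxe/0%E]_(h : 'F_(d; N) | val h != fone d) F (val h) <= C)%E ->
  (fsize h <= N)%N -> h != fone d -> (F h <= C)%E.
Proof.
move=> FC hN h1; apply: le_trans FC; rewrite -mem_forests_upto in hN.
exact: (le_bigmax_cond _ (fun h : 'F_(d; N) => F (val h)) (j := SeqSub hN)).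
Qed.

Lemma rough_bound X (M : R) s t h : (rp_norm X <= M%:E)%E -> (fsize h <= N)%N ->
  `|X s t h| <= (`|M| + 1) * (dist s t `^ alpha) ^+ fsize h.
Proof.
move=> XM hN; have M1 : 0 <= `|M| + 1 by rewrite addr_ge0.
(* The added 1 in the constant covers the empty forest, which [rp_norm] leaves out. *)
have [->|h1] := eqVneq h (fone d).
  by rewrite (rp_character X s t).1 expr0 mulr1 normr1 lerDr.
have [->|st] := pselect (s = t).
  by rewrite rough_path_diag // normr0 mulr_ge0 // exprn_ge0 ?powR_ge0.
have := hnorm_bound (bigmax_forest_le
  (F := fun h => hnorm ((fsize h)%:R * alpha) (fun s t => X s t h)) XM hN h1) st.
rewrite powR_exprn ?dist_ge0 //; move=> H; apply: le_trans H _.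
by rewrite ler_wpM2r ?powR_ge0 // ler_wpDr // ler_norm.
Qed.

Lemma rough_diff_bound X X' (del : R) s t h : (rho X X' <= del%:E)%E -> (fsize h <= N)%N ->
  `|X s t h - X' s t h| <= del * (dist s t `^ alpha) ^+ fsize h.
Proof.
move=> XX hN; have del0 : 0 <= del.
  by rewrite -lee_fin; apply: le_trans XX; exact: rho_ge0.
have [->|h1] := eqVneq h (fone d).
  by rewrite (rp_character X s t).1 (rp_character X' s t).1 subrr normr0 expr0 mulr1.
have [->|st] := pselect (s = t).
  by rewrite !rough_path_diag // subrr normr0 mulr_ge0 // exprn_ge0 ?powR_ge0.
have := hnorm_bound (bigmax_forest_le
  (F := fun h => hnorm ((fsize h)%:R * alpha) (fun s t => X s t h - X' s t h)) XX hN h1) st.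
by rewrite powR_exprn ?dist_ge0.
Qed.

End RoughBounds.

(** * Remainders of lifted solutions *)

Section Lifts.
Variables (R : realType) (d n : nat) (T : {posnum R}) (alpha : R).
Local Notation rpath := (rough_path d T alpha).
Local Notation N := (level alpha).
Local Notation V := 'rV[R]_n.
Variable f : 'I_d -> V -> V.
Implicit Types (X : rpath) (Y : time T -> V) (s t : time T).

Lemma big_seq_sub (W : nmodType) (I : choiceType) (r : seq I) (F : I -> W) : uniq r ->
  \sum_(h : seq_sub r) F (val h) = \sum_(h <- r) F h.
Proof.
move=> ur; rewrite -(big_map val xpredT F); apply: perm_big; apply: uniq_perm => //.
  by rewrite map_inj_uniq ?index_enum_uniq //; exact: val_inj.
move=> h; apply/mapP/idP => [[x _ ->]|hr]; first exact: ssvalP.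
by exists (SeqSub hr); rewrite ?mem_index_enum.
Qed.

Lemma big_seq_sub_cond (W : nmodType) (I : choiceType) (r : seq I) (P : pred I) (F : I -> W) :
  uniq r -> \sum_(h : seq_sub r | P (val h)) F (val h) = \sum_(h <- r | P h) F h.
Proof.
by move=> ur; rewrite big_mkcond (big_seq_sub (fun h => if P h then F h else 0)) // -big_mkcond.
Qed.

Lemma elem_diff_tree (t : ptree d) (z : V) : tnormal t -> elem_diff f (tree_forest t) z = tree_elem_diff f t z.
Proof. by move=> nt; rewrite /elem_diff val_tree_forest. Qed.

Lemma rde_remainderE X Y s t :
  rde_remainder f X Y s t = Y t - Y s - increment N f (X s t) (Y s).
Proof.
rewrite /rde_remainder; congr (_ - _).
rewrite (big_seq_sub_cond (@is_tree d) (fun h => ((sigma h)%:R^-1 * X s t h) *: elem_diff f h (Y s)));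
  last exact: forests_upto_uniq.
rewrite big_forests_upto_tree; apply: eq_big_seq => u; rewrite mem_ntrees => /andP[nu _].
by rewrite elem_diff_tree.
Qed.

Lemma pairing_lift (phi : dual R d) Y s :
  pairing phi (@lift_solution _ _ _ T alpha f Y s) =
  phi (fone d) *: Y s + \sum_(u <- ntrees d N.-1)
    (phi (tree_forest u) * weight R (tree_forest u)) *: tree_elem_diff f u (Y s).
Proof.
pose G h := phi h *: if is_tree h || (h == fone d)
  then (sigma h)%:R^-1 *: elem_diff f h (Y s) else 0.
rewrite /pairing (big_seq_sub G) ?forests_upto_uniq //.
rewrite (bigD1_seq (fone d)) ?forests_upto_uniq ?mem_forests_upto //=; congr (_ + _).
  by rewrite /G eqxx orbT sigma_one invr1 scale1r.
rewrite big_mkcond /= (eq_bigr (fun h => if is_tree h then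
    (phi h * weight R h) *: elem_diff f h (Y s) else 0)) => [|h _].
  rewrite -big_mkcond big_forests_upto_tree; apply: eq_big_seq => u.
  by rewrite mem_ntrees => /andP[nu _]; rewrite elem_diff_tree.
rewrite /G; have [->|h1] := eqVneq h (fone d); first by [].
by rewrite orbF; case: ifP => _; rewrite ?scaler0 // scalerA.
Qed.

(** With [weight] factored out, this is the error in the expansion of [f_u] along the solution, the
    quantity estimated by [lipO_remainder_tree]. *)
Lemma remainder_tree X Y (h : 'F_(d; N.-1)) u s t : tnormal u -> val h = tree_forest u ->
  remainder X (lift_solution f Y) h s t =
  weight R (tree_forest u) *: (tree_elem_diff f u (Y t) -
    \sum_(v <- ntrees d N.-1) cut_coef (X s t) u v *: tree_elem_diff f v (Y s)).
Proof.
move=> nu hu; rewrite /remainder pairing_lift hu star_tree_one scale0r add0r scalerBr.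
congr (_ - _).
  by rewrite /lift_solution hu /is_tree val_tree_forest // elem_diff_tree.
rewrite scaler_sumr; apply: eq_big_seq => v; rewrite mem_ntrees => /andP[nv _].
rewrite star_tree // scalerA; congr (_ *: _); rewrite /cut_coef /weight.
have s0 : (sigma (tree_forest u))%:R != 0 :> R by rewrite pnatr_eq0 -lt0n sigma_gt0.
by field; rewrite s0 pnatr_eq0 -lt0n sigma_gt0.
Qed.

Lemma remainder_one X Y (h : 'F_(d; N.-1)) s t : val h = fone d ->
  remainder X (lift_solution f Y) h s t =
  Y t - Y s - \sum_(v <- ntrees d N.-1)
    wcoef (X s t) v *: tree_elem_diff f v (Y s).
Proof.
have cX := rp_character X s t.
move=> h1; rewrite /remainder pairing_lift h1 star_dirac1 // cX.1 scale1r opprD addrA.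
congr (_ - _ - _).
  by rewrite /lift_solution h1 eqxx orbT sigma_one invr1 scale1r.
by apply: eq_bigr => v _; rewrite star_dirac1 // mulrC.
Qed.

Lemma trunk_not_forest (x : dual R d) h (t : ptree d) : tnormal t -> ~~ is_tree h -> h != fone d ->
  star x (dirac_forest R h) (tree_forest t) = 0.
Proof.
move=> nt hT h1; rewrite /star coprod_tree // big_seq big1 // => q qt.
rewrite /dirac_forest; case: (tree_coprod_trunk qt) => [->|[u nu ->]].
  by rewrite (negbTE h1) mulr0.
case: eqVneq hT => [->|]; last by rewrite mulr0.
by rewrite /is_tree val_tree_forest.
Qed.

Lemma remainder_forest X Y (h : 'F_(d; N.-1)) s t : ~~ is_tree (val h) -> val h != fone d ->
  remainder X (lift_solution f Y) h s t = 0.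
Proof.
move=> hT h1; rewrite /remainder pairing_lift /lift_solution (negbTE hT) (negbTE h1) /=.
rewrite /star coprod_one big_seq1 /dirac_forest (negbTE h1) mulr0 scale0r add0r.
rewrite big_seq big1 ?addr0 ?oppr0 // => v; rewrite mem_ntrees => /andP[nv _].
by rewrite [X in X * _]trunk_not_forest // mul0r scale0r.
Qed.

End Lifts.

Section Helpers.
Variable R : realType.

(** Every admissible [q] satisfies [inf S <= k * q + b]; passing to the infimum gives
    [(1 - k) * inf S <= b], without iterating the improvement. *)
Lemma self_improve (Q : R -> Prop) (k b x : R) : 0 < k < 1 ->
  (exists q, Q q) -> (forall q, Q q -> 0 <= q) ->
  (forall q, Q q -> Q (k * q + b)) -> (forall q, Q q -> x <= q) -> x <= b / (1 - k).
Proof.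
move=> /andP[k0 k1] Q0 Qge0 Qk xQ; pose S : set R := [set q | Q q].
have hasS : has_inf S by split; [case: Q0 => q Qq; exists q|exists 0 => q /Qge0].
have lbS q : Q q -> inf S <= q by move=> Qq; apply: ge_inf => //; case: hasS.
have k10 : 0 < 1 - k by rewrite subr_gt0.
apply: (@le_trans _ _ (inf S)).
  by apply: lb_le_inf; [case: hasS|move=> q; exact: xQ].
rewrite ler_pdivlMr //.
have : (inf S - b) / k <= inf S.
  apply: lb_le_inf; [by case: hasS|move=> q Qq].
  by rewrite ler_pdivrMr // lerBlDr mulrC; apply: lbS; exact: Qk.
by rewrite ler_pdivrMr //; lra.
Qed.

Lemma small_power (al c eta : R) : 0 < al -> 0 <= c -> 0 < eta ->
  exists2 h : R, 0 < h <= 1 & forall x, 0 <= x <= h -> c * x `^ al <= eta.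
Proof.
move=> al0 c0 eta0; have c1 : 0 < c + 1 by rewrite ltr_wpDl.
pose e := eta / (c + 1); have e0 : 0 < e by rewrite divr_gt0.
exists (Num.min 1 (e `^ al^-1)) => [|x /andP[x0]].
  by rewrite lt_min ltr01 powR_gt0 //= ge_min lexx.
rewrite le_min => /andP[_ xe].
have xal : x `^ al <= e.
  have -> : e = (e `^ al^-1) `^ al by rewrite -powRrM mulVf ?gt_eqF // powRr1 // ltW.
  by rewrite ge0_ler_powR ?nnegrE ?powR_ge0 // ltW.
apply: (@le_trans _ _ (c * e)); first by rewrite ler_wpM2l.
rewrite /e mulrA ler_pdivrMr // mulrC.
by apply: ler_wpM2l; [exact: ltW|rewrite lerDl].
Qed.

(** The ratio 2/3 instead of 1/2 also serves the Euler grid: an interval of at least two cells can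
    be cut between cells so that neither part exceeds two thirds of it. *)
Definition kappa (th : R) : R := (2 / 3) `^ (th - 1).

Lemma kappa01 th : 1 < th -> 0 < kappa th < 1.
Proof.
move=> th1; have p0 : 0 < (2 / 3 : R) by rewrite divr_gt0.
have <- : 1 `^ (th - 1) = 1 :> R by rewrite powR1.
rewrite powR_gt0 //=; apply: gt0_ltr_powR => //.
- by rewrite subr_gt0.
- by rewrite nnegrE ltW.
- by rewrite nnegrE.
- by rewrite ltr_pdivrMr // mul1r ltr_nat.
Qed.

Lemma split_power th (a b c : R) : 1 < th -> 0 <= a <= 2 / 3 * c -> 0 <= b <= 2 / 3 * c ->
  a + b = c -> a `^ th + b `^ th <= kappa th * c `^ th.
Proof.
move=> th1 /andP[a0 ac] /andP[b0 bc] abc; have th0 : 0 < th by rewrite (lt_trans ltr01).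
have c0 : 0 <= c by rewrite -abc addr_ge0.
have p0 : 0 <= 2 / 3 * c by exact: le_trans ac.
have th10 : 0 <= th - 1 by rewrite subr_ge0 ltW.
have H x : 0 <= x -> x <= 2 / 3 * c -> x `^ th <= x * (kappa th * c `^ (th - 1)).
  move=> x0 xc; rewrite -(mulr_powRB1 x0 th0) ler_wpM2l // /kappa -powRM //.
  by rewrite ge0_ler_powR ?nnegrE.
apply: le_trans (lerD (H a a0 ac) (H b b0 bc)) _.
by rewrite -mulrDl abc mulrCA mulr_powRB1.
Qed.

End Helpers.

Lemma ler_norm_diff4 (R : realType) (W : normedModType R) (a b c e a' b' c' e' : W) :
  `|a + b + c + e - (a' + b' + c' + e')| <=
  `|a - a'| + `|b - b'| + `|c - c'| + `|e - e'|.
Proof.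
have -> : a + b + c + e - (a' + b' + c' + e') = (a - a') + (b - b') + (c - c') + (e - e').
  by rewrite !opprD (addrACA (a + b + c)) (addrACA (a + b)) (addrACA a).
by do 3![apply: le_trans (ler_normD _ _) _; apply: lerD => //].
Qed.

Section Windows.
Variables (R : realType) (T : {posnum R}).
Implicit Types (s t u a : time T).

Lemma mid_subproof s t : 0 <= (sval s + sval t) / 2 <= T%:num.
Proof.
case: s t => [s /= /andP[s0 sT]] [t /= /andP[t0 tT]].
by apply/andP; split; lra.
Qed.

Definition mid s t : time T := exist _ ((sval s + sval t) / 2) (mid_subproof s t).

Lemma dist_midl s t : dist s (mid s t) = dist s t / 2.
Proof.
rewrite /dist /=.
have -> : (sval s + sval t) / 2 - sval s = (sval t - sval s) / 2 by lra.
by rewrite normrM normfV (ger0_norm (ler0n _ 2)).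
Qed.

Lemma dist_midr s t : dist (mid s t) t = dist s t / 2.
Proof.
rewrite /dist /=.
have -> : sval t - (sval s + sval t) / 2 = (sval t - sval s) / 2 by lra.
by rewrite normrM normfV (ger0_norm (ler0n _ 2)).
Qed.

Lemma time_le t : 0 <= sval t <= T%:num. Proof. by case: t. Qed.

(** A discrete Gronwall argument over windows of length [h]; as [1 <= A], each of the [k] terms of
    the geometric sum is bounded by [A ^+ k * B]. *)
Lemma window_induct (G : time T -> R) (h A B : R) : 0 < h -> 1 <= A -> 0 <= B ->
  0 <= G time0 ->
  (forall a t, sval a <= sval t <= sval a + h -> G t <= A * G a + B) ->
  forall (k : nat) t, sval t <= k%:R * h -> G t <= A ^+ k * (G time0 + k%:R * B).
Proof.
move=> h0 A1 B0 G0 HG; have A0 : 0 <= A by rewrite (le_trans ler01).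
elim=> [|k IHk] t tk.
  rewrite mul0r in tk; have t0 : sval t = 0.
    by apply/eqP; rewrite eq_le tk; case/andP: (time_le t).
  by rewrite (@time_inj _ _ t time0) // expr0 mul1r mul0r addr0.
have kB : 0 <= G time0 + k%:R * B by rewrite addr_ge0 // mulr_ge0.
have kB' : G time0 + k%:R * B <= G time0 + k.+1%:R * B.
  by rewrite lerD2l ler_wpM2r // ler_nat.
have Ak : 0 <= A ^+ k by rewrite exprn_ge0.
have [tkh|tkh] := leP (sval t) (k%:R * h).
  apply: le_trans (IHk t tkh) _; rewrite exprS; apply: ler_pM => //.
  by rewrite -[leLHS]mul1r ler_wpM2r.
have a01 : 0 <= k%:R * h <= T%:num.
  apply/andP; split; first by rewrite mulr_ge0 // ltW.
  by apply: le_trans (ltW tkh) _; case/andP: (time_le t).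
have := HG (exist _ (k%:R * h) a01) t; rewrite /= ltW //= => H.
apply: le_trans (H _) _.
  by move: tk; rewrite -natr1 mulrDl mul1r.
have := IHk (exist _ (k%:R * h) a01) (lexx _) => Ga.
apply: (@le_trans _ _ (A * (A ^+ k * (G time0 + k%:R * B)) + B)).
  by rewrite lerD2r ler_wpM2l.
rewrite mulrA -exprS -natr1 mulrDl mul1r addrA [leRHS]mulrDr lerD2l.
by rewrite -[leLHS]mul1r ler_wpM2r // exprn_ege1.
Qed.

Lemma window_count (h : R) : 0 < h -> exists k : nat, forall t, sval t <= k%:R * h.
Proof.
move=> h0; exists (Num.truncn (T%:num / h)).+1 => t.
apply: le_trans (_ : T%:num <= _); first by case/andP: (time_le t).
by rewrite -ler_pdivrMr // ltW // truncnS_gt.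
Qed.

End Windows.

(** * Solutions *)

Section Solutions.
Variables (R : realType) (d n : nat) (T : {posnum R}) (alpha : R).
Hypothesis alpha01 : 0 < alpha < 1.
Local Notation rpath := (rough_path d T alpha).
Local Notation N := (level alpha).
Local Notation V := 'rV[R]_n.
Local Notation theta := (N.+1%:R * alpha).
Variables (f : 'I_d -> V -> V) (K : R).
Hypothesis smooth_f : forall i, smooth (f i).
Hypothesis K_ge0 : 0 <= K.
Hypothesis f_le : forall i vs y, (size vs <= N.+1)%N ->
  `|iter_diff (f i) vs y| <= K * norm_prod vs.
Variable M : R.
Local Notation inc := (increment N f).
Local Notation J := (rde_remainder f).

Lemma alpha_ge0 : 0 <= alpha. Proof. by rewrite ltW //; case/andP: alpha01. Qed.

Lemma ler_powR_alpha (a b : R) : 0 <= a -> a <= b -> a `^ alpha <= b `^ alpha.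
Proof. by move=> a0 ab; rewrite ge0_ler_powR ?nnegrE ?alpha_ge0 // (le_trans a0). Qed.

Let E : R := T%:num `^ alpha.
Let E_ge0 : 0 <= E. Proof. exact: powR_ge0. Qed.

Section Configurations.
Variable B : R.

(** The parameter fed to the calculus of orders. Bundling the data with their bounds makes each
    constant obtained from [lipO] uniform over all data that satisfy these bounds. *)
Record config := Config {
  cX : bool -> rpath; cy : bool -> V; cr : bool -> V; cdel : R; ceta : R;
  cs : time T; cu : time T; ct : time T;
  cXM : forall b, (rp_norm (cX b) <= M%:E)%E;
  cdelP : (rho (cX true) (cX false) <= cdel%:E)%E;
  cyP : `|cy true - cy false| <= cdel;
  cetaP : 0 <= ceta <= B;
  crP : forall b, `|cr b| <= ceta;
  crP' : `|cr true - cr false| <= ceta * cdel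
}.

Definition pair_config (X X' : rpath) (y y' r r' : V) (del eta : R) s u t
    (XM : (rp_norm X <= M%:E)%E) (X'M : (rp_norm X' <= M%:E)%E) (XX : (rho X X' <= del%:E)%E)
    (yy : `|y - y'| <= del) (etaB : 0 <= eta <= B) (re : `|r| <= eta) (r'e : `|r'| <= eta)
    (rr : `|r - r'| <= eta * del) : config :=
  @Config (fun b => if b then X else X') (fun b => if b then y else y')
    (fun b => if b then r else r') del eta s u t
    (fun b => match b with true => XM | false => X'M end) XX yy etaB
    (fun b => match b with true => re | false => r'e end) rr.

Lemma cdel_ge0 om : 0 <= cdel om.
Proof. by rewrite -lee_fin; apply: le_trans (cdelP om); exact: rho_ge0. Qed.

Lemma cy_lip : lip cdel (fun om => cy om).
Proof. by exists 1 => // om; rewrite mul1r; exact: cyP. Qed.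

Lemma cr_lipO : lipO cdel ceta (fun om => cr om).
Proof.
by exists 1 => // om; rewrite !mul1r; split; [exact: crP|exact: crP'].
Qed.

Lemma config_lipO (p q : config -> time T) (eps : config -> R) h :
  (forall om, dist (p om) (q om) `^ alpha <= eps om) -> (fsize h <= N)%N ->
  lipO cdel (fun om => eps om ^+ fsize h) (fun om b => cX om b (p om) (q om) h).
Proof.
move=> pq hN; exists (`|M| + 1) => [|om]; first exact: addr_ge0.
have e0 : (dist (p om) (q om) `^ alpha) ^+ fsize h <= eps om ^+ fsize h.
  by rewrite lerXn2r ?nnegrE ?(le_trans _ (pq om)) ?powR_ge0.
have e1 : 0 <= eps om ^+ fsize h by rewrite exprn_ge0 // (le_trans _ (pq om)) ?powR_ge0.
split=> [b|].
  rewrite (le_trans (rough_bound _ _ (cXM om b) hN)) //.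
  by rewrite ler_wpM2l // addr_ge0.
rewrite (le_trans (rough_diff_bound _ _ (cdelP om) hN)) // mulrC.
rewrite ler_wpM2r ?cdel_ge0 // (le_trans e0) // -[leLHS]mul1r.
by rewrite ler_wpM2r // lerDr.
Qed.

Let e_st om := dist (cs om) (ct om) `^ alpha.
(** Chen's relation holds for times in any order, where [dist s t] need not dominate the two other
    distances; their maximum is the common scale. *)
Let e_max om := Num.max (dist (cs om) (cu om)) (dist (cu om) (ct om)) `^ alpha.

Lemma e_st_bound om : 0 <= e_st om <= E.
Proof. by rewrite powR_ge0 ler_powR_alpha ?dist_le ?dist_ge0. Qed.

Lemma e_max_bound om : 0 <= e_max om <= E.
Proof.
by rewrite powR_ge0 ler_powR_alpha // ?le_max ?dist_ge0 // ge_max !dist_le.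
Qed.

Let x_st om b := cX om b (cs om) (ct om).
Let x_su om b := cX om b (cs om) (cu om).
Let x_ut om b := cX om b (cu om) (ct om).

Lemma char_x (p q : config -> time T) om b : is_character (cX om b (p om) (q om)).
Proof. exact: rp_character. Qed.

Lemma increment_lipO : lipO cdel e_st (fun om b => inc (x_st om b) (cy om b)).
Proof.
have xO h := @config_lipO cs ct e_st h (fun om => lexx _).
apply: eq_lipO (lipO_increment smooth_f K_ge0 f_le cdel_ge0 e_st_bound xO cy_lip) => //.
Qed.

Lemma increment_incr_lipO : lipO cdel (fun om => e_st om * ceta om)
  (fun om b => inc (x_st om b) (cy om b + cr om b) - inc (x_st om b) (cy om b)).
Proof.
have xO h := @config_lipO cs ct e_st h (fun om => lexx _).
exact: (lipO_increment_incr smooth_f K_ge0 f_le cdel_ge0 e_st_bound xO cy_lip cr_lipO cetaP).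
Qed.

Lemma defect_lipO : lipO cdel (fun om => e_max om ^+ N.+1)
  (fun om b => inc (x_su om b) (cy om b) +
     inc (x_ut om b) (cy om b + inc (x_su om b) (cy om b)) - inc (x_st om b) (cy om b)).
Proof.
have xO h : (fsize h <= N)%N -> lipO cdel (fun om => e_max om ^+ fsize h) (fun om b => x_su om b h).
  by apply: config_lipO => om; rewrite ler_powR_alpha ?dist_ge0 // le_max lexx.
have zO h : (fsize h <= N)%N -> lipO cdel (fun om => e_max om ^+ fsize h) (fun om b => x_ut om b h).
  by apply: config_lipO => om; rewrite ler_powR_alpha ?dist_ge0 // le_max lexx orbT.
have cx := char_x cs cu; have z1 om b : x_ut om b (fone d) = 1 by exact: (char_x cu ct om b).1.
apply: lipO_ext (lipO_defect smooth_f K_ge0 f_le cdel_ge0 e_max_bound cx xO cy_lip z1 zO) _.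
by move=> om b; rewrite /x_su /x_ut rp_chen.
Qed.

Section RemainderOrder.
Variable q : R.
Hypothesis q_ge0 : 0 <= q.

(* Configurations in which the perturbation [cr] has the order of an RDE remainder. *)
Definition rconfig := {om : config | ceta om <= q * e_st om ^+ N.+1}.
Let del (om : rconfig) := cdel (sval om).
Let eps (om : rconfig) := e_st (sval om).
Let y (om : rconfig) b := cy (sval om) b.
Let x (om : rconfig) b := x_st (sval om) b.
Let r (om : rconfig) b := cr (sval om) b.

Lemma rconfig_lipO : lipO del (fun om => eps om ^+ N.+1) r.
Proof.
apply: (@lipO_le _ _ _ _ _ q (fun om => ceta (sval om))) => //.
- by move=> om; exact: cdel_ge0.
- by move=> om; exact: (svalP om).
- exact: (lipO_pull sval cr_lipO).
Qed.

Let del_ge0 om : 0 <= del om. Proof. exact: cdel_ge0. Qed.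
Let eps_bound om : 0 <= eps om <= E. Proof. exact: e_st_bound. Qed.
Let cx om b : is_character (x om b). Proof. exact: rp_character. Qed.
Let yL : lip del y. Proof. exact: (lip_pull sval cy_lip). Qed.
Let xO (h : forest d) : (fsize h <= N)%N ->
  lipO del (fun om => eps om ^+ fsize h) (fun om b => x om b h).
Proof.
move=> hN; have H := @config_lipO cs ct e_st h (fun om => lexx _) hN.
exact: (lipO_pull (sval : rconfig -> config) H).
Qed.

Lemma tree_remainder_lipO t : tnormal t -> (tsize t <= N)%N ->
  lipO del (fun om => eps om ^+ (N - tsize t)) (fun om b =>
    tree_elem_diff f t (y om b + inc (x om b) (y om b) + r om b) -
    \sum_(u <- ntrees d N.-1) cut_coef (x om b) t u *: tree_elem_diff f u (y om b)).
Proof.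
exact: (lipO_remainder_tree smooth_f K_ge0 f_le del_ge0 eps_bound cx xO yL rconfig_lipO).
Qed.

Lemma one_remainder_lipO :
  lipO del (fun om => eps om ^+ N) (fun om b => inc (x om b) (y om b) + r om b -
    \sum_(u <- ntrees d N.-1) wcoef (x om b) u *:
        tree_elem_diff f u (y om b)).
Proof.
exact: (lipO_remainder_one smooth_f K_ge0 f_le del_ge0 eps_bound xO yL rconfig_lipO).
Qed.

End RemainderOrder.

End Configurations.

Implicit Types (X : rpath) (Y : time T -> V) (y r : V) (s u t : time T) (del eta : R).

(* [y |-> y + inc x y] is the truncated flow map; this is its failure to be a flow. *)
Definition defect X s u t y : V :=
  inc (X s u) y + inc (X u t) (y + inc (X s u) y) - inc (X s t) y.

Definition close X X' y y' del : Prop :=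
  [/\ (rp_norm X <= M%:E)%E, (rp_norm X' <= M%:E)%E, (rho X X' <= del%:E)%E & `|y - y'| <= del].

Lemma rho_diag X (del : R) : 0 <= del -> (rho X X <= del%:E)%E.
Proof. by move=> del0; apply: le_trans (rho_refl X) _; rewrite lee_fin. Qed.

Lemma close_diag X y y' del : (rp_norm X <= M%:E)%E -> `|y - y'| <= del -> close X X y y' del.
Proof. by move=> XM yy; split=> //; apply: rho_diag; exact: le_trans yy. Qed.

Lemma close_refl X y : (rp_norm X <= M%:E)%E -> close X X y y 0.
Proof. by move=> XM; apply: close_diag; rewrite // subrr normr0. Qed.

Lemma increment_bound : exists C : R, [/\ 0 <= C,
  forall X y s t, (rp_norm X <= M%:E)%E -> `|inc (X s t) y| <= C * dist s t `^ alpha &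
  forall X X' y y' del s t, close X X' y y' del ->
    `|inc (X s t) y - inc (X' s t) y'| <= C * dist s t `^ alpha * del].
Proof.
have z1 : `|(0 : V)| <= 0 by rewrite normr0.
have z2 del : `|(0 : V) - 0| <= 0 * del by rewrite subrr normr0 mul0r.
have z3 : 0 <= (0 : R) <= 0 by rewrite lexx.
have [C C0 H] := @increment_lipO 0; exists C.
split=> // [X y s t XM|X X' y y' del s t [XM X'M XX yy]].
  have [_ _ XX yy] := close_refl y XM.
  by have [H1 _] := H (pair_config s s t XM XM XX yy z3 z1 z1 (z2 _)); exact: (H1 true).
by have [_] := H (pair_config s s t XM X'M XX yy z3 z1 z1 (z2 _)).
Qed.

Lemma defect_bound : exists C : R, [/\ 0 <= C,
  forall X y s u t, (rp_norm X <= M%:E)%E ->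
    `|defect X s u t y| <= C * Num.max (dist s u) (dist u t) `^ theta &
  forall X X' y y' del s u t, close X X' y y' del ->
    `|defect X s u t y - defect X' s u t y'| <=
      C * Num.max (dist s u) (dist u t) `^ theta * del].
Proof.
have z1 : `|(0 : V)| <= 0 by rewrite normr0.
have z2 del : `|(0 : V) - 0| <= 0 * del by rewrite subrr normr0 mul0r.
have z3 : 0 <= (0 : R) <= 0 by rewrite lexx.
have [C C0 H] := @defect_lipO 0; exists C.
split=> // [X y s u t XM|X X' y y' del s u t [XM X'M XX yy]].
  have [_ _ XX yy] := close_refl y XM.
  have [H1 _] := H (pair_config s u t XM XM XX yy z3 z1 z1 (z2 _)).
  by rewrite /= powR_exprn ?le_max ?dist_ge0 // in H1; exact: (H1 true).
have [_] := H (pair_config s u t XM X'M XX yy z3 z1 z1 (z2 _)).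
by rewrite /= powR_exprn ?le_max ?dist_ge0.
Qed.

Lemma increment_incr_bound (B : R) : exists2 C : R, 0 <= C &
  forall X X' del eta y y' r r' s t, close X X' y y' del -> 0 <= eta <= B ->
    `|r| <= eta -> `|r'| <= eta -> `|r - r'| <= eta * del ->
    `|(inc (X s t) (y + r) - inc (X s t) y) - (inc (X' s t) (y' + r') - inc (X' s t) y')|
      <= C * (dist s t `^ alpha * eta) * del.
Proof.
have [C C0 H] := @increment_incr_lipO B.
exists C => // X X' del eta y y' r r' s t [XM X'M XX yy] etaB re r'e rr.
by have [_ H2] := H (pair_config s s t XM X'M XX yy etaB re r'e rr).
Qed.

Section Remainders.
Variable q : R.
Hypothesis q_ge0 : 0 <= q.
Let B := q * (T%:num `^ alpha) ^+ N.+1.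

Definition comparable (X X' : rpath) (Y Y' : time T -> V) del s t : Prop :=
  [/\ close X X' (Y s) (Y' s) del, `|J X Y s t| <= q * dist s t `^ theta,
      `|J X' Y' s t| <= q * dist s t `^ theta &
      `|J X Y s t - J X' Y' s t| <= q * dist s t `^ theta * del].

Lemma rconfig_bound (Phi : rpath -> V -> V -> time T -> time T -> V) k :
  lipO (fun om : @rconfig B q => cdel (sval om))
    (fun om => (dist (cs (sval om)) (ct (sval om)) `^ alpha) ^+ k)
    (fun om b => Phi (cX (sval om) b) (cy (sval om) b) (cr (sval om) b) (cs (sval om)) (ct (sval om))) ->
  exists2 C : R, 0 <= C & forall X X' (Y Y' : time T -> V) del s t, comparable X X' Y Y' del s t ->
    `|Phi X (Y s) (J X Y s t) s t| <= C * dist s t `^ (k%:R * alpha) /\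
    `|Phi X (Y s) (J X Y s t) s t - Phi X' (Y' s) (J X' Y' s t) s t|
      <= C * dist s t `^ (k%:R * alpha) * del.
Proof.
move=> [C C0 H]; exists C => // X X' Y Y' del s t [[XM X'M XX yy] J1 J2 JJ].
have e0 : 0 <= q * dist s t `^ theta <= B.
  rewrite mulr_ge0 ?powR_ge0 //= -powR_exprn ?dist_ge0 // ler_wpM2l //.
  by rewrite lerXn2r ?nnegrE ?powR_ge0 // ler_powR_alpha ?dist_ge0 // dist_le.
pose om := pair_config s s t XM X'M XX yy e0 J1 J2 JJ.
have omP : ceta om <= q * (dist (cs om) (ct om) `^ alpha) ^+ N.+1.
  by rewrite /= powR_exprn ?dist_ge0.
have [H1 H2] := H (exist _ om omP); rewrite /= powR_exprn ?dist_ge0 // in H1 H2.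
by split; [exact: (H1 true)|exact: H2].
Qed.

Lemma solution_stepE X (Y : time T -> V) s t :
  Y s + inc (X s t) (Y s) + J X Y s t = Y t.
Proof.
rewrite rde_remainderE; set a := inc _ _.
by rewrite addrAC addrA [_ + (Y t - Y s)]addrC subrK subrK.
Qed.

(** The remainder [J] plays the part of the perturbation [cr]: by [solution_stepE], [Y t] is the
    flow image of [Y s] plus [J]. The constants of the finitely many [h] are added up. *)
Lemma lift_remainder_bound : exists2 C : R, 0 <= C &
  forall X X' (Y Y' : time T -> V) del (h : 'F_(d; N.-1)) s t,
    comparable X X' Y Y' del s t ->
    `|remainder X (lift_solution f Y) h s t| <= C * dist s t `^ ((N - fsize (val h))%:R * alpha) /\
    `|remainder X (lift_solution f Y) h s t - remainder X' (lift_solution f Y') h s t| <=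
      C * dist s t `^ ((N - fsize (val h))%:R * alpha) * del.
Proof.
suff H (h : 'F_(d; N.-1)) : exists C : R, 0 <= C /\
  forall X X' (Y Y' : time T -> V) del s t, comparable X X' Y Y' del s t ->
    `|remainder X (lift_solution f Y) h s t| <= C * dist s t `^ ((N - fsize (val h))%:R * alpha) /\
    `|remainder X (lift_solution f Y) h s t - remainder X' (lift_solution f Y') h s t| <=
      C * dist s t `^ ((N - fsize (val h))%:R * alpha) * del.
  have [C HC] := choice H; have C0 h : 0 <= C h by case: (HC h).
  exists (\sum_h C h) => [|X X' Y Y' del h s t cmp]; first exact: sumr_ge0.
  have [_ /(_ X X' Y Y' del s t cmp)[H1 H2]] := HC h.
  have Ch : C h <= \sum_h C h by rewrite (bigD1 h) //= lerDl sumr_ge0.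
  have del0 : 0 <= del by have [[_ _ _ yy] _ _ _] := cmp; apply: le_trans yy.
  split; first by rewrite (le_trans H1) // ler_wpM2r ?powR_ge0.
  by rewrite (le_trans H2) // ler_wpM2r // ler_wpM2r ?powR_ge0.
have [h1|h1] := eqVneq (val h) (fone d).
  have H := @one_remainder_lipO B q q_ge0.
  have [C C0 HC] := @rconfig_bound (fun X y r s t => inc (X s t) y + r -
    \sum_(u <- ntrees d N.-1) wcoef (X s t) u *:
        tree_elem_diff f u y) _ H.
  exists C; split=> // X X' Y Y' del s t cmp; have := HC _ _ _ _ _ _ _ cmp.
  rewrite h1 fsize_one subn0 !remainder_one //.
  have dE (X0 : rpath) (Y0 : time T -> V) : Y0 t - Y0 s =
      inc (X0 s t) (Y0 s) + J X0 Y0 s t.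
    by rewrite rde_remainderE [RHS]addrC subrK.
  by rewrite (dE X Y) (dE X' Y').
have [hT|hT] := boolP (is_tree (val h)); last first.
  exists 0; split=> // X X' Y Y' del s t _.
  by rewrite !remainder_forest // subrr normr0 !mul0r.
have [u nu hu] : exists2 u, tnormal u & val h = tree_forest u.
  move: hT; rewrite /is_tree; case hE : (planar (val h)) => [|u [|]] // _.
  have nu : tnormal u by apply: (@mem_tnormal _ _ (val h)); rewrite hE mem_head.
  by exists u => //; apply: perm_forest; rewrite hE val_tree_forest.
have uN : (tsize u <= N)%N.
  have := ssvalP h; rewrite mem_forests_upto -[ssval h]/(val h) hu fsize_tree => /leq_trans; apply.
  exact: leq_pred.
have H := @tree_remainder_lipO B q q_ge0 u nu uN.
have [C C0 HC] := @rconfig_bound (fun X y r s t => weight R (tree_forest u) *: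
  (tree_elem_diff f u (y + inc (X s t) y + r) -
    \sum_(v <- ntrees d N.-1) cut_coef (X s t) u v *: tree_elem_diff f v y)) _ (lipOZ _ H).
exists C; split=> // X X' Y Y' del s t cmp; have := HC _ _ _ _ _ _ _ cmp.
by rewrite hu fsize_tree (remainder_tree f X Y s t nu hu) (remainder_tree f X' Y' s t nu hu) !solution_stepE.
Qed.

End Remainders.

(** * Sewing and a priori bounds on the remainder of a solution *)

Lemma increment_diag X t y : inc (X t t) y = 0.
Proof.
rewrite /increment big1 // => u _.
by rewrite rough_path_diag ?tree_forest_neq1 // mulr0 scale0r.
Qed.

Lemma rde_remainder_diag X Y t : J X Y t t = 0.
Proof. by rewrite rde_remainderE increment_diag !subrr. Qed.

(** Pure algebra. The third term compares increments at two points that differ by [J X Y s u], and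
    therefore gains a factor of order [alpha] over it. *)
Lemma rde_chasles X Y s u t : J X Y s t = J X Y u t + J X Y s u +
  (inc (X u t) (Y u) - inc (X u t) (Y s + inc (X s u) (Y s))) + defect X s u t (Y s).
Proof.
rewrite !rde_remainderE /defect.
set a := inc _ (Y s + _); set b := inc _ (Y u); set c := inc (X s u) _; set e := inc (X s t) _.
apply/rowP => j; rewrite !mxE; ring.
Qed.

(** Here [q] may depend on [X] and [Y]; [expansion_bound] makes it depend on the bound [M] only. *)
Definition has_expansion X Y : Prop :=
  exists2 q : R, 0 <= q & forall s t, `|J X Y s t| <= q * dist s t `^ theta.

Lemma theta_gt1 : 1 < theta. Proof. exact: level_exponent. Qed.
Lemma alpha_gt0 : 0 < alpha. Proof. by case/andP: alpha01. Qed.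

Lemma power_half s t : let p := dist s t / 2 in
  0 <= p <= dist s t /\ p `^ theta + p `^ theta <= kappa theta * dist s t `^ theta.
Proof.
have d0 := dist_ge0 s t; split; first by apply/andP; split; lra.
by apply: split_power; [exact: theta_gt1|apply/andP; split; lra|apply/andP; split; lra|lra].
Qed.

Lemma theta_ge0 : 0 <= theta. Proof. by rewrite ltW // (lt_trans ltr01 theta_gt1). Qed.

Lemma ler_powR_theta (a b : R) : 0 <= a -> a <= b -> a `^ theta <= b `^ theta.
Proof. by move=> a0 ab; rewrite ge0_ler_powR ?nnegrE ?theta_ge0 // (le_trans a0). Qed.

(** Both inequalities come from [rde_chasles]. The second one, solved for [J X Y u t], allows the
    left endpoint of an interval to be moved. *)
Lemma remainder_split : exists C1 C2 : R, [/\ 0 <= C1, 0 <= C2 &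
  forall X, (rp_norm X <= M%:E)%E -> [/\
  forall s t y, `|inc (X s t) y| <= C1 * dist s t `^ alpha,
  forall s t y y', `|inc (X s t) y - inc (X s t) y'| <= C1 * dist s t `^ alpha * `|y - y'| &
  forall Y s u t,
    let err := C1 * dist u t `^ alpha * `|J X Y s u| +
      C2 * Num.max (dist s u) (dist u t) `^ theta in
    `|J X Y s t| <= `|J X Y u t| + `|J X Y s u| + err /\
    `|J X Y u t| <= `|J X Y s t| + `|J X Y s u| + err]].
Proof.
have [C1 [C10 I1 LI]] := increment_bound.
have [C2 [C20 D1 LD]] := defect_bound.
exists C1, C2; split=> // X XM.
have I2 s t y y' : `|inc (X s t) y - inc (X s t) y'| <= C1 * dist s t `^ alpha * `|y - y'|.
  exact: (LI _ _ _ _ _ _ _ (close_diag XM (lexx _))).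
split=> // [s t y|Y s u t err]; first exact: I1.
have F := I2 u t (Y u) (Y s + inc (X s u) (Y s)); have D := D1 X (Y s) s u t XM.
rewrite opprD addrA -rde_remainderE in F; have := rde_chasles X Y s u t.
move: F D; rewrite /err; move: (inc (X u t) _ - _) (defect _ _ _ _ _) => a b aF bD EJ.
have abE : `|a + b| <= err by apply: le_trans (ler_normD _ _) _; exact: lerD.
split.
  rewrite EJ -addrA; apply: le_trans (ler_normD _ _) _; apply: lerD => //.
  exact: ler_normD.
have -> : J X Y u t = J X Y s t - J X Y s u - (a + b).
  by rewrite EJ; move: (J X Y u t) (J X Y s u) => v w; apply/rowP => l; rewrite !mxE; ring.
apply: le_trans (ler_normB _ _) _; apply: lerD => //; exact: ler_normB.
Qed.

(* The best constant in the bound on a set [I] of times satisfies [q <= k * q + b]. *)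
Lemma sewing_bound (G : time T -> time T -> V) (k b h : R) (I : time T -> Prop) : 0 < k < 1 ->
  (exists2 q : R, 0 <= q & forall s t, `|G s t| <= q * dist s t `^ theta) -> 0 <= b ->
  (forall q, 0 <= q ->
     (forall s t, I s -> I t -> dist s t <= h -> `|G s t| <= q * dist s t `^ theta) ->
     forall s t, I s -> I t -> dist s t <= h -> `|G s t| <= (k * q + b) * dist s t `^ theta) ->
  forall s t, I s -> I t -> dist s t <= h -> `|G s t| <= b / (1 - k) * dist s t `^ theta.
Proof.
move=> k01 [q0 q00 Gq] b0 step s t Is It sth.
have [st|st] := eqVneq (dist s t) 0.
  have := Gq s t; rewrite st powR0 ?gt_eqF ?(lt_trans ltr01 theta_gt1) //.
  by rewrite !mulr0.
have d0 : 0 < dist s t `^ theta by rewrite powR_gt0 // lt_neqAle eq_sym st dist_ge0.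
rewrite -ler_pdivrMr //.
pose Q q := 0 <= q /\ forall s t, I s -> I t -> dist s t <= h ->
  `|G s t| <= q * dist s t `^ theta.
apply: (self_improve k01 (Q := Q)) => [|q []|q [qge Hq]|q [qge Hq]] //.
- by exists q0; split.
- by split; [rewrite addr_ge0 // mulr_ge0 //; case/andP: k01 => /ltW|exact: step].
- by rewrite ler_pdivrMr //; exact: Hq.
Qed.

Lemma expansion_bound_small : exists q h : R, [/\ 0 <= q, 0 < h <= 1 &
  forall X Y, (rp_norm X <= M%:E)%E -> has_expansion X Y ->
  forall s t, dist s t <= h -> `|J X Y s t| <= q * dist s t `^ theta].
Proof.
have [C1 [C2 [C10 C20 split_step]]] := remainder_split.
have /andP[k0 k1] := kappa01 theta_gt1; set k := kappa theta in k0 k1.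
have k10 : 0 < (1 - k) / 2 by rewrite divr_gt0 // subr_gt0.
(* On intervals this short the third term of [rde_chasles] is at most [(1 - k) / 2] times [J] on the
   first half, so that the total factor is [k' = (1 + k) / 2 < 1]. *)
have [h h01 Hh] := small_power alpha_gt0 C10 k10.
pose k' := (1 + k) / 2.
have k'01 : 0 < k' < 1 by apply/andP; rewrite /k'; split; lra.
exists (C2 / (1 - k')), h; split=> //.
  by rewrite divr_ge0 // subr_ge0 ltW //; case/andP: k'01.
move=> X Y XM eY s t sth; have [_ _ {}split_step] := split_step X XM.
apply: (sewing_bound k'01 eY C20 (I := fun=> True)) sth => //.
move=> q qge Jq {}s {}t _ _ sth.
have [/andP[p0 ps] pk] := power_half s t; set p := dist s t / 2 in p0 ps pk.
have sup : dist s (mid s t) = p := dist_midl s t.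
have upt : dist (mid s t) t = p := dist_midr s t.
have ph : p <= h by exact: le_trans sth.
have A1 : `|J X Y s (mid s t)| <= q * p `^ theta by have := Jq s (mid s t) I I; rewrite sup => /(_ ph).
have A2 : `|J X Y (mid s t) t| <= q * p `^ theta by have := Jq (mid s t) t I I; rewrite upt => /(_ ph).
have /= [H _] := split_step Y s (mid s t) t; rewrite sup upt maxxx in H.
have A3 : C1 * p `^ alpha * `|J X Y s (mid s t)| <= (1 - k) / 2 * (q * p `^ theta).
  by apply: ler_pM => //; [rewrite mulr_ge0 ?powR_ge0|apply: Hh; rewrite p0].
have A4 : p `^ theta <= dist s t `^ theta by exact: ler_powR_theta.
have A5 : C2 * p `^ theta <= C2 * dist s t `^ theta by rewrite ler_wpM2l.
have A6 : q * (p `^ theta + p `^ theta) <= q * (k * dist s t `^ theta) by rewrite ler_wpM2l.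
have A7 : (1 - k) / 2 * (q * p `^ theta) <= (1 - k) / 2 * (q * dist s t `^ theta).
  by apply: ler_wpM2l; [exact: ltW|exact: ler_wpM2l].
apply: le_trans H _; move: A1 A2 A3 A5 A6 A7; rewrite /k'.
move: (p `^ theta) (dist s t `^ theta) => P D; lra.
Qed.

Lemma dist_alpha_le s t : dist s t `^ alpha <= E.
Proof. by rewrite ler_powR_alpha ?dist_ge0 ?dist_le. Qed.

Lemma power_far (h c x : R) s t : 0 < h -> 0 <= c -> x <= c -> h <= dist s t ->
  x <= c / h `^ theta * dist s t `^ theta.
Proof.
move=> h0 c0 xc hst; apply: le_trans xc _; have hp : 0 < h `^ theta by rewrite powR_gt0.
rewrite mulrAC ler_pdivlMr // ler_wpM2l //.
by apply: ler_powR_theta => //; exact: ltW.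
Qed.

Lemma solution_diffE X Y s t : Y t - Y s = inc (X s t) (Y s) + J X Y s t.
Proof. by rewrite rde_remainderE [RHS]addrC subrK. Qed.

Lemma dist_window (a t : time T) (h : R) : sval a <= sval t <= sval a + h -> dist a t <= h.
Proof.
by move=> /andP[at1 at2]; rewrite /dist ger0_norm ?subr_ge0 // lerBlDr addrC.
Qed.

Lemma powR_theta_le1 (x : R) : 0 <= x <= 1 -> x `^ theta <= 1.
Proof.
by move=> /andP[x0 x1]; apply: le_trans (ler_powR_theta x0 x1) _; rewrite powR1.
Qed.

Lemma powR_theta_alpha (x h : R) : 0 <= x <= h -> h <= 1 -> x `^ theta <= h `^ alpha.
Proof.
move=> /andP[x0 xh] h1; have h0 : 0 <= h by exact: le_trans xh.
apply: le_trans (ler_powR_theta x0 xh) _; rewrite -powR_exprn //.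
rewrite exprS -[leRHS]mulr1 ler_wpM2l ?powR_ge0 //.
rewrite exprn_ile1 ?powR_ge0 //.
by apply: le_trans (ler_powR_alpha h0 h1) _; rewrite powR1.
Qed.

(** For distant times it suffices that [J] is bounded. No bound on [Y] itself is available, as its
    initial value is arbitrary, but [Y - Y time0] is bounded window by window. *)
Lemma expansion_bound : exists2 q : R, 0 <= q &
  forall X Y, (rp_norm X <= M%:E)%E -> has_expansion X Y ->
  forall s t, `|J X Y s t| <= q * dist s t `^ theta.
Proof.
have [C1 [C10 I1 LI]] := increment_bound.
have [q [h [q0 /andP[h0 h1] Hq]]] := expansion_bound_small.
have [k Hk] := window_count T h0.
pose B := C1 * E + q; have B0 : 0 <= B by rewrite addr_ge0 ?mulr_ge0.
pose B' := 2 * (k%:R * B) + C1 * E.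
have B'0 : 0 <= B' by rewrite addr_ge0 ?mulr_ge0.
exists (q + B' / h `^ theta) => [|X Y XM eXY s t]; first by rewrite addr_ge0 ?divr_ge0 ?powR_ge0.
have incE s' t' y : `|inc (X s' t') y| <= C1 * E.
  by apply: le_trans (I1 _ _ _ _ XM) _; rewrite ler_wpM2l // dist_alpha_le.
have [sth|sth] := leP (dist s t) h.
  apply: le_trans (Hq X Y XM eXY s t sth) _; rewrite mulrDl lerDl.
  by rewrite mulr_ge0 ?powR_ge0 // divr_ge0 ?powR_ge0.
have W u : `|Y u - Y time0| <= k%:R * B.
  have := @window_induct _ T (fun u => `|Y u - Y time0|) h 1 B h0 (lexx _) B0 (normr_ge0 _) _ k u (Hk u).
  rewrite subrr normr0 add0r expr1n mul1r; apply=> a v av.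
  have at1 := dist_window av; rewrite mul1r.
  have -> : Y v - Y time0 = (Y a - Y time0) + (Y v - Y a) by rewrite [RHS]addrC subrKA.
  apply: le_trans (ler_normD _ _) _; rewrite lerD2l (solution_diffE X).
  apply: le_trans (ler_normD _ _) _; apply: lerD => //.
  apply: le_trans (Hq X Y XM eXY a v at1) _; rewrite -[leRHS]mulr1 ler_wpM2l //.
  by rewrite powR_theta_le1 // dist_ge0 (le_trans at1).
rewrite mulrDl; apply: ler_wpDl; first by rewrite mulr_ge0 ?powR_ge0.
apply: power_far => //; last exact: ltW.
rewrite rde_remainderE /B'.
have -> : Y t - Y s = (Y t - Y time0) - (Y s - Y time0) by rewrite opprB addrA subrK.
apply: le_trans (ler_normB _ _) _; apply: lerD => //.
by apply: le_trans (ler_normB _ _) _; have := W s; have := W t; lra.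
Qed.

(** * Comparison of two solutions *)

Lemma difference_step : exists C5 C6 : R, [/\ 0 <= C5, 0 <= C6 &
  forall X X' Y Y' (rh S q : R) s t, (rp_norm X <= M%:E)%E -> (rp_norm X' <= M%:E)%E ->
  (rho X X' <= rh%:E)%E -> 0 <= rh -> has_expansion X Y -> has_expansion X' Y' ->
  `|Y s - Y' s| <= S -> 0 <= q ->
  `|J X Y s (mid s t) - J X' Y' s (mid s t)| <= q * dist s (mid s t) `^ theta ->
  `|J X Y (mid s t) t - J X' Y' (mid s t) t| <= q * dist (mid s t) t `^ theta ->
  `|J X Y s t - J X' Y' s t| <=
     (kappa theta * q + C5 * dist s t `^ alpha * q + C6 * (S + rh)) * dist s t `^ theta].
Proof.
have [C1 [C10 I1 LI]] := increment_bound.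
have [C2 [C20 _ LD]] := defect_bound.
have [q1 q10 Hq1] := expansion_bound.
have [C4 C40 H4] := @increment_incr_bound
  ((1 + q1) * T%:num `^ theta).
have q11 : 0 <= 1 + q1 by rewrite addr_ge0.
have C1E : 0 <= C1 * E by rewrite mulr_ge0.
exists (C4 * (1 + q1)), (C2 + C4 * (1 + q1) * E * (1 + C1 * E)); split.
- by rewrite mulr_ge0.
- by rewrite addr_ge0 // !mulr_ge0 // addr_ge0.
move=> X X' Y Y' rh S q s t XM X'M XX rh0 eY eY' YS q0.
have [/andP[p0 ps] pk] := power_half s t; rewrite dist_midl dist_midr => A1 A2.
set p := dist s t / 2 in p0 ps pk A1 A2; set u := mid s t in A1 A2.
have sup : dist s u = p := dist_midl s t.
have upt : dist u t = p := dist_midr s t.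
have S0 : 0 <= S by apply: le_trans YS.
have Srh : 0 <= S + rh by rewrite addr_ge0.
have XX1 : (rho X X' <= (S + rh)%:E)%E by apply: le_trans XX _; rewrite lee_fin lerDr.
have YS1 : `|Y s - Y' s| <= S + rh by apply: le_trans YS _; rewrite lerDl.
have cl : close X X' (Y s) (Y' s) (S + rh) by split.
(* [eta] has to bound both remainders over the first half, and [eta * del] their difference: this
   explains the 1 in [eta] and the [q] in [del]. The other part of [del] bounds the distance of the
   two flow images. *)
pose eta := (1 + q1) * p `^ theta; pose del := (1 + C1 * E) * (S + rh) + q.
have pth : 0 <= p `^ theta := powR_ge0 _ _.
have e0 : 0 <= eta <= (1 + q1) * T%:num `^ theta.
  rewrite /eta mulr_ge0 //= ler_wpM2l // ler_powR_theta //.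
  exact: le_trans ps (dist_le _ _).
have etap : p `^ theta <= eta by rewrite /eta mulrDl mul1r lerDl mulr_ge0.
have delq : q <= del by rewrite /del lerDr mulr_ge0 // addr_ge0.
have r1 : `|J X Y s u| <= eta.
  apply: le_trans (Hq1 X Y XM eY s u) _; rewrite sup /eta mulrDl mul1r lerDr //.
have r2 : `|J X' Y' s u| <= eta.
  apply: le_trans (Hq1 X' Y' X'M eY' s u) _; rewrite sup /eta mulrDl mul1r lerDr //.
have r3 : `|J X Y s u - J X' Y' s u| <= eta * del.
  by apply: le_trans A1 _; rewrite mulrC ler_pM.
have P3 : `|Y s + inc (X s u) (Y s) - (Y' s + inc (X' s u) (Y' s))| <= del.
  rewrite opprD addrACA; apply: le_trans (ler_normD _ _) _.
  apply: le_trans (lerD YS1 (LI _ _ _ _ _ s u cl)) _; rewrite /del mulrDl mul1r -[leRHS]addrA lerD2l.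
  by apply: ler_wpDr => //; rewrite ler_wpM2r // ler_wpM2l // dist_alpha_le.
have XX2 : (rho X X' <= del%:E)%E.
  apply: le_trans XX1 _; rewrite lee_fin /del mulrDl mul1r -[leRHS]addrA lerDl addr_ge0 //.
  by rewrite mulr_ge0.
have := H4 X X' del eta _ _ _ _ u t (And4 XM X'M XX2 P3) e0 r1 r2 r3.
rewrite !solution_stepE => I4.
have I2 := LD _ _ _ _ _ s u t cl.
rewrite sup upt maxxx in I2.
rewrite (rde_chasles X Y s u t) (rde_chasles X' Y' s u t).
have I4' : `|(inc (X u t) (Y u) - inc (X u t) (Y s + inc (X s u) (Y s))) -
   (inc (X' u t) (Y' u) - inc (X' u t) (Y' s + inc (X' s u) (Y' s)))| <=
   C4 * (1 + q1) * (dist s t `^ alpha * dist s t `^ theta) * del.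
  apply: le_trans I4 _; rewrite upt /eta; rewrite ler_wpM2r ?(le_trans q0 delq) //.
  rewrite -!mulrA ler_wpM2l // [leLHS]mulrCA ler_wpM2l //.
  by rewrite ler_pM ?powR_ge0 // ?ler_powR_alpha ?ler_powR_theta.
apply: le_trans (ler_norm_diff4 _ _ _ _ _ _ _ _) _.
apply: le_trans (lerD (lerD (lerD A2 A1) I4') I2) _.
have Dth : 0 <= dist s t `^ theta := powR_ge0 _ _.
have Dal : 0 <= dist s t `^ alpha := powR_ge0 _ _.
have DE := dist_alpha_le s t.
have B1 : q * (p `^ theta + p `^ theta) <= q * (kappa theta * dist s t `^ theta) by rewrite ler_wpM2l.
have B2 : C2 * p `^ theta * (S + rh) <= C2 * dist s t `^ theta * (S + rh).
  by rewrite ler_wpM2r // ler_wpM2l // ler_powR_theta.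
have B3 : C4 * (1 + q1) * (dist s t `^ alpha * dist s t `^ theta) * ((1 + C1 * E) * (S + rh)) <=
    C4 * (1 + q1) * (E * dist s t `^ theta) * ((1 + C1 * E) * (S + rh)).
  rewrite ler_wpM2r ?mulr_ge0 ?addr_ge0 // ler_wpM2l ?mulr_ge0 // ler_wpM2r //.
rewrite /del; move: B1 B2 B3; move: (p `^ theta) (dist s t `^ theta) (dist s t `^ alpha) => P D1 D2.
lra.
Qed.

Definition solution_pair X X' Y Y' (rh : R) : Prop :=
  [/\ (rp_norm X <= M%:E)%E, (rp_norm X' <= M%:E)%E, (rho X X' <= rh%:E)%E,
      has_expansion X Y & has_expansion X' Y'].

Lemma solution_pair_ge0 X X' Y Y' rh : solution_pair X X' Y Y' rh -> 0 <= rh.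
Proof.
by move=> [_ _ XX _ _]; rewrite -lee_fin; apply: le_trans XX; exact: rho_ge0.
Qed.

Lemma has_expansionB X X' Y Y' : has_expansion X Y -> has_expansion X' Y' ->
  exists2 q : R, 0 <= q & forall s t, `|J X Y s t - J X' Y' s t| <= q * dist s t `^ theta.
Proof.
move=> [q q0 Jq] [q' q'0 Jq']; exists (q + q') => [|s t]; first exact: addr_ge0.
by rewrite mulrDl; apply: le_trans (ler_normB _ _) _; exact: lerD.
Qed.

Lemma comparison_local : exists A h : R, [/\ 1 <= A, 0 < h &
  forall X X' Y Y' rh, solution_pair X X' Y Y' rh ->
  forall a t, sval a <= sval t <= sval a + h ->
    `|Y t - Y' t| <= A * `|Y a - Y' a| + A * rh].
Proof.
have [C1 [C10 I1 LI]] := increment_bound.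
have [C5 [C6 [C50 C60 H5]]] := difference_step.
have /andP[k0 k1] := kappa01 theta_gt1; set k := kappa theta in k0 k1.
have k10 : 0 < (1 - k) / 2 by rewrite divr_gt0 // subr_gt0.
have C56 : 0 <= C5 + C6 by rewrite addr_ge0.
(* Two feedbacks of the unknown constant are absorbed: [C5] from the comparison of increments, [C6]
   from the distance of the solutions, which depends on that constant through [sup] below. *)
have [h /andP[h0 h1] Hh] := small_power alpha_gt0 C56 k10.
have {}Hh : (C5 + C6) * h `^ alpha <= (1 - k) / 2 by apply: Hh; rewrite lexx ltW.
pose k' := (1 + k) / 2.
have k'01 : 0 < k' < 1 by apply/andP; rewrite /k'; split; lra.
have k'1 : 0 < 1 - k' by rewrite /k'; lra.
have C1E : 0 <= C1 * E by rewrite mulr_ge0.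
pose L := C6 * (2 + C1 * E) / (1 - k').
have L0 : 0 <= L.
  by apply: divr_ge0; [apply: mulr_ge0 => //; exact: addr_ge0|exact: ltW].
exists (1 + C1 * E + L), h; split => //; first by rewrite -addrA lerDl addr_ge0.
move=> X X' Y Y' rh XY; have rh0 := solution_pair_ge0 XY; case: XY => XM X'M XX eY eY'.
move=> a t at_; set D := `|Y a - Y' a|.
have D0 : 0 <= D by exact: normr_ge0.
pose I s := sval a <= sval s <= sval a + h.
have Ia : I a by rewrite /I lexx lerDl ltW.
have dI s t' : I s -> I t' -> dist s t' <= h.
  move=> /andP[s1 s2] /andP[t1 t2]; rewrite /dist ler_norml; apply/andP; split; lra.
have Imid s t' : I s -> I t' -> I (mid s t').
  by move=> /andP[s1 s2] /andP[t1 t2]; rewrite /I /=; apply/andP; split; lra.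
have XX1 : (rho X X' <= (D + rh)%:E)%E by apply: le_trans XX _; rewrite lee_fin lerDr.
have YS1 : `|Y a - Y' a| <= D + rh by rewrite lerDl.
(* A bound [q] on the difference of the remainders bounds the distance of the solutions on the
   window, with the small factor of order [alpha] in [h]. *)
have sup q s : 0 <= q -> (forall s t, I s -> I t -> dist s t <= h ->
        `|J X Y s t - J X' Y' s t| <= q * dist s t `^ theta) -> I s ->
    `|Y s - Y' s| <= (1 + C1 * E) * (D + rh) + q * h `^ alpha.
  move=> q0 Hq Is; have das := dI a s Ia Is.
  have -> : Y s - Y' s = (Y a - Y' a) + (inc (X a s) (Y a) - inc (X' a s) (Y' a)) +
      (J X Y a s - J X' Y' a s).
    rewrite -{1}(solution_stepE X Y a s) -{1}(solution_stepE X' Y' a s).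
    by rewrite !opprD (addrACA (Y a + _)) (addrACA (Y a)).
  apply: le_trans (ler_normD _ _) _; apply: lerD.
    apply: le_trans (ler_normD _ _) _; rewrite mulrDl mul1r; apply: lerD => //.
    apply: le_trans (LI _ _ _ _ _ a s (And4 XM X'M XX1 YS1)) _.
    rewrite ler_wpM2r ?addr_ge0 // ler_wpM2l //.
    exact: dist_alpha_le.
  apply: le_trans (Hq a s Ia Is das) _; rewrite ler_wpM2l //.
  by apply: powR_theta_alpha => //; rewrite dist_ge0.
pose b := C6 * ((2 + C1 * E) * (D + rh)).
have b0 : 0 <= b by rewrite mulr_ge0 // mulr_ge0 ?addr_ge0.
have diff := @sewing_bound _ k' b h I k'01 (has_expansionB eY eY') b0.
have step : forall q, 0 <= q ->
     (forall s t, I s -> I t -> dist s t <= h ->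
        `|J X Y s t - J X' Y' s t| <= q * dist s t `^ theta) ->
     forall s t, I s -> I t -> dist s t <= h ->
        `|J X Y s t - J X' Y' s t| <= (k' * q + b) * dist s t `^ theta.
  move=> q q0 Hq s v Is Iv sv.
  have Im := Imid s v Is Iv.
  have S1 := sup q s q0 Hq Is.
  have J1 := Hq s _ Is Im (dI _ _ Is Im); have J2 := Hq _ v Im Iv (dI _ _ Im Iv).
  have := H5 X X' Y Y' rh _ q s v XM X'M XX rh0 eY eY' S1 q0 J1 J2.
  move=> H; apply: le_trans H _; rewrite ler_wpM2r ?powR_ge0 //.
  have dh : C5 * dist s v `^ alpha * q <= C5 * h `^ alpha * q.
    by rewrite ler_wpM2r // ler_wpM2l // ler_powR_alpha ?dist_ge0.
  have Hq' : (C5 + C6) * h `^ alpha * q <= (1 - k) / 2 * q by rewrite ler_wpM2r.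
  have rC6 : C6 * rh <= C6 * (D + rh) by rewrite ler_wpM2l // lerDr.
  rewrite /b /k' -/k; move: (h `^ alpha) dh Hq' rC6 => H dh Hq' rC6; lra.
have {}diff := diff step.
have bk : 0 <= b / (1 - k') by rewrite divr_ge0 // ltW.
have := sup _ t bk diff at_; move=> H; apply: le_trans H _.
have hle : b / (1 - k') * h `^ alpha <= b / (1 - k').
  rewrite -[leRHS]mulr1 ler_wpM2l //.
  by apply: le_trans (ler_powR_alpha (ltW h0) h1) _; rewrite powR1.
have -> : (1 + C1 * E + L) * D + (1 + C1 * E + L) * rh =
   (1 + C1 * E) * (D + rh) + b / (1 - k') by rewrite /b /L; ring.
by rewrite lerD2l.
Qed.

Lemma comparison_sup : exists2 A : R, 0 <= A &
  forall X X' Y Y' rh, solution_pair X X' Y Y' rh ->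
  forall t, `|Y t - Y' t| <= A * (`|Y time0 - Y' time0| + rh).
Proof.
have [A [h [A1 h0 HA]]] := comparison_local; have [k Hk] := window_count T h0.
have A0 : 0 <= A by exact: le_trans A1.
exists (A ^+ k * (1 + k%:R * A)) => [|X X' Y Y' rh XY t].
  by rewrite mulr_ge0 ?exprn_ge0 // addr_ge0 // mulr_ge0.
have rh0 := solution_pair_ge0 XY.
have B0 : 0 <= A * rh by rewrite mulr_ge0.
have := @window_induct _ T (fun t => `|Y t - Y' t|) h A (A * rh) h0 A1 B0 (normr_ge0 _)
  (fun a t => HA X X' Y Y' rh XY a t) k t (Hk t).
move=> H; apply: le_trans H _; rewrite -mulrA ler_wpM2l ?exprn_ge0 //.
have D0 : 0 <= `|Y time0 - Y' time0| by [].
have kA : 0 <= k%:R * A by rewrite mulr_ge0.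
have kAD : 0 <= k%:R * A * `|Y time0 - Y' time0| by rewrite mulr_ge0.
by rewrite mulrA; lra.
Qed.

(** With the distance of the solutions already bounded on the whole interval, sewing applies to all
    pairs of close times, and only the feedback through [C5] remains to be absorbed. *)
Lemma comparison_remainder : exists2 A : R, 0 <= A &
  forall X X' Y Y' rh, solution_pair X X' Y Y' rh ->
  forall s t, `|J X Y s t - J X' Y' s t| <=
    A * (`|Y time0 - Y' time0| + rh) * dist s t `^ theta.
Proof.
have [A A0 HA] := comparison_sup.
have [C1 [C10 I1 LI]] := increment_bound.
have [C5 [C6 [C50 C60 H5]]] := difference_step.
have /andP[k0 k1] := kappa01 theta_gt1; set k := kappa theta in k0 k1.
have k10 : 0 < (1 - k) / 2 by rewrite divr_gt0 // subr_gt0.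
have [h /andP[h0 h1] Hh] := small_power alpha_gt0 C50 k10.
pose k' := (1 + k) / 2.
have k'01 : 0 < k' < 1 by apply/andP; rewrite /k'; split; lra.
have k'1 : 0 < 1 - k' by rewrite /k'; lra.
have C1E : 0 <= C1 * E by rewrite mulr_ge0.
pose L1 := C6 * (A + 1) / (1 - k').
have L10 : 0 <= L1.
  by apply: divr_ge0; [apply: mulr_ge0 => //; exact: addr_ge0|exact: ltW].
pose L2 := (2 * A + C1 * E * (A + 1)) / h `^ theta.
have L2' : 0 <= 2 * A + C1 * E * (A + 1) by rewrite addr_ge0 ?mulr_ge0 ?addr_ge0.
have L20 : 0 <= L2 by rewrite divr_ge0 ?powR_ge0.
exists (L1 + L2) => [|X X' Y Y' rh XY s t]; first by rewrite addr_ge0.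
have rh0 := solution_pair_ge0 XY; have Asup := HA X X' Y Y' rh XY.
case: XY => XM X'M XX eY eY'; set D := `|Y time0 - Y' time0| + rh in Asup *.
have D0 : 0 <= D by rewrite addr_ge0.
have rD : rh <= D by rewrite lerDr.
pose b := C6 * (A * D + D).
have b0 : 0 <= b by rewrite mulr_ge0 // addr_ge0 // mulr_ge0.
have Dth : 0 <= dist s t `^ theta by exact: powR_ge0.
have near : dist s t <= h -> `|J X Y s t - J X' Y' s t| <= L1 * D * dist s t `^ theta.
  move=> sth; have -> : L1 * D = b / (1 - k') by rewrite /L1 /b; ring.
  apply: (@sewing_bound _ k' b h (fun=> True) k'01 (has_expansionB eY eY')) => //.
  move=> q q0 Hq {Dth}s {sth}t _ _ sth.
  have [/andP[p0 ps] _] := power_half s t.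
  have J1 := Hq s (mid s t) I I; rewrite dist_midl in J1; have {}J1 := J1 (le_trans ps sth).
  have J2 := Hq (mid s t) t I I; rewrite dist_midr in J2; have {}J2 := J2 (le_trans ps sth).
  have := H5 X X' Y Y' rh (A * D) q s t XM X'M XX rh0 eY eY' (Asup s) q0.
  rewrite dist_midl dist_midr => /(_ J1 J2) H.
  apply: le_trans H _; rewrite ler_wpM2r ?powR_ge0 //.
  have dh : C5 * dist s t `^ alpha * q <= (1 - k) / 2 * q.
    by rewrite ler_wpM2r // Hh // dist_ge0.
  have rC6 : C6 * rh <= C6 * D by rewrite ler_wpM2l.
  by rewrite /b /k' -/k; lra.
rewrite mulrDl mulrDl; have [sth|sth] := leP (dist s t) h.
  by apply: le_trans (near sth) _; rewrite lerDl mulr_ge0 // mulr_ge0.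
apply: ler_wpDl; first by rewrite mulr_ge0 // mulr_ge0.
have -> : L2 * D = (2 * A + C1 * E * (A + 1)) * D / h `^ theta by rewrite /L2 mulrAC.
apply: power_far => //; [by rewrite mulr_ge0| |exact: ltW].
have XX1 : (rho X X' <= (A * D + D)%:E)%E.
  by apply: le_trans XX _; rewrite lee_fin ler_wpDl // mulr_ge0.
have YS1 : `|Y s - Y' s| <= A * D + D by apply: le_trans (Asup s) _; rewrite lerDl.
have I2 := LI _ _ _ _ _ s t (And4 XM X'M XX1 YS1).
have I2' : C1 * dist s t `^ alpha * (A * D + D) <= C1 * E * (A * D + D).
  by rewrite ler_wpM2r ?addr_ge0 ?mulr_ge0 // ler_wpM2l // dist_alpha_le.
rewrite !rde_remainderE.
have -> : Y t - Y s - inc (X s t) (Y s) - (Y' t - Y' s - inc (X' s t) (Y' s)) =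
    (Y t - Y' t) - (Y s - Y' s) - (inc (X s t) (Y s) - inc (X' s t) (Y' s)).
  by apply/rowP => j; rewrite !mxE; ring.
apply: le_trans (ler_normB _ _) _; apply: le_trans (lerD (ler_normB _ _) (lexx _)) _.
have := Asup s; have := Asup t; lra.
Qed.

(** * Existence of solutions by the Euler scheme *)

Section Existence.
Variables (X : rpath) (XM : (rp_norm X <= M%:E)%E) (xi : V).

Definition mesh (m : nat) : R := T%:num / m%:R.

Lemma grid_subproof m i : 0 <= Num.min T%:num (i%:R * mesh m) <= T%:num.
Proof.
by rewrite le_min ge_min lexx andbT ltW //= mulr_ge0 // divr_ge0 // ltW.
Qed.

(** The minimum makes the grid total in [i]; for [i <= m] it has no effect ([gridE]). *)
Definition grid m i : time T := exist _ (Num.min T%:num (i%:R * mesh m)) (grid_subproof m i).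

Fixpoint euler m k : V :=
  if k is k'.+1 then euler m k' + inc (X (grid m k') (grid m k)) (euler m k') else xi.

Definition cell m t : nat := Num.truncn (sval t / mesh m).

(** Piecewise constant: on the grid one step has zero remainder ([euler_step]), and inside a cell
    [J] is minus an increment. *)
Definition euler_path m t : V := euler m (cell m t).

Section Mesh.
Variable m : nat.
Hypothesis m0 : (0 < m)%N.
Local Notation eta := (mesh m).
Local Notation Y := (euler_path m).

Lemma mesh_gt0 : 0 < eta.
Proof. by rewrite divr_gt0 // ltr0n. Qed.

Lemma mesh_mul : m%:R * eta = T%:num.
Proof. by rewrite /mesh mulrCA mulfV ?mulr1 // pnatr_eq0 -lt0n. Qed.

Lemma gridE i : (i <= m)%N -> sval (grid m i) = i%:R * eta.
Proof.
move=> im /=; apply: min_r; rewrite -mesh_mul ler_wpM2r ?ler_nat //.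
exact: ltW mesh_gt0.
Qed.

Lemma cell_grid i : (i <= m)%N -> cell m (grid m i) = i.
Proof.
by move=> im; rewrite /cell gridE // mulfK ?natrK // gt_eqF ?mesh_gt0.
Qed.

Lemma cell_le t : (cell m t <= m)%N.
Proof.
rewrite /cell -[leqRHS](@natrK R) le_truncn // ler_pdivrMr ?mesh_gt0 // mesh_mul.
by case/andP: (time_le t).
Qed.

Lemma cell_itv t : sval (grid m (cell m t)) <= sval t < sval (grid m (cell m t)) + eta.
Proof.
rewrite gridE ?cell_le // /cell; have e0 := mesh_gt0.
have t0 : 0 <= sval t / eta.
  by apply: divr_ge0; [case/andP: (time_le t)|exact: ltW].
have /andP[h1] := truncn_itv t0.
by rewrite ltr_pdivrMr // -natr1 mulrDl mul1r -ler_pdivlMr // h1.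
Qed.

Lemma cell_mono s t : sval s <= sval t -> (cell m s <= cell m t)%N.
Proof. by move=> st; apply: le_truncn; rewrite ler_wpM2r // invr_ge0 ltW ?mesh_gt0. Qed.

Lemma dist_grid i j : (i <= j <= m)%N -> dist (grid m i) (grid m j) = (j - i)%:R * eta.
Proof.
move=> /andP[ij jm]; rewrite /dist !gridE ?(leq_trans ij) // -mulrBl -natrB //.
by rewrite ger0_norm // mulr_ge0 // ltW ?mesh_gt0.
Qed.

Lemma euler_path_grid i : (i <= m)%N -> Y (grid m i) = euler m i.
Proof. by move=> im; rewrite /euler_path cell_grid. Qed.

Lemma euler_path_cell t : Y t = Y (grid m (cell m t)).
Proof. by rewrite [RHS]/euler_path cell_grid ?cell_le. Qed.

Lemma euler_step i : (i < m)%N -> J X Y (grid m i) (grid m i.+1) = 0.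
Proof.
move=> im; rewrite rde_remainderE !euler_path_grid ?(ltnW im) //=.
by rewrite [euler m i + _]addrC addrK subrr.
Qed.

End Mesh.

(** Since [J] vanishes over a single cell, induction on the number of cells takes the place of the
    infimum argument, and the constant does not depend on the mesh. *)
Lemma euler_sewing : exists L h : R, [/\ 0 <= L, 0 < h <= 1 &
  forall m i j, (0 < m)%N -> (i <= j <= m)%N -> (j - i)%:R * mesh m <= h ->
    `|J X (euler_path m) (grid m i) (grid m j)| <= L * ((j - i)%:R * mesh m) `^ theta].
Proof.
have [C1 [C2 [C10 C20 /(_ X XM)[_ _ split_step]]]] := remainder_split.
have th1 := theta_gt1.
have /andP[k0 k1] := kappa01 th1; set k := kappa theta in k0 k1.
have k10 : 0 < (1 - k) / 2 by rewrite divr_gt0 // subr_gt0.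
have [h h01 Hh] := small_power alpha_gt0 C10 k10.
(* The solution of [(k + (1 - k) / 2) * L + C2 = L], so that the induction step reproduces [L]. *)
pose L := 2 * C2 / (1 - k).
have k1' : 0 < 1 - k by rewrite subr_gt0.
have L0 : 0 <= L by apply: divr_ge0; [exact: mulr_ge0|exact: ltW].
exists L, h; split=> // m i j m0; have e0 := mesh_gt0 m0.
have [l] := ubnP (j - i); elim: l i j => // l IHl i j jil /andP[ij jm] jih.
have [ji|ji] := leqP (j - i) 1.
  have [E0|E0] := eqVneq i j.
    by rewrite E0 rde_remainder_diag // normr0 mulr_ge0 // powR_ge0.
  have jE : j = i.+1 by clear -ij ji E0; lia.
  by rewrite jE euler_step -?jE // normr0 mulr_ge0 // powR_ge0.
(* With at least two cells, both parts are nonempty and have at most two thirds of the cells, the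
   extreme case being three cells. *)
pose a := ((j - i) %/ 2)%N; pose u := (i + a)%N.
have [a1 [u1 u2]] : (0 < a)%N /\ (i <= u)%N /\ (u <= j)%N by rewrite /u /a; clear -ij ji; lia.
have iu : (i <= u <= m)%N by rewrite u1 (leq_trans u2).
have uj : (u <= j <= m)%N by rewrite u2.
have ijm : (i <= j <= m)%N by rewrite ij.
pose A := (u - i)%:R * mesh m; pose B := (j - u)%:R * mesh m; pose D := (j - i)%:R * mesh m.
have ABD : A + B = D by rewrite /A /B /D -mulrDl -natrD; congr (_%:R * _); clear -u1 u2; lia.
have A0 : 0 <= A by rewrite mulr_ge0 // ltW.
have B0 : 0 <= B by rewrite mulr_ge0 // ltW.
have AD : A <= D by rewrite -ABD lerDl.
have BD : B <= D by rewrite -ABD lerDr.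
have frac (p : nat) : (3 * p <= 2 * (j - i))%N -> p%:R * mesh m <= 2 / 3 * D.
  move=> p3; rewrite /D [leRHS]mulrA; apply: ler_wpM2r; first exact: ltW.
  have : (3 * p)%:R <= (2 * (j - i))%:R :> R by rewrite ler_nat.
  by rewrite !natrM; lra.
have dA : dist (grid m i) (grid m u) = A by rewrite dist_grid.
have dB : dist (grid m u) (grid m j) = B by rewrite dist_grid.
have J1 : `|J X (euler_path m) (grid m i) (grid m u)| <= L * A `^ theta.
  by apply: IHl => //; [rewrite /u /a; clear -ij ji jil; lia|exact: le_trans jih].
have J2 : `|J X (euler_path m) (grid m u) (grid m j)| <= L * B `^ theta.
  by apply: IHl => //; [rewrite /u /a; clear -ij ji jil; lia|exact: le_trans jih].
have /= := split_step (euler_path m) (grid m i) (grid m u) (grid m j).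
rewrite dA dB addrA => -[H _]; apply: le_trans H _; rewrite -/D.
have P1 : A `^ theta + B `^ theta <= k * D `^ theta.
  apply: split_power => //; rewrite ?A0 ?B0 /=; apply: frac; rewrite /u /a; clear -ij ji; lia.
have P2 : Num.max A B `^ theta <= D `^ theta.
  by apply: (ler_powR_theta); rewrite ?le_max ?A0 // ge_max AD BD.
have P3 : C1 * B `^ alpha * `|J X (euler_path m) (grid m i) (grid m u)| <=
    (1 - k) / 2 * (L * D `^ theta).
  apply: ler_pM => //; first by rewrite mulr_ge0 // powR_ge0.
    by apply: Hh; rewrite B0 (le_trans BD).
  by apply: le_trans J1 _; rewrite ler_wpM2l // (ler_powR_theta).
have P4 : L * (A `^ theta + B `^ theta) <= L * (k * D `^ theta) by rewrite ler_wpM2l.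
have P5 : C2 * Num.max A B `^ theta <= C2 * D `^ theta by rewrite ler_wpM2l.
have LE : C2 = (1 - k) / 2 * L by rewrite /L; field; rewrite gt_eqF.
have P6 : C2 * D `^ theta = (1 - k) / 2 * L * D `^ theta by rewrite -LE.
move: J1 J2 P3 P4 P5 P6; move: (A `^ theta) (B `^ theta) (D `^ theta) => A' B' D'.
lra.
Qed.

Lemma euler_path_split s t m : (0 < m)%N -> sval s <= sval t ->
  let gs := grid m (cell m s) in let gt := grid m (cell m t) in
  [/\ dist gs s <= mesh m, dist gt t <= mesh m, dist gs gt <= dist s t + mesh m &
    dist gs gt = (cell m t - cell m s)%:R * mesh m].
Proof.
move=> m0 st gs gt; have /andP[s1 s2] := cell_itv m0 s; have /andP[t1 t2] := cell_itv m0 t.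
have e0 := mesh_gt0 m0.
have st' : (cell m s <= cell m t <= m)%N by rewrite cell_mono // cell_le.
have sg : sval gs <= sval gt.
  by rewrite !gridE ?cell_le // ler_wpM2r ?ler_nat ?cell_mono // ltW.
rewrite -/gs in s1 s2; rewrite -/gt in t1 t2.
split; last exact: dist_grid.
- by rewrite /dist ger0_norm; lra.
- by rewrite /dist ger0_norm; lra.
- by rewrite /dist !ger0_norm; lra.
Qed.

(** Each time is replaced by the grid point below it. The path is constant in between, so the price
    is the power [alpha] of the mesh, which disappears in the limit. *)
Lemma euler_expansion : exists Q P h : R, [/\ 0 <= Q, 0 <= P, 0 < h <= 1 &
  forall m s t, (0 < m)%N -> sval s <= sval t -> mesh m <= dist s t -> dist s t <= h ->
    `|J X (euler_path m) s t| <= Q * dist s t `^ theta + P * mesh m `^ alpha].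
Proof.
have [C1 [C2 [C10 C20 /(_ X XM)[I1 _ split_step]]]] := remainder_split.
have [L [h [L0 h01 HL]]] := euler_sewing.
have C1E : 0 <= C1 * E by rewrite mulr_ge0.
pose b := 2 `^ theta : R; have b0 : 0 <= b := powR_ge0 _ _.
(* The grid points can be as far apart as [2 * dist s t], hence [h / 2] and the factor [b]. *)
exists (((1 + C1 * E) * L + 2 * C2) * b), (C1 * (2 + C1 * E)), (h / 2); split.
- by rewrite mulr_ge0 // addr_ge0 // mulr_ge0 // addr_ge0.
- by rewrite mulr_ge0 // addr_ge0.
- by case/andP: h01 => h0 h1; apply/andP; split; lra.
move=> m s t m0 st etast sth; have [] := euler_path_split m0 st.
set gs := grid m _; set gt := grid m _ => dgs dgt dgg gggE.
set Y := euler_path m; have e0 := mesh_gt0 m0; have D0 := dist_ge0 s t.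
have Ys : Y gs = Y s := esym (euler_path_cell m0 s).
have Yt : Y gt = Y t := esym (euler_path_cell m0 t).
have near u v : Y u = Y v -> dist u v <= mesh m -> `|J X Y u v| <= C1 * mesh m `^ alpha.
  move=> uv duv; rewrite rde_remainderE uv subrr sub0r normrN.
  by apply: le_trans (I1 _ _ _) _; rewrite ler_wpM2l // ler_powR_alpha ?dist_ge0.
have J1 := near _ _ Ys dgs; have J2 := near _ _ Yt dgt.
pose D := 2 * dist s t.
have DE : D `^ theta = b * dist s t `^ theta by rewrite powRM.
have max_le (x y : R) : 0 <= x <= D -> y <= D -> Num.max x y `^ theta <= D `^ theta.
  by move=> /andP[x0 xD] yD; apply: (ler_powR_theta); rewrite ?le_max ?x0 // ge_max xD.
have [dD mD] : dist s t <= D /\ mesh m <= D by rewrite /D; split; lra.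
have ggD : dist gs gt <= D by rewrite /D; lra.
have J3 : `|J X Y gs gt| <= L * D `^ theta.
  apply: (le_trans (HL m _ _ m0 _ _)).
  - by rewrite cell_mono ?cell_le.
  - by rewrite -gggE (le_trans ggD) // /D; lra.
  - by rewrite -gggE ler_wpM2l // (ler_powR_theta) ?dist_ge0.
have [/= H1 _] := split_step Y gs gt t; have [/= _ H2] := split_step Y gs s t.
have P1 : C1 * dist gt t `^ alpha * `|J X Y gs gt| <= C1 * E * (L * D `^ theta).
  by apply: ler_pM; rewrite ?mulr_ge0 ?powR_ge0 // ler_wpM2l // dist_alpha_le.
have P2 : C1 * dist s t `^ alpha * `|J X Y gs s| <= C1 * E * (C1 * mesh m `^ alpha).
  by apply: ler_pM; rewrite ?mulr_ge0 ?powR_ge0 // ler_wpM2l // dist_alpha_le.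
have P3 : C2 * Num.max (dist gs gt) (dist gt t) `^ theta <= C2 * D `^ theta.
  by rewrite ler_wpM2l // max_le ?dist_ge0 //; exact: le_trans mD.
have P4 : C2 * Num.max (dist gs s) (dist s t) `^ theta <= C2 * D `^ theta.
  by rewrite ler_wpM2l // max_le ?dist_ge0 //; exact: le_trans mD.
have -> : ((1 + C1 * E) * L + 2 * C2) * b * dist s t `^ theta =
    ((1 + C1 * E) * L + 2 * C2) * D `^ theta by rewrite DE mulrA.
move: H1 H2 P1 P2 P3 P4 J1 J2 J3; rewrite -/Y.
move: (D `^ theta) (mesh m `^ alpha) `|J X Y s t| `|J X Y gs s| `|J X Y gs t|
  `|J X Y gs gt| `|J X Y gt t| => p q x1 x2 x3 x4 x5.
lra.
Qed.

Lemma euler_bounded : exists B h : R, [/\ 0 <= B, 0 < h &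
  forall m t, (0 < m)%N -> mesh m <= h -> `|euler_path m t| <= B].
Proof.
have [C1 [C2 [C10 C20 /(_ X XM)[I1 _ _]]]] := remainder_split.
have [L [h [L0 /andP[h0 h1] HL]]] := euler_sewing.
have h2 : 0 < h / 2 by rewrite divr_gt0.
have [k Hk] := window_count T h2.
pose b := C1 * E + L; have b0 : 0 <= b by rewrite addr_ge0 // mulr_ge0.
exists (1 ^+ k * (`|xi| + k%:R * b)), (h / 2); split=> //.
  by rewrite expr1n mul1r addr_ge0 // mulr_ge0.
move=> m t m0 mh.
have Y0 : euler_path m time0 = xi.
  by rewrite /euler_path /cell mul0r /= truncn0.
rewrite -Y0; apply: (@window_induct _ T (fun t => `|euler_path m t|) (h / 2) 1 b) => //.
move=> a u au; have /andP[au1 _] := au; have [_ _ dgg gggE] := euler_path_split m0 au1.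
have dau := dist_window au; rewrite mul1r.
rewrite (euler_path_cell m0 u) (euler_path_cell m0 a).
set ga := grid m _ in dgg gggE *; set gu := grid m _ in dgg gggE *.
rewrite -[X in `|X| <= _](subrK (euler_path m ga)) (solution_diffE X) addrC.
apply: le_trans (ler_normD _ _) _; rewrite lerD2l.
apply: le_trans (ler_normD _ _) _; apply: lerD.
  by apply: le_trans (I1 _ _ _) _; rewrite ler_wpM2l // dist_alpha_le.
have ggh : (cell m u - cell m a)%:R * mesh m <= h by rewrite -gggE; lra.
apply: le_trans (HL m _ _ m0 _ ggh) _; first by rewrite cell_mono ?cell_le.
rewrite -gggE -[leRHS]mulr1 ler_wpM2l // (powR_theta_le1) // dist_ge0 /=; lra.
Qed.

Lemma mesh_small (e : R) : 0 < e -> exists m0, forall m, (m0 <= m)%N -> (0 < m)%N /\ mesh m <= e.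
Proof.
move=> e0; exists (Num.truncn (T%:num / e)).+1 => m le_m.
have m0 : (0 < m)%N by apply: leq_trans le_m.
split=> //; rewrite /mesh ler_pdivrMr ?ltr0n // mulrC -ler_pdivrMr //.
by apply: ltW; apply: lt_le_trans (truncnS_gt _) _; rewrite ler_nat.
Qed.

(** A cluster point in a product of closed balls, compact by Tychonoff's theorem. Two times are
    approximated by the same [m], which is what [J] at one pair of times requires; [m] may vary with
    the pair. *)
Lemma euler_limit : exists Y : time T -> V, forall s t (e : R) m0, 0 < e ->
  exists2 m, (m0 <= m)%N & `|Y s - euler_path m s| < e /\ `|Y t - euler_path m t| < e.
Proof.
have [B [h [B0 h0 HB]]] := euler_bounded.
pose ball_cpt := [set y : V | `|y| <= B].
have cpt : compact ball_cpt.
  apply: bounded_closed_compact.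
    exists B; split; first exact: num_real.
    by move=> x Bx y /= yB; apply: le_trans yB (ltW Bx).
  by rewrite (_ : ball_cpt = (fun y : V => `|y|) @^-1` [set x : R | x <= B]) //;
    apply: preimage_closed; [move=> *; exact: norm_continuous|exact: closed_le].
have := @tychonoff (time T) (fun=> V) (fun=> ball_cpt) (fun=> cpt).
set A := [set _ | _] => cptA.
have FA : ((fun m => euler_path m : prod_topology (fun _ : time T => V)) @ \oo) A.
  have [m0 Hm0] := mesh_small h0.
  by exists m0 => // m /= /Hm0[? ?] t; exact: HB.
have [Y [_ clY]] := cptA _ _ FA.
exists Y => s t e m0 e0.
have near_pt u : nbhs (Y : prod_topology (fun _ : time T => V)) [set Z | `|Y u - Z u| < e].
  apply: (@proj_continuous (time T) (fun=> V) u Y [set z | `|Y u - z| < e]).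
  by apply/nbhs_ballP; exists e => // z; rewrite -ball_normE.
have near_st := @filterI _ _ (nbhs_filter (Y : prod_topology (fun _ : time T => V))) _ _
  (near_pt s) (near_pt t).
have [|Z [[m le_m <-] [sZ tZ]]] := clY [set euler_path m | m in [set m | (m0 <= m)%N]] _ _ near_st.
  by exists m0 => // m le_m; exists m.
by exists m.
Qed.

Lemma euler_limit_solution : exists2 Y, Y time0 = xi & has_expansion X Y.
Proof.
have [Y limY] := euler_limit.
have [C1 [C2 [C10 C20 /(_ X XM)[I1 I2 split_step]]]] := remainder_split.
have [Q [P [h [Q0 P0 /andP[h0 h1] HQ]]]] := euler_expansion.
have [B [h' [B0 h'0 HB]]] := euler_bounded.
have C1E : 0 <= C1 * E by rewrite mulr_ge0.
have small e s t : 0 < e -> exists m, [/\ (0 < m)%N, mesh m <= e,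
    `|Y s - euler_path m s| < e & `|Y t - euler_path m t| < e].
  move=> e0; have [m0 Hm] := mesh_small e0.
  by have [m /Hm[? ?] [? ?]] := limY s t e m0 e0; exists m.
have YB t : `|Y t| <= B + h'.
  have [m [m0 mh Ht _]] := small h' t t h'0.
  rewrite -[Y t](subrK (euler_path m t)) addrC.
  by apply: le_trans (ler_normD _ _) _; rewrite lerD ?HB // ltW.
have fwd s t : sval s < sval t -> dist s t <= h -> `|J X Y s t| <= Q * dist s t `^ theta.
  move=> st sth; rewrite -[leRHS]addr0; apply/ler_addgt0Pr => e e0; rewrite addr0.
  have st0 : 0 < dist s t by rewrite /dist normr_gt0 subr_eq0 gt_eqF.
  (* Half of [e] is for the mesh term. The other half is for replacing [Y] by the Euler path, which
     costs [c] times the pointwise error: 1 for each endpoint and [C1 * E] for the increment. *)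
  have e2 : 0 < e / 2 by rewrite divr_gt0.
  have [g /andP[g0 _] Hg] := small_power alpha_gt0 P0 e2.
  pose c := 2 + C1 * E; have c0 : 0 < c by rewrite ltr_wpDr.
  have ec : 0 < e / 2 / c by rewrite divr_gt0.
  have m3 : 0 < Num.min (Num.min g (dist s t)) (e / 2 / c) by rewrite !lt_min g0 st0.
  have [m [m0]] := small _ s t m3; rewrite le_min le_min !lt_min -!andbA.
  move=> /and3P[mg mst _] /and3P[_ _ Hs] /and3P[_ _ Ht].
  have J1 := HQ m s t m0 (ltW st) mst sth.
  have P1 : P * mesh m `^ alpha <= e / 2 by apply: Hg; rewrite mg ltW ?mesh_gt0.
  set Z := euler_path m in Hs Ht J1.
  have -> : J X Y s t = J X Z s t + ((Y t - Z t) - (Y s - Z s) -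
      (inc (X s t) (Y s) - inc (X s t) (Z s))).
    rewrite !rde_remainderE; move: (inc _ _) (inc _ _) => a b.
    by apply/rowP => j; rewrite !mxE; ring.
  have I : `|inc (X s t) (Y s) - inc (X s t) (Z s)| <= C1 * E * (e / 2 / c).
    apply: le_trans (I2 _ _ _ _) _; apply: ler_pM => //; rewrite ?mulr_ge0 ?powR_ge0 //.
      by rewrite ler_wpM2l // dist_alpha_le.
    exact: ltW.
  have ce : c * (e / 2 / c) = e / 2 by rewrite mulrC divfK // gt_eqF.
  apply: le_trans (ler_normD _ _) _; have N3 := ler_normB (Y t - Z t - (Y s - Z s))
    (inc (X s t) (Y s) - inc (X s t) (Z s)).
  have N2 := ler_normB (Y t - Z t) (Y s - Z s).
  move: ce; rewrite /c mulrDl; lra.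
(* Backwards in time, the loop from [t] through [s] to [t] is split: [J] vanishes over the whole
   loop, and its first half is a forward interval. *)
have bwd s t : sval t < sval s -> dist s t <= h ->
    `|J X Y s t| <= ((1 + C1 * E) * Q + C2) * dist s t `^ theta.
  move=> ts sth; have J1 := fwd t s ts; rewrite dist_sym in J1; move/(_ sth) in J1.
  have [_ /=] := split_step Y t s t; rewrite rde_remainder_diag normr0 add0r => H.
  apply: le_trans H _; rewrite [dist t s]dist_sym maxxx !mulrDl addrA lerD2r mul1r lerD //.
  rewrite -[leRHS]mulrA; apply: ler_pM => //; rewrite ?mulr_ge0 ?powR_ge0 //.
  by rewrite ler_wpM2l // dist_alpha_le.
exists Y.
  apply/eqP; rewrite -subr_eq0 -normr_le0; apply/ler_addgt0Pr => e e0; rewrite add0r.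
  have [m [m0 _ H _]] := small e time0 time0 e0.
  by move: H; rewrite /euler_path /cell mul0r /= truncn0 => /ltW.
pose q := (1 + C1 * E) * Q + C2; pose b := 2 * (B + h') + C1 * E.
have q0 : 0 <= q by rewrite addr_ge0 // mulr_ge0 // addr_ge0.
have b0 : 0 <= b by rewrite addr_ge0 // mulr_ge0 // addr_ge0 // ltW.
have bh0 : 0 <= b / h `^ theta by rewrite divr_ge0 ?powR_ge0.
exists (q + b / h `^ theta) => [|s t]; first exact: addr_ge0.
have [sth|sth] := leP (dist s t) h; last first.
  rewrite mulrDl; apply: ler_wpDl; first by rewrite mulr_ge0 ?powR_ge0.
  apply: (power_far) => //; last exact: ltW.
  rewrite rde_remainderE /b; apply: le_trans (ler_normB _ _) _.
  have := ler_normB (Y t) (Y s); have := YB s; have := YB t; have := I1 s t (Y s).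
  have : C1 * dist s t `^ alpha <= C1 * E by rewrite ler_wpM2l // dist_alpha_le.
  lra.
have Qq : Q <= q by rewrite /q mulrDl mul1r -addrA lerDl addr_ge0 // mulr_ge0.
have Dth := powR_ge0 (dist s t) theta.
have [st|ts|/time_inj ->] := ltgtP (sval s) (sval t).
- apply: le_trans (fwd s t st sth) _; rewrite ler_wpM2r //; lra.
- apply: le_trans (bwd s t ts sth) _; rewrite ler_wpM2r // -/q; lra.
- by rewrite rde_remainder_diag normr0 mulr_ge0 ?powR_ge0 // addr_ge0.
Qed.

End Existence.
End Solutions.

(** * The Ito-Lyons map *)

Section ItoLyons.
Variables (R : realType) (d n : nat) (T : {posnum R}) (alpha : R).
Hypothesis alpha01 : 0 < alpha < 1.
Local Notation rpath := (rough_path d T alpha).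
Local Notation N := (level alpha).
Local Notation V := 'rV[R]_n.
Local Notation theta := (N.+1%:R * alpha).
Implicit Types (X : rpath) (Z : coef_path d n T alpha) (s t : time T).

Lemma rp_norm_fin X : exists M : R, (rp_norm X <= M%:E)%E.
Proof.
have : (rp_norm X < +oo)%E.
  rewrite /rp_norm; elim/big_ind: _ => [||h _]; first exact: ltry.
    by move=> x y xoo yoo; rewrite gt_max xoo.
  by rewrite mulrC; exact: rp_holder.
by case: (rp_norm X) => [r _|//|_]; [exists r|exists 0; rewrite leNye].
Qed.

Lemma rp_norm_le X X' (m r : R) : (rp_norm X <= m%:E)%E -> (rho X X' <= r%:E)%E ->
  (rp_norm X' <= (m + r)%:E)%E.
Proof.
move=> XM XX; have m0 : (0 <= m%:E)%E.
  by apply: le_trans XM; rewrite /rp_norm; elim/big_rec: _ => // h x _ x0; rewrite le_max x0 orbT.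
have r0 : (0 <= r%:E)%E by apply: le_trans XX; exact: rho_ge0.
rewrite /rp_norm; elim/big_ind: _ => [|x y xl yl|h h1].
- by rewrite EFinD adde_ge0.
- by rewrite ge_max xl.
have hN : (fsize (val h) <= N)%N by rewrite -mem_forests_upto; exact: ssvalP.
apply: hnorm_le => s t st; rewrite -[X' s t _](subKr (X s t (val h))).
apply: le_trans (ler_normB _ _) _; rewrite mulrDl; apply: lerD.
  exact: (hnorm_bound (bigmax_forest_le
    (F := fun h => hnorm ((fsize h)%:R * alpha) (fun s t => X s t h)) XM hN h1)).
exact: (hnorm_bound (bigmax_forest_le
  (F := fun h => hnorm ((fsize h)%:R * alpha) (fun s t => X s t h - X' s t h)) XX hN h1)).
Qed.

Lemma cp_dist_le (gamma a b : R) X X' Z Z' :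
  (forall h, `|Z time0 h - Z' time0 h| <= a) ->
  (forall h s t, `|remainder X Z h s t - remainder X' Z' h s t| <=
     b * dist s t `^ ((N - fsize (val h))%:R * gamma)) ->
  (cp_dist gamma X Z X' Z' <= ((a + b) *+ #|{: 'F_(d; N.-1)}|)%:E)%E.
Proof.
move=> Za rb; rewrite -sumr_const -sumEFin; apply: lee_sum => h _.
by rewrite EFinD; apply: leeD; [rewrite lee_fin|apply: hnorm_le].
Qed.

Lemma controlledP X Z (b : R) :
  (forall h s t, `|remainder X Z h s t| <= b * dist s t `^ ((N - fsize (val h))%:R * alpha)) ->
  controlled X Z.
Proof.
move=> rb; apply: lte_sum_pinfty => h _; apply: lte_add_pinfty; first exact: ltry.
by apply: le_lt_trans (ltry b); apply: hnorm_le.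
Qed.

(** Lowers the Hoelder exponent from [alpha] to [beta]. The factor accounts for [T] larger than 1,
    and [x = 0] is treated apart because the power 0 of 0 is 1. *)
Lemma powR_exponent_le (x a b : R) k : 0 <= x <= T%:num -> 0 <= b <= a -> a <= 1 -> (k <= N)%N ->
  x `^ (k%:R * a) <= (1 + T%:num) `^ N%:R * x `^ (k%:R * b).
Proof.
move=> /andP[x0 xT] /andP[b0 ba] a1 kN.
have [->|x_neq0] := eqVneq x 0.
  have [ka|ka] := eqVneq (k%:R * a) 0; last by rewrite powR0 // mulr_ge0 ?powR_ge0.
  have -> : k%:R * b = 0.
    by apply/eqP; rewrite eq_le mulr_ge0 // andbT -ka ler_wpM2l.
  rewrite ka powRr0 mulr1; apply: (@le_trans _ _ (1 `^ N%:R)); first by rewrite powR1.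
  by rewrite ge0_ler_powR ?nnegrE ?addr_ge0 // lerDl.
have -> : k%:R * a = k%:R * (a - b) + k%:R * b by rewrite -mulrDr subrK.
rewrite powRD ?x_neq0 ?implybT // ler_wpM2r ?powR_ge0 //.
have ab : 0 <= k%:R * (a - b) by rewrite mulr_ge0 // subr_ge0.
apply: (@le_trans _ _ ((1 + T%:num) `^ (k%:R * (a - b)))).
  by rewrite ge0_ler_powR ?nnegrE ?addr_ge0 // (le_trans xT) // lerDr.
apply: ler_powR; first by rewrite lerDl.
apply: (@le_trans _ _ k%:R); last by rewrite ler_nat.
by rewrite -[leRHS]mulr1 ler_wpM2l // lerBlDr (le_trans a1) // lerDl.
Qed.

Variable f : 'I_d -> V -> V.
Hypothesis smooth_f : forall i, smooth (f i).
Hypothesis bounded_f : forall i, bounded_derivatives N.+1 (f i).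

Lemma uniform_derivative_bound : exists2 K : R, 0 <= K & forall i vs y, (size vs <= N.+1)%N ->
  `|iter_diff (f i) vs y| <= K * norm_prod vs.
Proof.
have [K HK] := choice bounded_f.
exists (\sum_i `|K i|) => [|i vs y vsN]; first exact: sumr_ge0.
apply: le_trans (iter_diff_le (smooth_f i) (HK i) y vsN) _.
apply: ler_wpM2r; first by rewrite /norm_prod prodr_ge0.
by apply: le_trans (ler_norm _) _; rewrite (bigD1 i) //= lerDl sumr_ge0.
Qed.

Lemma lift_lipschitz : exists2 C : R, 0 <= C & forall (Y Y' : time T -> V) t (h : 'F_(d; N.-1)),
  `|lift_solution f Y t h - lift_solution f Y' t h| <= C * `|Y t - Y' t|.
Proof.
have [K K_ge0 f_le] := uniform_derivative_bound.
pose Om := (V * V)%type; pose del (om : Om) := `|om.1 - om.2|.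
pose z (om : Om) (b : bool) := if b then om.1 else om.2.
have zL : lip del z by exists 1 => // om; rewrite mul1r.
have elem_lip (h : forest d) : (fsize h <= N.+1)%N ->
    exists2 C : R, 0 <= C & forall y y', `|elem_diff f h y - elem_diff f h y'| <= C * `|y - y'|.
  rewrite /elem_diff /fsize; case: (planar h) => [|u [|v s]] hN.
  - by exists 1 => // y y'; rewrite mul1r.
  - have uN : (tsize u <= N.+1)%N by move: hN; rewrite /= addn0.
    have [C C0 HC] := lipO_td smooth_f K_ge0 f_le (fun om => normr_ge0 _) zL uN.
    by exists C => // y y'; have [_] := HC (y, y'); rewrite /= mulr1.
  - by exists 0 => // y y'; rewrite subrr normr0 mul0r.
have lift_lip (h : 'F_(d; N.-1)) : exists C : R, 0 <= C /\ forall (Y Y' : time T -> V) t,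
    `|lift_solution f Y t h - lift_solution f Y' t h| <= C * `|Y t - Y' t|.
  have hN : (fsize (val h) <= N.+1)%N.
    have := ssvalP h; rewrite mem_forests_upto => /leq_trans; apply.
    by rewrite (leq_trans (leq_pred _)).
  have [C C0 HC] := elem_lip _ hN; exists ((sigma (val h))%:R^-1 * C).
  have s0 : 0 <= (sigma (val h))%:R^-1 :> R by rewrite invr_ge0.
  split=> [|Y Y' t]; first exact: mulr_ge0.
  rewrite /lift_solution; case: ifP => _; last first.
    by rewrite subrr normr0 !mulr_ge0.
  by rewrite -scalerBr normrZ ger0_norm // -mulrA ler_wpM2l.
have [C HC] := choice lift_lip; have C0 h : 0 <= C h by case: (HC h).
exists (\sum_h C h) => [|Y Y' t h]; first exact: sumr_ge0.
have [_ /(_ Y Y' t) H] := HC h; apply: le_trans H _.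
by rewrite ler_wpM2r // (bigD1 h) //= lerDl sumr_ge0.
Qed.

Lemma has_expansion_controlled X Y : has_expansion f X Y -> controlled X (lift_solution f Y).
Proof.
move=> [q q0 Hq]; have [M XM] := rp_norm_fin X.
have [K K_ge0 f_le] := uniform_derivative_bound.
have [C C0 HC] := @lift_remainder_bound R d n T alpha alpha01 f K smooth_f K_ge0 f_le M q q0.
apply: (@controlledP _ _ C) => h s t.
(* The solution is compared with itself, at distance 0; only the size estimate is used. *)
have [|] := HC X X Y Y 0 h s t; last by [].
split=> //; first exact: close_refl.
by rewrite subrr normr0 mulr0.
Qed.

Lemma rde_solutionP xi X Y :
  rde_solution f xi X Y <-> Y time0 = xi /\ has_expansion f X Y.
Proof.
split=> [[Y0 Joo _]|[Y0 eY]].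
  split=> //; have [C HC] := hnorm_fin Joo.
  exists `|C| => // s t; have [->|st] := pselect (s = t).
    by rewrite rde_remainder_diag normr0 mulr_ge0 ?powR_ge0.
  by apply: le_trans (HC s t st) _; rewrite ler_wpM2r ?powR_ge0 // ler_norm.
split=> //; last exact: has_expansion_controlled.
by have [q q0 Hq] := eY; apply: le_lt_trans (ltry q); apply: hnorm_le.
Qed.

(** Existence rules out the default value of [xget]. The comparison estimates then apply to
    whichever solution was chosen. *)
Lemma ito_lyonsP xi X : exists Y, [/\ Y time0 = xi, has_expansion f X Y &
  ito_lyons_path f xi X = lift_solution f Y].
Proof.
have [K K_ge0 f_le] := uniform_derivative_bound; have [M XM] := rp_norm_fin X.
have [Y0 Y00 eY0] := euler_limit_solution alpha01 smooth_f K_ge0 f_le XM xi.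
rewrite /ito_lyons_path; case: xgetP => [Z _ [Y /rde_solutionP[Yxi eY] <-]|/(_ (lift_solution f Y0))].
  by exists Y.
by case; exists Y0 => //; exact/rde_solutionP.
Qed.

Lemma ito_lyons_difference (M : R) : exists2 C : R, 0 <= C &
  forall xi xi' X X' (rh : R), (rp_norm X <= M%:E)%E -> (rp_norm X' <= M%:E)%E ->
  (rho X X' <= rh%:E)%E ->
  (forall h, `|ito_lyons_path f xi X time0 h - ito_lyons_path f xi' X' time0 h| <=
     C * (`|xi - xi'| + rh)) /\
  forall h s t, `|remainder X (ito_lyons_path f xi X) h s t -
      remainder X' (ito_lyons_path f xi' X') h s t| <=
    C * (`|xi - xi'| + rh) * dist s t `^ ((N - fsize (val h))%:R * alpha).
Proof.
have [K K_ge0 f_le] := uniform_derivative_bound.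
have [A A0 HA] := @comparison_sup R d n T alpha alpha01 f K smooth_f K_ge0 f_le M.
have [A' A'0 HA'] := @comparison_remainder R d n T alpha alpha01 f K smooth_f K_ge0 f_le M.
have [q q0 Hq] := @expansion_bound R d n T alpha alpha01 f K smooth_f K_ge0 f_le M.
(* [comparable] asks for one constant, valid for the two remainders and for their difference. *)
have qA : 0 <= q + A' by rewrite addr_ge0.
have [C C0 HC] := @lift_remainder_bound R d n T alpha alpha01 f K smooth_f K_ge0 f_le M _ qA.
have [L L0 HL] := lift_lipschitz.
have A1 : 0 <= 1 + A by rewrite addr_ge0.
exists (L + C * (1 + A)) => [|xi xi' X X' rh XM X'M XX]; first by rewrite addr_ge0 ?mulr_ge0.
have [Y [Y0 eY ->]] := ito_lyonsP xi X; have [Y' [Y'0 eY' ->]] := ito_lyonsP xi' X'.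
have XY : solution_pair f M X X' Y Y' rh by split.
have rh0 := solution_pair_ge0 XY.
set del := `|xi - xi'| + rh; have del0 : 0 <= del by rewrite addr_ge0.
have Adel : del <= (1 + A) * del by rewrite mulrDl mul1r lerDl mulr_ge0.
split=> [h|h s t].
  apply: le_trans (HL _ _ _ _) _; rewrite Y0 Y'0 mulrDl; apply: ler_wpDr.
    by rewrite !mulr_ge0.
  by rewrite ler_wpM2l // lerDl.
(* [(1 + A) * del] dominates the distance of the rough paths as well as that of the solutions at
   time [s]. *)
have [|_ H] := HC X X' Y Y' ((1 + A) * del) h s t.
  have HAs := HA _ _ _ _ _ XY s; have HAst := HA' _ _ _ _ _ XY s t.
  rewrite Y0 Y'0 -/del in HAs HAst; have Dth := powR_ge0 (dist s t) theta.
  split.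
  - split=> //; last by apply: le_trans HAs _; rewrite ler_wpM2r // lerDr.
    by apply: le_trans XX _; rewrite lee_fin; apply: le_trans Adel; rewrite lerDr.
  - by apply: le_trans (Hq _ _ XM eY s t) _; rewrite ler_wpM2r // lerDl.
  - by apply: le_trans (Hq _ _ X'M eY' s t) _; rewrite ler_wpM2r // lerDl.
  - apply: le_trans HAst _; rewrite mulrAC; apply: ler_pM => //; rewrite ?mulr_ge0 //.
    by rewrite ler_wpM2r // lerDr.
apply: le_trans H _; rewrite mulrAC ler_wpM2r ?powR_ge0 // mulrA ler_wpM2r //.
by rewrite lerDr.
Qed.

(** Used with [gamma = alpha] for the Lipschitz bound and with [gamma = beta] for continuity. The
    real majorant [rh] of the distance keeps infinite values out of the estimate. *)
Lemma ito_lyons_dist (gamma M : R) : 0 <= gamma <= alpha -> exists2 C : R, 0 < C &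
  forall xi xi' X X' (rh : R), (rp_norm X <= M%:E)%E -> (rp_norm X' <= M%:E)%E ->
  (rho X X' <= rh%:E)%E ->
  (cp_dist gamma X (ito_lyons_path f xi X) X' (ito_lyons_path f xi' X') <=
    (C * (`|xi - xi'| + rh))%:E)%E.
Proof.
move=> gamma_alpha; have [C C0 HC] := ito_lyons_difference M.
pose c := (1 + T%:num) `^ N%:R; have c0 : 0 <= c := powR_ge0 _ _.
pose k := #|{: 'F_(d; N.-1)}|.
(* The 1 makes the constant positive, so that its product with an infinite distance is infinite. *)
exists (1 + (C + C * c) *+ k) => [|xi xi' X X' rh XM X'M XX].
  by rewrite ltr_wpDr // mulrn_wge0 // addr_ge0 // mulr_ge0.
have [H1 H2] := HC xi xi' X X' rh XM X'M XX.
have rh0 : 0 <= rh by rewrite -lee_fin; apply: le_trans XX; exact: rho_ge0.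
set del := `|xi - xi'| + rh in H1 H2 *; have del0 : 0 <= del by rewrite addr_ge0.
apply: le_trans (cp_dist_le (b := C * c * del) H1 _) _ => [h s t|].
  apply: le_trans (H2 h s t) _; rewrite [C * c * del]mulrAC -[leRHS]mulrA ler_wpM2l ?mulr_ge0 //.
  rewrite powR_exponent_le ?leq_subr ?dist_ge0 ?dist_le //.
  by apply: ltW; case/andP: alpha01.
by rewrite lee_fin -/k -mulrDl [leRHS]mulrDl mul1r mulrnAl lerDr.
Qed.

End ItoLyons.

Theorem proposition4p21 (R : realType) (d n : nat) (T : {posnum R})
    (alpha beta : R) (halpha : 0 < alpha < 1)
    (halpha' : forall m : nat, alpha <> m%:R^-1) (hbeta : 0 < beta < alpha)
    (f : 'I_d -> 'rV[R]_n -> 'rV[R]_n)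
    (hsmooth : forall i, smooth (f i))
    (hbounded : forall i, bounded_derivatives (level alpha).+1 (f i)) :
  let Phi (xi : 'rV[R]_n) (X : rough_path d T alpha) :
      bundle d n T alpha beta := ito_lyons f beta xi X in
  [/\ forall M : R, 0 < M -> exists C : R,
        forall (xi xi' : 'rV[R]_n) (X X' : rough_path d T alpha),
          `|xi| <= M -> `|xi'| <= M ->
          (rp_norm X <= M%:E)%E -> (rp_norm X' <= M%:E)%E ->
          (cp_dist alpha X (fibre (Phi xi X)) X' (fibre (Phi xi' X')) <=
           C%:E * (`|(xi - xi')%R|%:E + rho X X'))%E,
      continuous (fun x : 'rV[R]_n * rough_path d T alpha => Phi x.1 x.2) &
      forall (xi : 'rV[R]_n) (X : rough_path d T alpha), base (Phi xi X) = X].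
Proof.
move=> Phi; have [alpha0 _] := andP halpha; have [beta0 beta_alpha] := andP hbeta.
split=> // [M _|[xi X]].
  have [|C C0 HC] := @ito_lyons_dist R d n T alpha halpha f hsmooth hbounded alpha M.
    by rewrite lexx ltW.
  exists C => xi xi' X X' _ _ XM X'M; have := rho_ge0 X X'.
  (* At infinite distance the right-hand side is infinite and the bound is trivial. *)
  case rhE : (rho X X') => [rh| |] // _; last first.
    by rewrite addey // gt0_muley ?leey // lte_fin.
  by rewrite -EFinD -EFinM; apply: HC => //; rewrite rhE.
have [m Xm] := rp_norm_fin X.
have [|C C0 HC] := @ito_lyons_dist R d n T alpha halpha f hsmooth hbounded beta (m + 1).
  by rewrite !ltW.
(* [g <= 1] keeps the norm of [X'] below [m + 1], where [C] is valid. The distance in the bundle is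
   at most [g + C * (g + g)], strictly less than [(2 * C + 2) * g <= e]. *)
apply/cvg_ballP => e e0; pose g := Num.min 1 (e / (2 * C + 2)).
have C1 : 0 < 2 * C + 2 by rewrite addr_gt0 // mulr_gt0.
have g0 : 0 < g by rewrite lt_min ltr01 divr_gt0.
exists (ball xi g, ball X g) => [|[xi' X'] [/= xig Xg]].
  by split; exact: nbhsx_ballx.
rewrite -ball_normE /= in xig.
have XX : (rho X X' <= g%:E)%E := ltW Xg.
have ge : (2 * C + 2) * g <= e.
  by rewrite mulrC -ler_pdivlMr // /g ge_min lexx orbT.
have Xm1 : (rp_norm X <= (m + 1)%:E)%E by apply: le_trans Xm _; rewrite lee_fin lerDl.
have X'm1 : (rp_norm X' <= (m + 1)%:E)%E.
  by apply: rp_norm_le Xm _; apply: le_trans XX _; rewrite lee_fin /g ge_min lexx.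
have D := HC xi xi' X X' g Xm1 X'm1 XX.
apply: le_lt_trans (leeD XX D) _; rewrite -EFinD lte_fin.
have : C * (`|xi - xi'| + g) <= C * (g + g) by apply: ler_wpM2l; [exact: ltW|rewrite lerD2r; exact: ltW].
by move: ge; rewrite mulrDl; lra.
Qed.
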